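(* For any $t\in(0,1)$ there exists a confetti model $(\mathcal P,\lambda,\rho,\beta)$, with $\lambda\in[0,1]$ and with $\rho$ and $\beta$ (random) positive bounded random variables, for which $\mathrm{CAF}_{\text{red}}(\lambda,\rho,\beta)>t$ but red does not percolate.
   Context: Confetti model $(\mathcal P,\lambda,\rho,\beta)$, $\lambda\in[0,1]$: let $\mathcal P=(X_1,X_2,\dots)$ be a Poisson process of intensity $1$ on $\mathbb R^2\times(0,\infty)$; let $(\rho_i)_{i\ge1}$ be i.i.d. copies of the random variable $\rho$, $(\beta_i)_{i\ge1}$ i.i.d. copies of the random variable $\beta$, and $(\varepsilon_i)_{i\ge1}$ i.i.d. Bernoulli variables equal to $1$ with probability $\lambda$ and to $0$ with probability $1-\lambda$; the four families are independent. $\mathbb P_\lambda,\mathbb E_\lambda$ denote the resulting probability measure and expectation. If $\varepsilon_i=1$, the horizontal ''red'' square $X_i+([-\rho_i/2,\rho_i/2]^2\times\{0\})$ is placed; if $\varepsilon_i=0$, the horizontal ''blue'' square $X_i+([-\beta_i/2,\beta_i/2]^2\times\{0\})$ is placed. A point $(x_1,x_2)\in\mathbb R^2$ is coloured red (resp. blue) if the lowest placed square hit by the vertical upward ray from $(x_1,x_2,0)$ is red (resp. blue). Almost surely every point is coloured by a unique square. $C^{\text{red}}$ is the set of red points of $\mathbb R^2$. Red percolates if $C^{\text{red}}$ has an unbounded connected component almost surely; red does not percolate if almost surely there is no such component. The covered area fraction is $\mathrm{CAF}_{\text{red}}(\lambda,\rho,\beta):=\mathbb E_\lambda\big[\ell(C^{\text{red}}\cap[0,1]^2)\big]$,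 where $\ell$ is Lebesgue measure on $\mathbb R^2$. ''Random'' means that $\rho,\beta$ are allowed to be non-constant random variables. *)

(* Defs.v *)
From HB Require Import structures.
From mathcomp Require Import all_boot all_order all_algebra.
From mathcomp Require Import all_classical all_reals all_analysis.
From mathcomp Require Import measurable_realfun.

Set Implicit Arguments.
Unset Strict Implicit.
Unset Printing Implicit Defensive.

Import Order.TTheory GRing.Theory Num.Theory.
Import numFieldNormedType.Exports.

Local Open Scope classical_set_scope.
Local Open Scope ring_scope.

Section Independence.
Context {R : realType} {d : measure_display} {T : measurableType d}.
Variable P : probability T R.

Definition mutually_independent (I : eqType) (F : I -> set (set T)) : Prop :=
  forall (J : seq I) (A : I -> set T), uniq J ->
    (forall i, i \in J -> F i (A i)) ->
    P (\bigcap_(i in [set` J]) A i) = (\prod_(i <- J) P (A i))%E.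

Definition events_of d' (T' : measurableType d') (Y : T -> T') : set (set T) :=
  [set Y @^-1` B | B in @measurable d' T'].

Definition sigma_of_family d' (T' : measurableType d') (Y : nat -> T -> T') :
    set (set T) :=
  <<s \bigcup_i events_of (Y i) >>.

(* Equality of laws is only required on measurable sets: a probability is a
   function on all subsets whose values off the sigma-algebra are arbitrary. *)
Definition iid_copies d' (T' : measurableType d') (Y : T -> T')
    (Ys : nat -> T -> T') : Prop :=
  (forall i B, measurable B -> P (Ys i @^-1` B) = P (Y @^-1` B)) /\
  mutually_independent (fun i => events_of (Ys i)).

End Independence.

Section PoissonProcess.
Context {R : realType} {d : measure_display} {T : measurableType d}.
Variable P : probability T R.

Definition lebesgue2 : set (R * R) -> \bar R :=
  (@lebesgue_measure R \x @lebesgue_measure R)%E.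

Definition lebesgue3 : set (R * R * R) -> \bar R :=
  ((@lebesgue_measure R \x @lebesgue_measure R) \x @lebesgue_measure R)%E.

Definition upper_half_space : set (R * R * R) := [set p | 0 < p.2].

Definition point_count (X : nat -> T -> R * R * R) (A : set (R * R * R))
    (w : T) : \bar R :=
  counting [set i | A (X i w)].

(* In the independence clause, finite families of disjoint sets are recovered
   by padding the sequence with empty sets. *)
Definition unit_poisson_process (X : nat -> T -> R * R * R) : Prop :=
  [/\ forall i w, upper_half_space (X i w),
      forall (A : set (R * R * R)) (k : nat),
        measurable A -> A `<=` upper_half_space -> (lebesgue3 A < +oo)%E ->
        P [set w | point_count X A w = k%:R%:E] =
          (let m := fine (lebesgue3 A) in
           (expR (- m) * m ^+ k / k`!%:R)%:E)
    & forall A : nat -> set (R * R * R),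
        (forall n, measurable (A n)) ->
        (forall n, A n `<=` upper_half_space) ->
        trivIset setT A ->
        mutually_independent P (fun n => events_of (point_count X (A n)))].

End PoissonProcess.

Record confetti_model (R : realType) := ConfettiModel {
  confetti_display : measure_display;
  confetti_space : measurableType confetti_display;
  confetti_prob : probability confetti_space R;
  lambda : R;
  rho : {RV confetti_prob >-> R};
  beta : {RV confetti_prob >-> R};
  center : nat -> {RV confetti_prob >-> (R * R * R)%type};
  rho_copy : nat -> {RV confetti_prob >-> R};
  beta_copy : nat -> {RV confetti_prob >-> R};
  (* true encodes the value 1, i.e. red *)
  eps : nat -> {RV confetti_prob >-> bool};
  lambda_itv : 0 <= lambda <= 1;
  center_poisson : unit_poisson_process confetti_prob center;
  rho_iid : iid_copies confetti_prob rho rho_copy;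
  beta_iid : iid_copies confetti_prob beta beta_copy;
  eps_bernoulli :
    forall i (B : set bool), confetti_prob (eps i @^-1` B) = bernoulli_prob lambda B;
  eps_indep :
    mutually_independent confetti_prob (fun i => events_of (eps i));
  families_indep :
    mutually_independent confetti_prob
      (tnth [tuple sigma_of_family center; sigma_of_family rho_copy;
                   sigma_of_family beta_copy; sigma_of_family eps])
}.

Section Confetti.
Context {R : realType}.
Variable M : confetti_model R.

Definition square_side (i : nat) (w : confetti_space M) : R :=
  if eps M i w then rho_copy M i w else beta_copy M i w.

Definition placed_square (i : nat) (w : confetti_space M) : set (R * R * R) :=
  let s := square_side i w in
  [set center M i w + q | q in
     (`[- (s / 2), s / 2] `*` `[- (s / 2), s / 2]) `*` [set (0 : R)] ].

Definition upward_ray (x : R * R) : set (R * R * R) :=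
  [set p | p.1 = x /\ 0 <= p.2].

Definition hit (w : confetti_space M) (x : R * R) (i : nat) : Prop :=
  placed_square i w `&` upward_ray x !=set0.

(* Strict inequality: points where two lowest squares tie in height stay
   uncoloured, which almost surely does not occur. *)
Definition lowest_hit (w : confetti_space M) (x : R * R) (i : nat) : Prop :=
  hit w x i /\
  forall j, j != i -> hit w x j -> (center M i w).2 < (center M j w).2.

Definition red_set (w : confetti_space M) : set (R * R) :=
  [set x | exists2 i, lowest_hit w x i & eps M i w].

Definition CAF_red : \bar R :=
  (\int[confetti_prob M]_w
     lebesgue2 (red_set w `&` (`[0%R, 1%R] `*` `[0%R, 1%R])))%E.

Definition red_does_not_percolate : Prop :=
  {ae confetti_prob M, forall w,
     ~ exists2 x, red_set w x &
         ~ bounded_set (connected_component (red_set w) x)}.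

End Confetti.

Definition positive_bounded (R : realType) (T : Type) (Y : T -> R) : Prop :=
  (forall w, 0 < Y w) /\ exists K : R, forall w, Y w <= K.

(* Main.v *)
(** Blue squares have side 2 and red squares have side 2 * 6^k with probability
    proportional to 36^-k, k = 1, ..., n, the overall intensity of the red squares
    of level k being a * 36^-k.

    Red covers a lot: below a small height h a neighbourhood of the unit square
    contains no centre with probability close to 1.  On the other hand, for every
    k <= n the expected number of red squares of level k below height h that cover the
    unit square is at least a constant multiple of a * h, independently of k, so for n
    large some such square exists with probability close to 1.  Then the unit square
    is entirely red.

    Red does not percolate: fix T such that an unoccupied column, one without blue
    centres below height T * h, is unlikely.  A red point lies in such a column or is
    covered by a red square centred below T * h, and the cells of mesh 6^k meeting
    such a square of level k are rare uniformly in k, since a is chosen after T.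
    Call a cell of mesh 1 bad if its column has no low blue centre, and a cell of mesh
    6^(k+1) bad if there is a low red square of level k+1 near it, or if two bad
    cells of mesh 6^k occur at distance exactly 5 inside or near it.  A discrete red
    path leaving a cell of mesh 6^k and going to distance 6^k makes the cell bad.
    Distant cells are independent, so the probability p_k of being bad satisfies
    p_(k+1) <= C p_k^2 + (small), the second term being 0 for k >= n; hence
    p_k -> 0 and almost surely no cell starts an infinite red path.

    The Poisson process is built from i.i.d. uniform variables, with a Poisson number
    of uniform points in every box of a partition of the upper half-space.  The marks
    of the squares may be attached to the global index of a point or to its rank in
    its box without changing their law; the second choice makes the events seen in
    disjoint columns depend on disjoint families of variables. *)
Require Import Defs.
From HB Require Import structures.
From mathcomp Require Import all_boot all_order all_algebra finmap.
From mathcomp Require Import all_classical all_reals all_analysis.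
From mathcomp Require Import measurable_realfun.
From mathcomp Require Import ring lra zify.

Set Implicit Arguments.
Unset Strict Implicit.
Unset Printing Implicit Defensive.

Import Order.TTheory GRing.Theory Num.Theory.
Import numFieldNormedType.Exports.

Local Open Scope classical_set_scope.
Local Open Scope ring_scope.

(** * Product spaces *)

(** The weight 36^-k is the scale-invariant one: a square of level k covers a number of unit cells
    of order 36^k, so every level contributes the same small amount at its own scale. In the
    covering of the unit square these contributions add up over the levels, whereas each step of the
    renormalization meets a single level. The size of its bounds therefore does not depend on n, and
    n can be chosen last.

    The constants are fixed in the order h, e (the bound on the probability of a bad cell), T, a, n.
    This is not circular: the probability lam of red stays below 1/2 for all a <= 1 and all n, so
    the blue intensity that determines T is bounded below in advance.

    The numbers 5 and 6 belong together. Badness of a cell is decided by the columns at coarse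
    distance at most 2, so distance 5 > 2 + 2 separates two cells, while a path going to distance 6
    * 6^k has to meet a coarse cell at distance exactly 5.

    All estimates are made for the marks indexed by box and rank, and are transferred to the marks
    indexed globally by inclusions of events that hold off a null set. *)

Definition coord_events (I : Type) d (T : measurableType d) : set (set (I -> T)) :=
  [set E | exists i A, measurable A /\ E = (fun w => w i) @^-1` A].

Definition Om (I : Type) d (T : measurableType d) := g_sigma_algebraType (@coord_events I d T).

HB.instance Definition _ (I : Type) d (T : measurableType d) :=
  Measurable.on (Om I T).

Section cylinders.
Context (I : eqType) d (T : measurableType d).

Definition cyl (J : seq I) (A : I -> set T) : set (Om I T) :=
  [set w | forall i, i \in J -> A i (w i)].

Lemma measurable_coord (i : I) : measurable_fun [set: Om I T] (fun w => w i).
Proof.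
move=> _ A mA; rewrite setTI; apply: sub_sigma_algebra.
by exists i, A.
Qed.

Lemma measurable_to_Om d' (S : measurableType d') (f : S -> Om I T) :
  (forall i, measurable_fun setT (fun x => f x i)) -> measurable_fun setT f.
Proof.
move=> mf.
apply: (@measurability _ _ S (Om I T) setT f (@coord_events I d T)) => // _ [_ [i [A [mA ->]]] <-].
exact: mf i measurableT A mA.
Qed.

Lemma cyl_cons i J A : cyl (i :: J) A = (fun w => w i) @^-1` A i `&` cyl J A.
Proof.
apply/seteqP; split=> w /=.
  by move=> h; split=> [|j jJ]; apply: h; rewrite inE ?eqxx ?jJ ?orbT.
by move=> [h1 h2] j; rewrite inE => /predU1P[->//|]; exact: h2.
Qed.

Lemma measurable_cyl J A : (forall i, measurable (A i)) -> measurable (cyl J A).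
Proof.
move=> mA; elim: J => [|i J IH].
  by rewrite [X in measurable X](_ : _ = setT)//; apply/seteqP; split.
rewrite cyl_cons; apply: measurableI => //.
by rewrite -[X in measurable X]setTI; exact: measurable_coord.
Qed.

Lemma cylI (J1 J2 : seq I) A1 A2 :
  cyl J1 A1 `&` cyl J2 A2 =
  cyl (undup (J1 ++ J2)) (fun i => (if i \in J1 then A1 i else setT) `&`
                           (if i \in J2 then A2 i else setT)).
Proof.
apply/seteqP; split=> w /=.
  move=> [h1 h2] i _; split; first by case: ifPn => // /h1.
  by case: ifPn => // /h2.
move=> h; split=> i iJ; have := h i; rewrite mem_undup mem_cat iJ ?orbT => /(_ isT)[];
by rewrite ?iJ.
Qed.

Definition has_iid_coords (R : realType) (mu : set T -> \bar R)
   (P : set (Om I T) -> \bar R) :=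
  forall J A, uniq J -> (forall i, measurable (A i)) ->
    P (cyl J A) = (\prod_(i <- J) mu (A i))%E.

(** Cylinders are stable under intersection and generate the sigma-algebra. *)
Lemma Om_measure_unique (R : realType) (P Q : probability (Om I T) R) :
  (forall J A, uniq J -> (forall i, measurable (A i)) -> P (cyl J A) = Q (cyl J A)) ->
  forall E, measurable E -> P E = Q E.
Proof.
move=> PQ E mE.
pose G := [set E | exists J (A : I -> set T), [/\ uniq J, (forall i, measurable (A i)) & E = cyl J A]].
apply: (measure_unique G (fun=> setT)) => //.
- rewrite eqEsubset; split.
    apply: smallest_sub; first exact: smallest_sigma_algebra.
    move=> _ [i [A [mA ->]]]; apply: sub_sigma_algebra.
    exists [:: i], (fun=> A); split => //.
    apply/seteqP; split=> w /=; first by move=> h j; rewrite inE => /eqP ->.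
    by apply; rewrite inE.
  apply: smallest_sub; first exact: sigma_algebra_measurable.
  by move=> _ [J [A [_ mA ->]]]; exact: measurable_cyl.
- move=> _ _ [J1 [A1 [_ mA1 ->]]] [J2 [A2 [_ mA2 ->]]]; rewrite cylI.
  exists (undup (J1 ++ J2)); eexists; split; [exact: undup_uniq| |reflexivity].
  by move=> i; apply: measurableI; case: ifP.
- move=> _; exists [::], (fun=> setT); split => //.
  by apply/seteqP; split.
- by apply/seteqP; split=> // x _; exists 0%N.
- by move=> _ [J [A [uJ mA ->]]]; exact: PQ.
- by move=> _; apply: le_lt_trans (probability_le1 _ _) _; rewrite ?ltry.
Qed.

End cylinders.

Lemma iid_coord (I : eqType) d (T : measurableType d) (R : realType) (mu : set T -> \bar R)
    (P : probability (Om I T) R) i A :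
  has_iid_coords mu P -> measurable A -> P [set w | A (w i)] = mu A.
Proof.
move=> iidP mA; have := @iidP [:: i] (fun=> A) isT (fun=> mA).
rewrite big_seq1 => <-; congr (P _).
by apply/seteqP; split=> c /= hc; [move=> k; rewrite inE => /eqP ->|apply: hc; rewrite inE].
Qed.

Lemma measurable_coord_pre (I : eqType) d (T : measurableType d) (i : I) (A : set T) :
  measurable A -> measurable [set w : Om I T | A (w i)].
Proof. by move=> mA; rewrite -[X in measurable X]setTI; exact: measurable_coord. Qed.

Section law.
Context d d' (S : measurableType d) (T : measurableType d') (R : realType).
Variables (P : probability S R) (f : S -> T).
Hypothesis mf : measurable_fun setT f.

Definition law : probability T R := distribution P (mfun_Sub (mem_set mf)).

Lemma lawE E : law E = P (f @^-1` E).
Proof. by []. Qed.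

End law.

(** * Resampling, and independence of events on disjoint sets of coordinates *)

(** A pointwise substitute for measurability with respect to the coordinates in [S]: independence is
    stated on the full space, without restricted product spaces. *)
Definition depends_on (I U : Type) (S : set I) (E : set (I -> U)) :=
  forall w w', (forall i, S i -> w i = w' i) -> E w -> E w'.

Lemma bigcap_cons (K : eqType) T (k : K) J (E : K -> set T) :
  \bigcap_(i in [set` k :: J]) E i = E k `&` \bigcap_(i in [set` J]) E i.
Proof.
apply/seteqP; split=> w /=.
  by move=> h; split=> [|i /= iJ]; apply: h; rewrite /= inE ?eqxx ?iJ ?orbT.
by move=> [h1 h2] i /=; rewrite inE => /predU1P[->//|]; exact: h2.
Qed.

Section mixing.
Context (I : eqType) d (T : measurableType d) (R : realType).

Definition mix (S : set I) (p : Om I T * Om I T) : Om I T :=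
  fun i : I => (if i \in S then p.1 else p.2) i.

Lemma measurable_mix S : measurable_fun setT (mix S).
Proof.
apply: measurable_to_Om => i; rewrite /mix; case: (i \in S);
  apply: (@measurableT_comp _ _ _ _ (Om I T) T (fun w => w i)) => //;
  exact: measurable_coord.
Qed.

Variables (mu : set T -> \bar R) (P : probability (Om I T) R).
Hypothesis iidP : has_iid_coords mu P.

(** The preimage of a cylinder is a rectangle: its indices in [S] constrain the first sample, the
    others constrain the second. *)
Lemma mix_law S E : measurable E -> (P \x P)%E (mix S @^-1` E) = P E.
Proof.
move=> mE; have := @Om_measure_unique _ _ _ _ (law (P \x P)%E (@measurable_mix S)) P.
move=> /(_ _ E mE) <- // J A uJ mA.
rewrite lawE.
have -> : mix S @^-1` cyl J A =
    cyl [seq i <- J | i \in S] A `*` cyl [seq i <- J | i \notin S] A.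
  apply/seteqP; split=> [[w w'] /= h|[w w'] /= [h1 h2]].
    by split=> i; rewrite mem_filter => /andP[iS /h]; rewrite /mix ?iS// (negbTE iS).
  move=> i iJ; rewrite /mix; case: ifPn => iS.
    by apply: h1; rewrite mem_filter iS.
  by apply: h2; rewrite mem_filter iS.
rewrite /= product_measure1E; [|exact: measurable_cyl|exact: measurable_cyl].
rewrite (iidP uJ mA).
transitivity ((\prod_(i <- [seq i <- J | i \in S]) mu (A i)) *
              (\prod_(i <- [seq i <- J | i \notin S]) mu (A i)))%E.
  by congr (_ * _)%E; apply: iidP => //; exact: filter_uniq.
by rewrite !big_filter [RHS](bigID (fun i => i \in S)).
Qed.

(** Fubini for [mix_law]: the coordinates in [S] are frozen and the others resampled. *)
Lemma mix_integral S E : measurable E ->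
  P E = (\int[P]_w P [set w' | E (mix S (w, w'))])%E.
Proof.
move=> mE; rewrite -(mix_law S mE); apply: eq_integral => w _ /=.
congr (P _); apply/seteqP; split=> w' /=; by rewrite /xsection /= inE.
Qed.

(** Under [mix S] the event [E] is read off the first sample and [F] off the second, so the preimage
    of the intersection is a rectangle. *)
Lemma indep2 (S : set I) (E F : set (Om I T)) : measurable E -> measurable F ->
  depends_on S E -> depends_on (~` S) F -> P (E `&` F) = (P E * P F)%E.
Proof.
move=> mE mF dE dF; rewrite -(mix_law S (measurableI _ _ mE mF)).
have -> : mix S @^-1` (E `&` F) = E `*` F.
  apply/seteqP; split=> [[w w'] /= [h1 h2]|[w w'] /= [h1 h2]]; split.
  - by apply: dE h1 => i Si; rewrite /mix mem_set.
  - by apply: dF h2 => i Si; rewrite /mix memNset.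
  - by apply: dE h1 => i Si; rewrite /mix mem_set.
  - by apply: dF h2 => i Si; rewrite /mix memNset.
by rewrite product_measure1E.
Qed.

Lemma depends_on_sub (S S' : set I) (E : set (Om I T)) :
  S `<=` S' -> depends_on S E -> depends_on S' E.
Proof. by move=> SS dE w w' h; apply: dE => i /SS; exact: h. Qed.

Lemma indep_family (K : eqType) (S : K -> set I) (J : seq K) (E : K -> set (Om I T)) :
  uniq J -> (forall k, k \in J -> measurable (E k)) ->
  (forall k, k \in J -> depends_on (S k) (E k)) ->
  {in J &, forall k k', k != k' -> S k `&` S k' = set0} ->
  P (\bigcap_(k in [set` J]) E k) = (\prod_(k <- J) P (E k))%E.
Proof.
elim: J => [|k J IH] /= => [_ _ _ _|/andP[kJ uJ] mE dE dis].
  by rewrite big_nil classical_sets.set_nil bigcap_set0 probability_setT.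
rewrite big_cons bigcap_cons.
rewrite -IH//; last 3 first.
- by move=> i iJ; apply: mE; rewrite inE iJ orbT.
- by move=> i iJ; apply: dE; rewrite inE iJ orbT.
- by move=> i j iJ jJ; apply: dis; rewrite inE ?iJ ?jJ orbT.
apply: (@indep2 (S k)).
- by apply: mE; rewrite mem_head.
- by apply: fin_bigcap_measurable => // i /= iJ; apply: mE; rewrite inE iJ orbT.
- by apply: dE; rewrite mem_head.
- move=> w w' h /= Ew i iJ; have iJ' : i \in k :: J by rewrite inE iJ orbT.
  apply: (dE _ iJ') (Ew i iJ) => a Sa; apply: h => Ska.
  have ik : k != i by apply: contraNneq kJ => ->.
  have := dis k i (mem_head _ _) iJ' ik.
  by move/seteqP => [/(_ a) + _]; apply.
Qed.

End mixing.

(** * Uniform variables and their binary digits *)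

Section affine.
Context (R : realType).
Variables (a b : R).
Hypothesis a0 : 0 < a.
Local Notation f := (fun x : R => a * x + b).

Lemma measurable_affine : measurable_fun [set: R] f.
Proof. by apply: measurable_funD => //; apply: measurable_funM. Qed.

Lemma lebesgue_affine (A : set R) : measurable A ->
  (a%:E * lebesgue_measure (f @^-1` A))%E = lebesgue_measure A.
Proof.
move=> mA.
have a0' : 0 <= a by exact: ltW.
have mf : @measurable_fun _ _ (measurableTypeR R) (measurableTypeR R) setT f.
  exact: measurable_affine.
pose m' : {measure set (measurableTypeR R) -> \bar R} :=
  mscale (NngNum a0') (@pushforward _ _ (measurableTypeR R) (measurableTypeR R) R lebesgue_measure f).
rewrite [RHS](@lebesgue_measure_unique R (m' mf))//.
move=> _ [[p q]] _ <-; rewrite /m' /mscale/= /pushforward/=.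
transitivity (a%:E * @lebesgue_measure R [set` `](p - b) / a, (q - b) / a]%R])%E; last first.
  congr (_ * lebesgue_measure _)%E; apply/seteqP; split=> x /=;
  by rewrite !in_itv/= ltr_pdivrMr// ler_pdivlMr// [x * a]mulrC ltrBlDr lerBrDr.
rewrite !lebesgue_measure_itv/= !lte_fin ltr_pM2r ?invr_gt0// ltrD2r.
case: ifP => _; last by rewrite mule0.
by rewrite -EFinM; congr EFin; field; rewrite gt_eqF.
Qed.

End affine.

Section unif01.
Context (R : realType).

Definition unif01 : set (measurableTypeR R) -> \bar R :=
  mrestr (@lebesgue_measure R) (measurable_itv `[0, 1[).

HB.instance Definition _ := Measure.on unif01.

Let unif01_setT : unif01 setT = 1%E.
Proof. by rewrite /unif01 /mrestr setTI lebesgue_measure_itv/= lte01 oppr0 adde0. Qed.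

HB.instance Definition _ := Measure_isProbability.Build _ _ _ unif01 unif01_setT.

Lemma unif01E (A : set R) : unif01 A = lebesgue_measure (A `&` `[0, 1[).
Proof. by []. Qed.

Lemma unif01_itv (a b : R) : 0 <= a -> a <= b -> b <= 1 ->
  unif01 `[a, b[ = (b - a)%:E.
Proof.
move=> a0 ab b1; rewrite unif01E setIidl; last first.
  by move=> x /=; rewrite !in_itv/= => /andP[h1 h2]; apply/andP; split; lra.
rewrite lebesgue_measure_itv/= lte_fin.
case: ifPn => [_|]; first by rewrite EFinB.
by rewrite -leNgt => ba; rewrite (_ : b - a = 0)//; lra.
Qed.

Definition b0 (x : R) : bool := 2^-1 <= x.
(** The doubling map of [0, 1[, which removes the first binary digit [b0]. *)
Definition dbl (x : R) : R := if b0 x then 2 * x - 1 else 2 * x.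
Definition bit (x : R) (k : nat) : bool := b0 (iter k dbl x).

Lemma bitS x k : bit x k.+1 = bit (dbl x) k.
Proof. by rewrite /bit iterSr. Qed.

Lemma measurable_b0 : measurable_fun [set: R] b0.
Proof.
by apply: measurable_fun_ler => //.
Qed.

Lemma measurable_dbl : measurable_fun [set: R] dbl.
Proof.
rewrite /dbl; apply: measurable_fun_ifT; first exact: measurable_b0.
  by apply: measurable_funB => //; apply: measurable_funM.
by apply: measurable_funM.
Qed.

Lemma measurable_bit k : measurable_fun [set: R] (fun x => bit x k).
Proof.
apply: (@measurableT_comp _ _ _ _ R _ b0); first exact: measurable_b0.
elim: k => [|k IH] /=; first exact: measurable_id.
by apply: (@measurableT_comp _ _ _ _ R _ dbl setT (iter k dbl)) => //; exact: measurable_dbl.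
Qed.

(** Doubling maps each half of [0, 1[ affinely onto [0, 1[ with slope 2. *)
Lemma unif01_dbl (c : bool) (B : set R) : measurable B ->
  unif01 [set x | b0 x = c /\ B (dbl x)] = ((2^-1)%:E * unif01 B)%E.
Proof.
move=> mB; rewrite !unif01E.
have h := @lebesgue_affine R 2 (- c%:R) (ltr0n _ 2) _ (measurableI _ _ mB (measurable_itv `[0, 1[)).
rewrite -h muleA -EFinM mulVf// mul1e; congr (lebesgue_measure _).
apply/seteqP; split=> x /=; rewrite !in_itv/= /dbl.
  move=> [[<- h1] /andP[x0 x1]]; move: h1; rewrite /b0; case: ifPn => /=; rewrite -?ltNge => hx.
    move=> h1; rewrite (_ : _ + _ = 2 * x - 1)//; split=> //; apply/andP; split; lra.
  rewrite subr0 => h1; split => //; apply/andP; split; lra.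
case: c {h} => /= -[h1] /andP[h2 h3].
  have hb : b0 x by rewrite /b0; lra.
  by rewrite hb; do !split => //; apply/andP; split; lra.
have hb : b0 x = false by apply/negbTE; rewrite /b0 -ltNge; lra.
by rewrite hb; move: h1; rewrite subr0; do !split => //; apply/andP; split; lra.
Qed.

End unif01.

Section precomp.
Context (I I' : eqType) d (T : measurableType d) (R : realType).

Definition precomp (f : I' -> I) (w : Om I T) : Om I' T := fun i => w (f i).

Lemma measurable_precomp f : measurable_fun setT (precomp f).
Proof. by apply: measurable_to_Om => i; exact: measurable_coord. Qed.

Lemma precomp_iid (mu : set T -> \bar R) (P : probability (Om I T) R) f :
  has_iid_coords mu P -> injective f ->
  has_iid_coords mu (law P (measurable_precomp f)).
Proof.
move=> iidP finj J A uJ mA; rewrite lawE.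
(* By injectivity at most one index enters the intersection; this transports the sets along [f]
   without an inverse of [f]. *)
pose A' i := \bigcap_(j in [set j | j \in J /\ f j = i]) A j.
have A'E j : j \in J -> A' (f j) = A j.
  move=> jJ; rewrite /A' (_ : [set _ | _] = [set j]) ?bigcap_set1//.
  by apply/seteqP; split=> k /= => [[_ /finj->//]|->].
have -> : precomp f @^-1` cyl J A = cyl (map f J) A'.
  apply/seteqP; split=> w /= h; first by move=> _ /mapP[j jJ ->]; rewrite A'E//; exact: h.
  by move=> j jJ; rewrite -A'E//; apply: h; exact: map_f.
rewrite iidP ?map_inj_uniq//.
  by rewrite big_map big_seq [RHS]big_seq; apply: eq_bigr => j jJ; rewrite A'E.
move=> i; rewrite /A'.
apply: fin_bigcap_measurable => //.
by apply: (@sub_finite_set _ _ [set` J]) => //= j [].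
Qed.

End precomp.

(** * Independent uniform variables *)

Section bits.
Context (R : realType).
Local Open Scope ereal_scope.

Definition fair (B : set bool) : \bar R := unif01 (@b0 R @^-1` B).

Lemma fair_setT : fair setT = 1.
Proof. by rewrite /fair preimage_setT probability_setT. Qed.

Lemma measurable_b0_dbl (B : set bool) (C : set R) : measurable C ->
  measurable [set x : R | B (b0 x) /\ C (dbl x)].
Proof.
move=> mC; apply: measurableI.
  by rewrite -[X in measurable X]setTI; exact: measurable_b0.
by rewrite -[X in measurable X]setTI; exact: measurable_dbl.
Qed.

Lemma unif01_shift (B : set bool) (C : set R) : measurable C ->
  unif01 [set x | B (b0 x) /\ C (dbl x)] = fair B * unif01 C.
Proof.
pose h c : R := if c \in B then (2^-1)%R else 0%R.
have e (D : set R) : measurable D ->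
    unif01 [set x | B (b0 x) /\ D (dbl x)] = (h true + h false)%:E * unif01 D.
  move=> mD.
  have hc c : unif01 [set x | (B `&` [set c]) (b0 x) /\ D (dbl x)] = (h c)%:E * unif01 D.
    rewrite /h; case: ifPn => [|] Bc.
      rewrite -(unif01_dbl c mD); congr (unif01 _); apply/seteqP; split=> x /= [].
        by move=> [_ ->].
      by move=> -> ?; split => //; split => //; exact/set_mem.
    rewrite mul0e (_ : [set _ | _] = set0) ?measure0//.
    apply/seteqP; split=> x //= -[[Bx xc] _]; move: Bc; rewrite notin_setE; apply.
    by rewrite -xc.
  rewrite EFinD ge0_muleDl ?lee_fin; [|by rewrite /h; case: ifP..].
  rewrite -!hc -measureU; last 3 first.
  - exact: measurable_b0_dbl.
  - exact: measurable_b0_dbl.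
  - by apply/seteqP; split=> x //= -[[[_ ->]] _ [[]]].
  congr (unif01 _); apply/seteqP; split=> x /=.
    by case: (b0 x) => -[? ?]; [left|right].
  by case=> -[[? _] ?].
move=> mC; rewrite e//; congr (_ * _).
(* The case [D = setT] identifies the weight [h true + h false] with [fair B]. *)
have := e setT measurableT; rewrite probability_setT mule1 => <-.
by rewrite /fair; congr (unif01 _); apply/seteqP; split=> x //= [].
Qed.

Lemma unif01_bits n (B : nat -> set bool) :
  unif01 [set x : R | forall k, (k < n)%N -> B k (bit x k)] = \prod_(k < n) fair (B k).
Proof.
have mB m (B' : nat -> set bool) : measurable [set x : R | forall k, (k < m)%N -> B' k (bit x k)].
  rewrite (_ : [set _ | _] = \bigcap_(k in `I_m) ((fun x => bit x k) @^-1` B' k)).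
    apply: fin_bigcap_measurable => // k _.
    by rewrite -[X in measurable X]setTI; exact: measurable_bit.
  by apply/seteqP; split=> x.
elim: n B => [|n IH] B.
  rewrite big_ord0 (_ : [set _ | _] = setT) ?probability_setT//.
  by apply/seteqP; split.
rewrite big_ord_recl -(IH (fun k => B k.+1)) -unif01_shift; last exact: (mB n (fun k => B k.+1)).
congr (unif01 _); apply/seteqP; split=> x /=.
  move=> h; split; first exact: (h 0%N).
  by move=> k kn; rewrite -bitS; exact: h.
by move=> [h1 h2] [|k] // kn; rewrite bitS; exact: h2.
Qed.

Lemma measurable_bits : measurable_fun setT (@bit R : _ -> Om nat bool).
Proof. by apply: measurable_to_Om => k; exact: measurable_bit. Qed.

(** The infinite product of fair coins, obtained from Lebesgue measure as the law of the digits of a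
    uniform point. *)
Definition Pbits : probability (Om nat bool) R := law (@unif01 R) measurable_bits.

Lemma Pbits_iid : has_iid_coords fair Pbits.
Proof.
move=> J A uJ mA; rewrite lawE.
pose n := (\max_(j <- J) j).+1.
have Jn j : j \in J -> (j < n)%N by move=> jJ; rewrite ltnS; exact: leq_bigmax_seq.
pose B k := if k \in J then A k else setT.
transitivity (unif01 [set x : R | forall k, (k < n)%N -> B k (bit x k)]).
  congr (unif01 _); apply/seteqP; split=> x /= h.
    by move=> k kn; rewrite /B; case: ifPn => // kJ; exact: h.
  by move=> j jJ; have := h j (Jn _ jJ); rewrite /B jJ.
rewrite unif01_bits -(big_mkord xpredT (fun k => fair (B k))).
have nJ : perm_eq [seq i <- index_iota 0 n | i \in J] J.
  apply: uniq_perm => //; first exact/filter_uniq/iota_uniq.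
  by move=> j; rewrite mem_filter mem_index_iota leq0n/= andbC; case: (boolP (j \in J)) => [/Jn ->|]; rewrite ?andbF.
rewrite (bigID (fun k => k \in J)) /= [X in _ * X]big1 ?mule1; last first.
  by move=> k kJ; rewrite /B (negbTE kJ) fair_setT.
rewrite -big_filter (perm_big _ nJ).
by rewrite big_seq [RHS]big_seq; apply: eq_bigr => j jJ; rewrite /B jJ.
Qed.

Definition from_bits (b : Om nat bool) : R :=
  fine (\sum_(k <oo) ((b k)%:R / 2 ^+ k.+1)%:E).

Lemma measurable_from_bits : measurable_fun setT from_bits.
Proof.
apply: (@measurableT_comp _ _ _ _ _ _ fine) => //.
apply: (ge0_emeasurable_sum (h := fun k (b : Om nat bool) => ((b k)%:R / 2 ^+ k.+1)%:E) (P := xpredT)).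
  by move=> k x _ _; rewrite lee_fin divr_ge0// exprn_ge0.
move=> k _; apply/measurable_EFinP; apply: measurable_funM => //.
apply: (@measurableT_comp _ _ _ _ _ _ (fun b : bool => b%:R : R)) => //.
exact: measurable_coord.
Qed.

Lemma from_bits_bit (x : R) : (0 <= x < 1)%R -> from_bits (bit x) = x.
Proof.
move=> x01.
have it n : (0 <= iter n (@dbl R) x < 1)%R.
  elim: n => [//|n /= /andP[h1 h2]]; rewrite /dbl /b0; case: ifPn; rewrite -?ltNge => h3; apply/andP; split; lra.
(* Telescoping: what remains of [x] after [n] digits is its [n]-th doubling divided by [2 ^+ n]. *)
have ps n : (\sum_(0 <= k < n) ((bit x k)%:R / 2 ^+ k.+1))%R = (x - iter n (@dbl R) x / 2 ^+ n)%R.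
  elim: n => [|n IH]; first by rewrite big_geq// expr0 divr1 subrr.
  rewrite big_nat_recr//= IH /bit exprS /dbl; case: (b0 _) => /=.
    by field; rewrite expf_eq0 /= pnatr_eq0 andbF.
  by field; rewrite expf_eq0 /= pnatr_eq0 andbF.
rewrite /from_bits.
rewrite (_ : (\sum_(k <oo) _) = x%:E)//.
apply/cvg_lim => //.
rewrite (_ : (fun n => _) = EFin \o (fun n => (x - iter n (@dbl R) x / 2 ^+ n)%R)); last first.
  by apply/funext => n /=; rewrite sumEFin ps.
apply/fine_cvgP; split; first exact: nearW.
rewrite [X in X @ _ --> _](_ : _ = (fun n => (x - iter n (@dbl R) x / 2 ^+ n)%R))//.
rewrite -[X in _ --> X]subr0; apply: cvgB; first exact: cvg_cst.
apply: (@squeeze_cvgr _ _ _ _ (fun=> 0%R) (fun n => (2^-1 ^+ n)%R)).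
- apply: nearW => n; have /andP[h1 h2] := it n.
  rewrite divr_ge0 ?exprn_ge0//= exprVn -[leRHS]mul1r.
  by rewrite ler_wpM2r ?invr_ge0 ?exprn_ge0// ltW.
- exact: cvg_cst.
- by apply: cvg_expr; rewrite ger0_norm ?invr_ge0// invf_lt1// ltr1n.
Qed.

End bits.

Section iid_uniform.
Context (I : countType) (R : realType).
Local Open Scope ereal_scope.

(** A doubly indexed array of bits is cut into rows, and each row is read as the expansion of one
    uniform variable. *)
Let row (i : I) : Om (I * nat)%type bool -> Om nat bool := precomp (fun j => (i, j)).

Definition rows (w : Om (I * nat)%type bool) : Om I R := fun i => from_bits R (row i w).

Lemma measurable_rows : measurable_fun setT rows.
Proof.
apply: measurable_to_Om => i.
by apply: (@measurableT_comp _ _ _ _ _ _ (@from_bits R)); [exact: measurable_from_bits|exact: measurable_precomp].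
Qed.

Definition Pbits2 : probability (Om (I * nat)%type bool) R :=
  law (Pbits R) (@measurable_precomp nat (I * nat)%type _ bool choice.pickle).

Definition Punif : probability (Om I R) R := law Pbits2 measurable_rows.

Lemma Pbits2_iid : has_iid_coords (@fair R) Pbits2.
Proof. by apply: precomp_iid; [exact: Pbits_iid|exact: (pcan_inj choice.pickleK)]. Qed.

(** A row has the law of the digits of a uniform point, and [from_bits] recovers that point. *)
Lemma law_val_row i (A : set R) : measurable A ->
  Pbits2 ((fun w => from_bits R (row i w)) @^-1` A) = unif01 A.
Proof.
move=> mA.
have mvA : measurable (from_bits R @^-1` A).
  by rewrite -[X in measurable X]setTI; exact: measurable_from_bits.
have rinj : injective (fun j : nat => (i, j)) by move=> ? ? [].
have mr := @measurable_precomp (I * nat)%type nat _ bool (fun j => (i, j)).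
have := @Om_measure_unique _ _ _ _ (law Pbits2 mr) (Pbits R) _ _ mvA.
rewrite !lawE => -> //; last first.
  move=> J B uJ mB; rewrite (Pbits_iid R uJ mB).
  by have -> := precomp_iid Pbits2_iid rinj uJ mB.
have mA' : measurable ((@bit R) @^-1` (from_bits R @^-1` A)).
  by rewrite -[X in measurable X]setTI; exact: measurable_bits.
rewrite !unif01E; congr (lebesgue_measure _).
apply/seteqP; split=> x /= [h]; rewrite in_itv/= => x01; split => //; last first.
  by rewrite from_bits_bit.
by move: h; rewrite from_bits_bit.
Qed.

Lemma Punif_iid : has_iid_coords (T := R) (@unif01 R) Punif.
Proof.
move=> J A uJ mA; rewrite lawE.
have -> : rows @^-1` cyl J A = \bigcap_(i in [set` J]) ((fun w => from_bits R (row i w)) @^-1` A i).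
  by apply/seteqP; split=> w /= h i; exact: h.
rewrite (@indep_family _ _ _ _ _ _ Pbits2_iid _ (fun i => [set p | p.1 = i])) //.
- by apply: eq_bigr => i _; apply: law_val_row.
- move=> i _; rewrite -[X in measurable X]setTI.
  apply: (@measurableT_comp _ _ _ _ _ _ (@from_bits R)) => //; [exact: measurable_from_bits|exact: measurable_precomp].
- move=> i _ w w' h /=; rewrite (_ : row i w = row i w')//.
  by apply/funext => j; rewrite /row /precomp; exact: h.
- move=> i i' _ _ ii'; apply/seteqP; split=> p //= -[h1 h2].
  by move/eqP: ii'; rewrite -h1 -h2.
Qed.

End iid_uniform.

Lemma measurable_countable_case d d' (T : measurableType d) (U : measurableType d')
  (K : countType) (f : T -> K) (g : K -> T -> U) :
  (forall k, measurable [set x | f x = k]) ->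
  (forall k, measurable_fun setT (g k)) ->
  measurable_fun setT (fun x => g (f x) x).
Proof.
move=> mf mg _ A mA; rewrite setTI.
rewrite (_ : _ @^-1` A = \bigcup_k ([set x | f x = k] `&` g k @^-1` A)).
  apply: countable_bigcupT_measurable => // k; apply: measurableI => //.
  by rewrite -[X in measurable X]setTI; exact: mg.
apply/seteqP; split=> x /=; first by move=> Ax; exists (f x).
by move=> [k _ [<-]].
Qed.

(** * Random relabelling of the marks *)

Section relabel.
Context (C M' : eqType) (M : countType) d (T : measurableType d) (R : realType).
Variables (mu : set T -> \bar R) (P : probability (Om (C + M)%type T) R).
Hypothesis mu0 : forall A, (0 <= mu A)%E.
Hypothesis iidP : has_iid_coords mu P.
Variable sigma : Om C T -> M' -> M.
Hypothesis sigma_inj : forall c, injective (sigma c).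
Hypothesis sigma_meas : forall i m, measurable [set c | sigma c i = m].

Definition centers (Mx : Type) (w : Om (C + Mx)%type T) : Om C T := fun c => w (inl c).

Lemma measurable_centers (Mx : eqType) : measurable_fun setT (@centers Mx).
Proof. by apply: measurable_to_Om => c; exact: measurable_coord. Qed.

Definition relabel_idx (c : Om C T) (i : C + M') : C + M :=
  match i with inl a => inl a | inr m => inr (sigma c m) end.

Definition relabel (w : Om (C + M)%type T) : Om (C + M')%type T :=
  fun i => w (relabel_idx (centers w) i).

Lemma measurable_relabel : measurable_fun setT relabel.
Proof.
apply: measurable_to_Om => -[a|m] /=; first exact: measurable_coord.
rewrite /relabel /=.
apply: (@measurable_countable_case _ _ _ _ M (fun w => sigma (centers w) m) (fun k w => w (inr k))).
  by move=> k; have := @measurable_centers M measurableT _ (sigma_meas m k); rewrite setTI.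
by move=> k; exact: measurable_coord.
Qed.

(** Once the centres are frozen by [mix_integral], the relabelling is a fixed injection of indices,
    which preserves i.i.d. coordinates by [precomp_iid]. The conditional probability of the mark
    constraints is then a constant, so the integral factors. *)
Lemma relabel_iid : has_iid_coords mu (law P measurable_relabel).
Proof.
move=> J A uJ mA; rewrite lawE.
have mcyl : measurable (relabel @^-1` cyl J A).
  by rewrite -[X in measurable X]setTI; apply: measurable_relabel => //; exact: measurable_cyl.
rewrite (mix_integral iidP (range inl) mcyl).
pose isl (i : C + M') := if i is inl _ then true else false.
pose JC := pmap (fun i : C + M' => if i is inl a then Some a else None) J.
pose J2 := [seq i <- J | ~~ isl i].
pose E1 : set (Om (C + M)%type T) := cyl (map inl JC) (fun i => if i is inl a then A (inl a) else setT).
pose k := (\prod_(i <- J2) mu (A i))%E.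
have memJC a : (a \in JC) = (inl a \in J).
  by rewrite /JC; elim: (J) => [//|[b|b] s IH] /=; rewrite !inE IH.
have uJC : uniq JC.
  rewrite /JC; elim: (J) uJ => [//|[b|b] s IH] /= /andP[bs us]; last exact: IH.
  rewrite IH// andbT; apply: contra bs.
  by elim: (s) => [//|[e|e] s' IH'] /=; rewrite !inE // => /orP[/eqP ->|/IH' ->]; rewrite ?eqxx ?orbT.
have mE1 : measurable E1 by apply: measurable_cyl => -[].
have rE (w w' : Om (C + M)%type T) i : relabel (mix (range inl) (w, w')) i =
    if i is inl a then w (inl a) else precomp (relabel_idx (centers w)) w' i.
  have -> : relabel (mix (range inl) (w, w')) i = mix (range inl) (w, w') (relabel_idx (centers w) i).
    rewrite /relabel (_ : centers (mix (range inl) (w, w')) = centers w)//.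
    by rewrite /centers; apply: boolp.functional_extensionality_dep => c; rewrite /centers /mix mem_set//; exists c.
  case: i => [a|m] /=; rewrite /mix; first by rewrite mem_set//; exists a.
  by rewrite memNset// => -[].
transitivity (\int[P]_w ((\1_E1 w)%:E * k))%E.
  apply: eq_integral => w _.
  rewrite indicE; case: (boolP (w \in E1)) => [/set_mem|] wE.
    rewrite mul1e.
    have tinj : injective (relabel_idx (centers w)).
      by move=> [a|m] [b|m'] //= [] => [->|/sigma_inj ->].
    rewrite /k; rewrite -(precomp_iid iidP tinj (filter_uniq _ uJ) mA) lawE.
    congr (P _); apply/seteqP; split=> w' /=.
      by move=> h [a|m]; rewrite mem_filter//= => mJ; have := h _ mJ; rewrite rE.
    move=> h [a|m] iJ; rewrite rE.
      by apply: (wE (inl a)); rewrite mem_map ?memJC//; exact: inl_inj.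
    by have := h (inr m); rewrite mem_filter /= iJ => /(_ isT).
  rewrite mul0e (_ : [set _ | _] = set0) ?measure0//.
  apply/seteqP; split=> w' //= h; move: wE; rewrite notin_setE; apply => _ /mapP[a aJ ->].
  have := h (inl a); rewrite -memJC aJ => /(_ isT).
  by rewrite rE.
rewrite ge0_integralZr//; last 2 first.
- by apply/measurable_EFinP; exact: measurable_indic.
- by rewrite /k; apply: prode_ge0 => i _.
rewrite integral_indic// setIT.
transitivity ((\prod_(i <- map inl JC : seq (C + M)) mu (if i is inl a then A (inl a) else [set: T] : set T)) * k)%E.
  by congr (_ * _)%E; apply: iidP; [rewrite map_inj_uniq//; exact: inl_inj|case].
rewrite [RHS](bigID isl)/= /k /J2 big_filter; congr (_ * _)%E.
rewrite big_map /JC.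
elim: (J) => [|[b|b] s IH] /=; rewrite ?big_nil// !big_cons/= ?IH//.
Qed.

End relabel.

(** * Independence of generated sigma-algebras *)

Section pi_systems.
Context d (T : measurableType d) (R : realType) (P : probability T R).
Context (I : eqType) (G : I -> set (set T)).
Hypothesis Gm : forall i, G i `<=` measurable.
Hypothesis GI : forall i, setI_closed (G i).
Hypothesis indG : mutually_independent P G.

Let sGm i : <<s G i >> `<=` measurable.
Proof. by apply: smallest_sub; [exact: sigma_algebra_measurable|exact: Gm]. Qed.

(** The indices are upgraded one at a time: those of [J1] already carry the generated
    sigma-algebras, those of [J2] still the pi-systems. *)
Let pi_indep_step (J1 J2 : seq I) (A : I -> set T) : uniq (J1 ++ J2) ->
  (forall i, i \in J1 -> <<s G i >> (A i)) -> (forall i, i \in J2 -> G i (A i)) ->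
  P (\bigcap_(i in [set` J1 ++ J2]) A i) = (\prod_(i <- J1 ++ J2) P (A i))%E.
Proof.
elim: J1 J2 A => [|i J1 IH] J2 A /=; first by move=> uJ _ h; exact: indG.
move=> /andP[iJ uJ] hA1 hA2.
have sA k : k \in J1 ++ J2 -> measurable (A k).
  rewrite mem_cat => /orP[kJ|kJ]; last by apply: Gm; exact: hA2.
  by apply: sGm; apply: hA1; rewrite inE kJ orbT.
pose E := \bigcap_(k in [set` J1 ++ J2]) A k.
have mE : measurable E by apply: fin_bigcap_measurable => // k /= /sA.
have PE : P E = (\prod_(k <- J1 ++ J2) P (A k))%E.
  by apply: IH => // k kJ; apply: hA1; rewrite inE kJ orbT.
have fPE : P E \is a fin_num by rewrite fin_num_measure.
have c0 : 0 <= fine (P E) by rewrite fine_ge0.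
rewrite big_cons bigcap_cons -PE -/E.
(* Both sides are measures of the set at index [i], the other sets being frozen in [E]; it suffices
   to compare them on the pi-system. *)
pose m1 : {measure set T -> \bar R} := mrestr P mE.
pose m2 : {measure set T -> \bar R} := mscale (NngNum c0) P.
have m2E B : m2 B = (P B * P E)%E by rewrite /m2 /= /mscale /= fineK// muleC.
rewrite -m2E -[LHS]/(m1 (A i)).
(* Adding [setT] gives the generator an exhausting sequence and keeps it stable under
   intersection. *)
pose G' := G i `|` [set setT].
have G'm : G' `<=` measurable by move=> B [/Gm//|->].
apply: (@g_sigma_algebra_measure_unique _ _ _ G' G'm (fun=> setT)) => //.
- by move=> _; right.
- by apply/seteqP; split=> // x _; exists 0%N.
- move=> B C [GB|->]; last by rewrite setTI.
  by move=> [GC|->]; [left; exact: GI|rewrite setIT; left].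
- move=> B [GB|->].
    rewrite m2E /m1 /= /mrestr.
    pose A' k := if k == i then B else A k.
    have A'E k : k \in J1 ++ J2 -> A' k = A k.
      by move=> kJ; rewrite /A'; case: eqP => // ki; move: iJ; rewrite -ki kJ.
    have := IH (i :: J2) A'.
    have pe : perm_eq (J1 ++ i :: J2) (i :: (J1 ++ J2)) by rewrite perm_catC/= perm_cons perm_catC.
    rewrite (perm_uniq pe) /= iJ uJ => /(_ isT).
    rewrite (perm_big _ pe)/= big_cons.
    have -> : [set` J1 ++ i :: J2] = [set` i :: (J1 ++ J2)].
      by apply/seteqP; split=> k /=; rewrite (perm_mem pe).
    rewrite bigcap_cons /A' eqxx -/A'.
    have -> : \bigcap_(k in [set` J1 ++ J2]) A' k = E.
      by apply: eq_bigcapr => k /= kJ; rewrite A'E.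
    rewrite (eq_big_seq (fun k => P (A k))); last by move=> k kJ; rewrite -/(A' k) A'E.
    rewrite -PE; apply.
      move=> k kJ; rewrite -/(A' k) A'E ?mem_cat ?kJ//; apply: hA1.
      by rewrite inE kJ orbT.
    move=> k; rewrite inE => /predU1P[->|kJ]; first by rewrite eqxx.
    by rewrite -/(A' k) A'E ?mem_cat ?kJ ?orbT//; exact: hA2.
  by rewrite m2E probability_setT mul1e /m1 /= /mrestr setTI.
- by move=> _; rewrite /m1 /= /mrestr setTI ltey_eq fPE.
- have GG' : G i `<=` G' by move=> B GB; left.
  by apply: (sub_sigma_algebra2 GG'); apply: hA1; rewrite mem_head.
Qed.

Lemma mutually_independent_g_sigma : mutually_independent P (fun i => <<s G i >>).
Proof.
move=> J A uJ hA; have := @pi_indep_step J [::] A.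
by rewrite cats0; apply.
Qed.

End pi_systems.

(** * Poisson laws: thinning and superposition *)

Definition pois (R : realType) (h : R) (k : nat) : R := expR (- h) * h ^+ k / k`!%:R.

Lemma measure_fin_split d (T : measurableType d) (R : realType) (P : {measure set T -> \bar R})
   (K : finType) (f : T -> K) (E : set T) :
  measurable E -> (forall c, measurable [set x | f x = c]) ->
  P E = (\sum_(c : K) P (E `&` [set x | f x = c]))%E.
Proof.
move=> mE mf.
transitivity (P (\bigcup_(c in [set` index_enum K]) (E `&` [set x | f x = c]))).
  congr (P _); apply/seteqP; split=> x /=; last by move=> [c _ []].
  by move=> Ex; exists (f x) => //=; rewrite mem_index_enum.
rewrite measure_fin_bigcup//; last 2 first.
- by move=> c c' _ _ [x [/= [_ ->] [_ ->]]].
- by move=> c _; exact: measurableI.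
by rewrite -fsbig_seq//; exact: index_enum_uniq.
Qed.

Lemma measurable_fiber d (T : measurableType d) (f : T -> nat) n :
  measurable_fun setT f -> measurable [set x | f x = n].
Proof. by move=> mf; rewrite -[X in measurable X]setTI; exact: (mf _ [set n]). Qed.

Lemma measurable_addn d (T : measurableType d) (f g : T -> nat) :
  measurable_fun setT f -> measurable_fun setT g ->
  measurable_fun setT (fun x => f x + g x)%N.
Proof.
move=> mf mg.
apply: (@measurable_countable_case _ _ _ _ nat f (fun k x => (k + g x)%N)).
  by move=> k; exact: measurable_fiber.
by move=> k; apply: (@measurableT_comp _ _ _ _ _ _ (addn k)).
Qed.

Lemma measurable_sumn d (T : measurableType d) (I : Type) (s : seq I) (f : I -> T -> nat) :
  (forall i, measurable_fun setT (f i)) ->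
  measurable_fun setT (fun x => \sum_(i <- s) f i x)%N.
Proof.
move=> mf; elim: s => [|i s IH].
  by under eq_fun do rewrite big_nil; exact: measurable_cst.
under eq_fun do rewrite big_cons; exact: measurable_addn.
Qed.

Section multinomial.
Context (R : realType) (K : finType) (p : K -> R).

Definition deck (k : K -> nat) (c : K) : K -> nat := fun c' => (k c' - (c' == c))%N.

(** For a probability vector [p], the probability that [n] independent labels have counts [k],
    computed by conditioning on the first label. *)
Fixpoint wcount (n : nat) (k : K -> nat) : R :=
  if n is n'.+1 then \sum_(c | (0 < k c)%N) p c * wcount n' (deck k c)
  else [forall c, k c == 0%N]%:R.

Lemma sum_deck k c : (0 < k c)%N -> (\sum_c' k c' = (\sum_c' deck k c c').+1)%N.
Proof.
move=> kc; rewrite (bigD1 c)//= [in RHS](bigD1 c)//= /deck eqxx.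
rewrite [in RHS](eq_bigr k); last by move=> i /negbTE ->; rewrite subn0.
by rewrite -addSn -subSn// subn1.
Qed.

Lemma prod_deck_fact k c : (0 < k c)%N ->
  (\prod_c' (k c')`! = k c * \prod_c' (deck k c c')`!)%N.
Proof.
move=> kc; rewrite (bigD1 c)//= [in RHS](bigD1 c)//= /deck eqxx mulnA.
rewrite [in RHS](eq_bigr (fun i => (k i)`!)); last by move=> i /negbTE ->; rewrite subn0.
by congr (_ * _)%N; case: (k c) kc => // m _; rewrite subn1 factS.
Qed.

Lemma prod_deck_pow k c : (0 < k c)%N ->
  p c * \prod_c' p c' ^+ deck k c c' = \prod_c' p c' ^+ k c'.
Proof.
move=> kc; rewrite (bigD1 c)//= [in RHS](bigD1 c)//= /deck eqxx mulrA.
rewrite (eq_bigr (fun i => p i ^+ k i)); last by move=> i /negbTE ->; rewrite subn0.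
by congr (_ * _); case: (k c) kc => // m _; rewrite subn1 exprS.
Qed.

(** The multinomial formula, cleared of denominators so that the recursion goes through without
    division. *)
Lemma wcountE n k : wcount n k * (\prod_c (k c)`!)%N%:R =
  if n == (\sum_c k c)%N then n`!%:R * \prod_c p c ^+ k c else 0.
Proof.
elim: n k => [|n IH] k /=.
  case: (boolP [forall c, k c == 0%N]) => [/forallP k0|].
    rewrite !big1 ?eqxx ?mul1r//.
    - by move=> c _; rewrite (eqP (k0 c)).
    - by move=> c _; rewrite (eqP (k0 c)).
    - by move=> c _; rewrite (eqP (k0 c)).
  rewrite negb_forall mul0r => /existsP[c kc]; case: eqP => // /esym/eqP.
  by rewrite sum_nat_eq0 => /forallP/(_ c)/=; rewrite (negbTE kc).
rewrite mulr_suml.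
transitivity (\sum_(c | (0 < k c)%N) (k c)%:R *
   (if n.+1 == (\sum_c' k c')%N then n`!%:R * \prod_c' p c' ^+ k c' else 0)).
  apply: eq_bigr => c kc.
  rewrite (prod_deck_fact kc) natrM -mulrA (mulrCA (wcount _ _)) IH (sum_deck kc) eqSS.
  rewrite mulrCA; congr (_ * _).
  by case: ifP => _; rewrite ?mulr0// mulrCA prod_deck_pow.
rewrite -mulr_suml.
case: eqP => [e|]; last by rewrite mulr0.
rewrite mulrA; congr (_ * _); rewrite factS natrM; congr (_ * _).
rewrite e natr_sum [RHS](bigID (fun c => (0 < k c)%N))/= [X in _ = _ + X]big1 ?addr0//.
by move=> c; rewrite lt0n negbK => /eqP ->.
Qed.

End multinomial.

Section thinning.
Context d (T : measurableType d) (R : realType) (P : probability T R).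
Context (K : finType) (N : T -> nat) (L : nat -> T -> K).
Context (h : R) (p : K -> R).
Hypothesis mN : measurable_fun setT N.
Hypothesis mL : forall j c, measurable [set w | L j w = c].
Hypothesis NL : forall n (l : nat -> K),
  P ([set w | N w = n] `&` [set w | forall j, (j < n)%N -> L j w = l j]) =
  (pois h n * \prod_(j < n) p (l j))%:E.
Hypothesis p1 : \sum_c p c = 1.

Definition lcount (s n : nat) (w : T) (c : K) : nat := (\sum_(s <= j < n) (L j w == c))%N.

Lemma measurable_lcount s n (k : K -> nat) : measurable [set w | forall c, lcount s n w c = k c].
Proof.
rewrite (_ : [set w | _] = \bigcap_(c in [set: K]) [set w | lcount s n w c = k c]); last first.
  by apply/seteqP; split=> w /= hh c; [move=> _|]; exact: hh.
apply: fin_bigcap_measurable => // c _.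
have : measurable_fun setT (fun w => lcount s n w c).
  apply: measurable_sumn => j.
  apply: (@measurableT_comp _ _ _ _ _ _ nat_of_bool) => //.
  apply: (measurable_fun_bool true); rewrite setTI.
  by rewrite (_ : _ @^-1` _ = [set w | L j w = c])//; apply/seteqP; split=> w /= /eqP.
exact: measurable_fiber.
Qed.

Lemma lcount_recl s n w c : (s < n)%N -> lcount s n w c = ((L s w == c) + lcount s.+1 n w c)%N.
Proof. by move=> sn; rewrite /lcount big_ltn. Qed.

(** The prefix [l] of labels already revealed is generalised: revealing the label [s] turns a
    statement about [s] into one about [s.+1] with fewer labels left. *)
Lemma prob_lcount s n (l : nat -> K) (k : K -> nat) : 
  P ([set w | N w = (s + n)%N] `&` [set w | forall j, (j < s)%N -> L j w = l j] `&`
     [set w | forall c, lcount s (s + n) w c = k c]) =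
  (pois h (s + n) * \prod_(j < s) p (l j) * wcount p n k)%:E.
Proof.
have mNn m : measurable [set w | N w = m].
  exact: measurable_fiber.
have mpre m (l' : nat -> K) : measurable [set w | forall j, (j < m)%N -> L j w = l' j].
  rewrite (_ : [set w | _] = \bigcap_(j in `I_m) [set w | L j w = l' j]).
    by apply: fin_bigcap_measurable.
  by apply/seteqP; split=> w.
elim: n s l k => [|n IH] s l k.
  rewrite addn0 /=; case: (boolP [forall c, k c == 0%N]) => [/forallP k0|].
    rewrite mulr1 -NL; congr (P _); rewrite setIidl// => w _ c.
    by rewrite /= /lcount big_geq// (eqP (k0 c)).
  rewrite negb_forall mulr0 => /existsP[c kc].
  rewrite (_ : _ `&` _ = set0) ?measure0//; apply/seteqP; split=> w //= -[_ /(_ c)].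
  by rewrite /lcount big_geq// => /esym/eqP; rewrite (negbTE kc).
rewrite (@measure_fin_split _ _ _ _ K (L s)); last 2 first.
- by do !apply: measurableI => //; exact: measurable_lcount.
- exact: mL.
transitivity (\sum_(c : K) (if (0 < k c)%N then pois h (s + n.+1) * \prod_(j < s) p (l j) * (p c * wcount p n (deck k c)) else 0)%:E)%E.
  apply: eq_bigr => c _.
  pose l' j := if j == s then c else l j.
  case: ifPn => kc; last first.
    rewrite (_ : _ `&` _ = set0) ?measure0//; apply/seteqP; split=> w //= -[[_ /(_ c)]].
    rewrite lcount_recl ?addnS ?ltnS ?leq_addr// => e Ls.
    by move: kc; rewrite -e Ls eqxx.
  have := IH s.+1 l' (deck k c).
  rewrite big_ord_recr /= /l' eqxx.
  under eq_bigr do rewrite ltn_eqF//.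
  rewrite addSnnS -!mulrA => <-; congr (P _); apply/seteqP; split=> w /=.
    move=> [[[-> h1] h2] h3]; do !split => //.
      move=> j; rewrite ltnS leq_eqVlt => /predU1P[->|js]; first by rewrite eqxx.
      by rewrite ltn_eqF// h1.
    move=> c'; have := h2 c'; rewrite lcount_recl ?addnS ?ltnS ?leq_addr// /deck h3 => <-.
    by rewrite eq_sym addKn.
  move=> [[-> h1] h2]; have h3 : L s w = c by rewrite h1// eqxx.
  do !split => //.
    by move=> j js; have := h1 j (ltnW js); rewrite ltn_eqF.
  move=> c'; rewrite lcount_recl ?addnS ?ltnS ?leq_addr// -addnS h2 /deck h3 eq_sym subnKC//.
  by case: eqP => // ->.
by rewrite sumEFin -big_mkcond/= -mulr_sumr.
Qed.

(** The factorial of the total count cancels between the Poisson and the multinomial weights, and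
    [p1] splits the exponential over the labels. *)
Lemma thinning (k : K -> nat) :
  P [set w | forall c, lcount 0 (N w) w c = k c] =
  (\prod_c pois (h * p c) (k c))%:E.
Proof.
have sumk n w : (\sum_c lcount 0 n w c = n)%N.
  rewrite /lcount exchange_big /= -[RHS]subn0 -[RHS]muln1 -sum_nat_const_nat.
  apply: eq_bigr => j _; rewrite (bigD1 (L j w))//= eqxx big1// => c.
  by rewrite eq_sym => /negbTE ->.
pose n := (\sum_c k c)%N.
(* There is a label because [p] sums to 1; [c0] only serves to instantiate the empty prefix. *)
have [c0|K0] := pickP [pred c : K | true]; last first.
  exfalso; move: p1; rewrite big1; first by move/eqP; rewrite eq_sym oner_eq0.
  by move=> c _; have := K0 c.
have := @prob_lcount 0 n (fun=> c0) k.
rewrite add0n big_ord0 mulr1 (_ : _ `&` _ = [set w | forall c, lcount 0 (N w) w c = k c]); last first.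
  apply/seteqP; split=> w /= => [[[-> _]]//|hk].
  have Nn : N w = n by rewrite -(sumk (N w) w); apply: eq_bigr => c _; exact: hk.
  by do !split => //; rewrite -Nn.
move=> -> _; congr EFin.
have kf0 : (\prod_c (k c)`!)%N%:R != 0 :> R.
  by rewrite pnatr_eq0 -lt0n prodn_gt0// => c; exact: fact_gt0.
have nf0 : n`!%:R != 0 :> R by rewrite pnatr_eq0 -lt0n fact_gt0.
apply: (mulIf kf0); rewrite -mulrA wcountE eqxx /pois.
rewrite big_split /= prodfV -natr_prod mulfVK// mulrA mulfVK//.
rewrite big_split /= -expR_sum sumrN -mulr_sumr p1 mulr1 -mulrA; congr (_ * _).
under [RHS]eq_bigr do rewrite exprMn.
by rewrite big_split /= prodrXr.
Qed.

End thinning.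

Section pois_facts.
Context (R : realType).
Implicit Types h : R.

Lemma pois_ge0 h k : 0 <= h -> 0 <= pois h k.
Proof. by move=> h0; rewrite /pois divr_ge0// mulr_ge0 ?expR_ge0 ?exprn_ge0. Qed.

Lemma cvg_sum_pois h : (fun n => \sum_(k < n) pois h k) @ \oo --> (1 : R).
Proof.
have -> : 1 = expR (- h) * expR h by rewrite -expRD addNr expR0.
rewrite (_ : (fun n => _) = (fun n => expR (- h) * series (exp_coeff h) n)); last first.
  apply/funext => n; rewrite /series/= mulr_sumr big_mkord; apply: eq_bigr => i _.
  by rewrite /pois /exp_coeff /= mulrA.
by apply: cvgM; [exact: cvg_cst|exact: is_cvg_series_exp_coeff].
Qed.

Lemma nneseries_pois h : (\sum_(k <oo) (pois h k)%:E = 1)%E.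
Proof.
apply/cvg_lim => //.
rewrite (_ : (fun n => _) = EFin \o (fun n => \sum_(k < n) pois h k)); last first.
  by apply/funext => n /=; rewrite sumEFin big_mkord.
by apply/fine_cvgP; split; [exact: nearW|exact: cvg_sum_pois].
Qed.

Lemma pois0 k : pois (0 : R) k = (k == 0%N)%:R.
Proof. by rewrite /pois oppr0 expR0 mul1r; case: k => [|k]; rewrite ?expr0 ?fact0 ?divr1// expr0n mul0r. Qed.

Lemma pois_add (a b : R) n :
  \sum_(i < n.+1) pois a i * pois b (n - i) = pois (a + b) n.
Proof.
rewrite {3}/pois opprD expRD addrC exprDn mulr_sumr mulr_suml; apply: eq_bigr => i _.
have iN : (i <= n)%N by rewrite -ltnS.
rewrite -(bin_fact iN) -mulr_natr !natrM /pois.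
have ne k : (k`!%:R : R) != 0 by rewrite pnatr_eq0 -lt0n fact_gt0.
have nb : 'C(n, i)%:R != 0 :> R by rewrite pnatr_eq0 -lt0n bin_gt0.
field.
by rewrite !ne nb.
Qed.

End pois_facts.

(** * Sampling from a law on the integers *)

Section quantile.
Context (R : realType) (pm : nat -> R).
Hypothesis pm0 : forall n, 0 <= pm n.
Let F n := \sum_(k < n) pm k.
Hypothesis cvgF : F @ \oo --> (1 : R).

(** The inverse distribution function. The default 0 concerns only points above all partial sums,
    and there are none in [0, 1[ when these tend to 1. *)
Definition quantile (u : R) : nat :=
  if pselect (exists n, (u < F n.+1)) is left H then ex_minn H else 0%N.

Let F_nd : nondecreasing_seq F.
Proof. by apply/nondecreasing_seqP => n; rewrite /F big_ord_recr/= lerDl. Qed.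

Let F_le1 n : F n <= 1.
Proof.
rewrite -(cvg_lim _ cvgF)//; apply: nondecreasing_cvgn_le => //.
by apply/cvg_ex; exists 1.
Qed.

Lemma quantileS u n : (quantile u == n.+1) = (F n.+1 <= u < F n.+2).
Proof.
rewrite /quantile; case: pselect => [H|H]; last first.
  apply/esym/negbTE/negP => /andP[_ h]; apply: H; by exists n.+1.
case: ex_minnP => m hm hmin; apply/eqP/andP => [mn|[h1 h2]].
  split; last by rewrite -mn.
  by rewrite leNgt; apply/negP => /hmin; rewrite mn ltnn.
apply/eqP; rewrite eqn_leq hmin//= ltnNge; apply/negP => mn.
have : F m.+1 <= F n.+1 by apply: F_nd.
by move=> /(lt_le_trans hm); rewrite ltNge h1.
Qed.

Lemma quantile0 u : u < 1 -> (quantile u == 0%N) = (u < F 1).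
Proof.
move=> u1; rewrite /quantile; case: pselect => [H|H].
  case: ex_minnP => m hm hmin; apply/eqP/idP => [m0|h].
    by move: hm; rewrite m0.
  by apply/eqP; rewrite -leqn0; exact: hmin.
exfalso.
have /(cvgr_gt 1)/(_ u u1) := cvgF.
move=> [n _ /(_ n (leqnn _)) /= hn]; apply: H; exists n.
by apply: (lt_le_trans hn); apply: F_nd.
Qed.

Lemma measurable_quantile : measurable_fun setT quantile.
Proof.
have mS n : measurable [set u | quantile u = n.+1].
  rewrite (_ : [set _ | _] = [set` `[F n.+1, F n.+2[]) //.
  by apply/seteqP; split=> u /=; rewrite in_itv/= -quantileS => /eqP.
have m n : measurable [set u | quantile u = n].
  case: n => // .
  rewrite (_ : [set _ | _] = ~` (\bigcup_n [set u | quantile u = n.+1])).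
    by apply: measurableC; exact: bigcupT_measurable.
  apply/seteqP; split=> u /= uq; first by case=> n _ /=; rewrite uq.
  by case E : (quantile u) => [//|n]; exfalso; apply: uq; exists n.
move=> _ Y _; rewrite setTI.
rewrite (_ : _ @^-1` Y = \bigcup_(n in Y) [set u | quantile u = n]).
  by apply: bigcup_measurable.
by apply/seteqP; split=> u /=; [move=> ?; exists (quantile u)|move=> [n ? ->]].
Qed.

Lemma quantile_law n : unif01 [set u | quantile u = n] = (pm n)%:E.
Proof.
have -> : pm n = F n.+1 - F n by rewrite /F big_ord_recr /= addrAC subrr add0r.
have F0 k : 0 <= F k by apply: sumr_ge0.
rewrite -unif01_itv //; last by apply: F_nd.
rewrite !unif01E; congr (lebesgue_measure _).
apply/seteqP; split=> u /= [h1 h2]; (split; last exact: h2); move: h2; rewrite /= in_itv/= => /andP[u0 u1].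
  rewrite in_itv/=; case: n h1 => [|n] h1.
    by rewrite -quantile0// h1 eqxx andbT /F big_ord0.
  by rewrite -quantileS h1.
move: h1; rewrite in_itv/=; case: n => [|n] h1.
  by apply/eqP; rewrite quantile0//; case/andP: h1.
by apply/eqP; rewrite quantileS.
Qed.

End quantile.

Section clip.
Context (R : realType).
Local Notation leb := (@lebesgue_measure R).

(* Values outside ]0, 1[ are redirected, so that the points never leave their box. *)
Definition clip (u : R) : R := if 0 < u < 1 then u else 2^-1.

Lemma clip_itv u : 0 < clip u < 1.
Proof. by rewrite /clip; case: ifP => // _; rewrite invr_gt0 ltr0n invf_lt1// ltr1n. Qed.

Lemma measurable_clip : measurable_fun setT clip.
Proof.
apply: measurable_fun_ifT => //.
by apply: measurable_and; exact: measurable_fun_ltr.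
Qed.

Lemma leb_oo_co (B : set R) (b c : R) : measurable B ->
  leb (B `&` `[b, c[) = leb (B `&` `]b, c[).
Proof.
move=> mB; have [bc|cb] := ltP b c; last first.
  by rewrite !set_itv_ge ?setI0// -?leNgt// bnd_simp -leNgt.
apply/eqP; rewrite eq_le; apply/andP; split; last first.
  apply: le_measure; rewrite ?inE; [exact: measurableI|exact: measurableI|].
  by apply: setIS; apply: subset_itv_oo_co.
rewrite -(@setU1itv _ _ (BLeft c) b false)// setIUr.
apply: (le_trans (measureU2 _ _ _)); try exact: measurableI.
rewrite -[leRHS]add0e; apply: leeD => //.
rewrite -(lebesgue_measure_set1 b) le_measure ?inE//; exact: measurableI.
Qed.

Lemma leb_oo_oc (B : set R) (b c : R) : measurable B ->
  leb (B `&` `]b, c]) = leb (B `&` `]b, c[).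
Proof.
move=> mB; have [bc|cb] := ltP b c; last first.
  by rewrite !set_itv_ge ?setI0// -?leNgt// bnd_simp -leNgt.
apply/eqP; rewrite eq_le; apply/andP; split; last first.
  apply: le_measure; rewrite ?inE; [exact: measurableI|exact: measurableI|].
  by apply: setIS; apply: subset_itv_oo_oc.
rewrite -(@setUitv1 _ _ (BRight b) c true)// setIUr.
apply: (le_trans (measureU2 _ _ _)); try exact: measurableI.
rewrite -[leRHS]adde0; apply: leeD => //.
rewrite -(lebesgue_measure_set1 c) le_measure ?inE//; exact: measurableI.
Qed.

Lemma clip_law (a b : R) (B : set R) : 0 < a -> measurable B ->
  (a%:E * unif01 ((fun u => a * clip u + b)%R @^-1` B))%E = leb (B `&` `]b, (b + a)%R[).
Proof.
move=> a0 mB; rewrite unif01E leb_oo_co; last first.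
  rewrite -[X in measurable X]setTI.
  have mf : measurable_fun setT (fun u : R => a * clip u + b).
    by apply: measurable_funD => //; apply: measurable_funM => //; exact: measurable_clip.
  exact: mf.
rewrite -(lebesgue_affine b a0 (measurableI _ _ mB (measurable_itv _))).
congr (_ * lebesgue_measure _)%E; apply/seteqP; split=> u /=; rewrite !in_itv/= /clip.
  by move=> [+ u01]; rewrite u01 => h; split => //; move: u01 => /andP[? ?]; apply/andP; split; nra.
move=> [h /andP[h1 h2]].
have u01 : 0 < u < 1.
  apply/andP; split; first by rewrite -(pmulr_rgt0 _ a0); lra.
  by rewrite -(ltr_pM2l a0); lra.
by rewrite u01.
Qed.

End clip.

Definition box := (int * int * nat)%type.
(* [inl m] codes the number of points of the [m]-th box and [inr (m, j, c)] the [c]-th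
   coordinate of its [j]-th point. *)
Definition cidx := (nat + nat * nat * 'I_3)%type.

(** * The Poisson process of centres *)

Section center_process.
Context (R : realType) (h : R) (bx : nat -> box).
Hypothesis h0 : 0 < h.

Definition cnt (m : nat) (c : Om cidx R) : nat := quantile (pois h) (c (inl m)).

Definition pos1 (m j : nat) (c : Om cidx R) : R :=
  1 * clip (c (inr (m, j, inord 0))) + ((bx m).1.1)%:~R.
Definition pos2 (m j : nat) (c : Om cidx R) : R :=
  1 * clip (c (inr (m, j, inord 1))) + ((bx m).1.2)%:~R.
Definition pos3 (m j : nat) (c : Om cidx R) : R :=
  h * clip (c (inr (m, j, inord 2))) + h * ((bx m).2)%:R.
Definition pos (m j : nat) (c : Om cidx R) : R * R * R := (pos1 m j c, pos2 m j c, pos3 m j c).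

(** Heights are open below and closed above, so that the boxes tile the open upper half-space; the
    horizontal sides match [Num.floor]. *)
Definition boxset (b : box) : set (R * R * R) :=
  (`[b.1.1%:~R, (b.1.1%:~R + 1)[ `*` `[b.1.2%:~R, (b.1.2%:~R + 1)[)
   `*` `]h * b.2%:R, (h * b.2%:R + h)].

Lemma measurable_boxset b : measurable (boxset b).
Proof. by apply: measurableX => //; apply: measurableX. Qed.

Lemma pos_in_box m j c : boxset (bx m) (pos m j c).
Proof.
rewrite /boxset /pos /pos1 /pos2 /pos3 /= !in_itv /= !mul1r.
have := clip_itv (c (inr (m, j, inord 0))); have := clip_itv (c (inr (m, j, inord 1))).
have := clip_itv (c (inr (m, j, inord 2))).
move=> /andP[z0 z1] /andP[? ?] /andP[? ?].
have hz0 := mulr_gt0 h0 z0.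
have hz1 : h * clip (c (inr (m, j, inord 2))) < h by rewrite gtr_pMr.
by do !split; apply/andP; split; lra.
Qed.

Lemma measurable_clip_coord (a b : R) (i : cidx) :
  measurable_fun setT (fun c : Om cidx R => a * clip (c i) + b).
Proof.
apply: measurable_funD => //; apply: measurable_funM => //.
apply: (@measurableT_comp _ _ _ _ _ _ (@clip R)); first exact: measurable_clip.
exact: measurable_coord.
Qed.

Lemma measurable_pos m j : measurable_fun setT (pos m j).
Proof.
apply: measurable_fun_pair; first apply: measurable_fun_pair.
- exact: measurable_clip_coord.
- exact: measurable_clip_coord.
- exact: measurable_clip_coord.
Qed.

Lemma measurable_cnt m : measurable_fun setT (cnt m).
Proof.
apply: (@measurableT_comp _ _ _ _ _ _ (quantile (pois h))).
  by apply: measurable_quantile => n; apply: pois_ge0; exact: ltW.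
exact: measurable_coord.
Qed.

Variable P : probability (Om cidx R) R.
Hypothesis iidP : has_iid_coords (T := R) (@unif01 R) P.

Lemma cnt_law m n : P [set c | cnt m c = n] = (pois h n)%:E.
Proof.
have ph k : 0 <= pois h k by apply: pois_ge0; exact: ltW.
rewrite -(@quantile_law _ (pois h))//; last exact: cvg_sum_pois.
apply: (iid_coord (inl m) iidP (A := [set u | quantile (pois h) u = n])).
by apply: measurable_fiber; apply: measurable_quantile.
Qed.

Lemma P_clip_coord (a b : R) (i : cidx) (B : set R) : 0 < a -> measurable B ->
  (a%:E * P [set c | B (a * clip (c i) + b)%R])%E = lebesgue_measure (B `&` `]b, (b + a)%R[).
Proof.
move=> a0 mB; rewrite -clip_law//; congr (_ * _)%E.
apply: (iid_coord i iidP (A := [set u | B (a * clip u + b)])).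
rewrite -[X in measurable X]setTI.
have mf : measurable_fun setT (fun u : R => a * clip u + b).
  by apply: measurable_funD => //; apply: measurable_funM => //; exact: measurable_clip.
exact: mf.
Qed.

Lemma depends_clip (a b : R) (i : cidx) (B : set R) :
  depends_on [set i] [set c : Om cidx R | B (a * clip (c i) + b)].
Proof. by move=> w w' hw /=; rewrite (hw i). Qed.

Local Open Scope ereal_scope.

(* [lebesgue_measure] lives on [measurableTypeR R], which has the same measurable
   sets as the canonical structure of [R] but a different display. *)
Local Notation mR := (measurableTypeR R).

Lemma measurable_mR3 (A : set (R * R * R)) : measurable A -> @measurable _ (mR * mR * mR)%type A.
Proof. exact. Qed.

(** The three coordinates are independent and uniform on the sides of the box, so the two sides
    agree on products; uniqueness of product measures is applied in the plane and then in space. *)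
Lemma pos_law m j (A : set (R * R * R)) : measurable A ->
  h%:E * P (pos m j @^-1` A) = lebesgue3 (A `&` boxset (bx m)).
Proof.
move=> /measurable_mR3 mA.
have mc a b i : @measurable_fun _ _ (Om cidx R) mR setT (fun c => (a * clip (c i) + b)%R).
  exact: measurable_clip_coord.
have m1 := mc 1%R (bx m).1.1%:~R (inr (m, j, inord 0)).
have m2 := mc 1%R (bx m).1.2%:~R (inr (m, j, inord 1)).
have m3 := mc h (h * (bx m).2%:R)%R (inr (m, j, inord 2)).
pose n1 := law P m1; pose n2 := law P m2; pose n3 := law P m3.
have ine (a b : nat) : (a < 3)%N -> (b < 3)%N -> a != b -> (inord a : 'I_3) != inord b.
  by move=> a3 b3 ab; apply/eqP => /(congr1 val); rewrite /= !inordK//; exact/eqP.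
have m12 : @measurable_fun _ _ (Om cidx R) (mR * mR)%type setT (fun c => (pos1 m j c, pos2 m j c)).
  exact: measurable_fun_pair.
have m123 : @measurable_fun _ _ (Om cidx R) (mR * mR * mR)%type setT (pos m j).
  exact: measurable_fun_pair.
have mpre i a b (B : set mR) : measurable B -> measurable [set c : Om cidx R | B (a * clip (c i) + b)%R].
  by move=> mB; rewrite -[X in measurable X]setTI; exact: mc.
have e12 (D : set (mR * mR)) : measurable D -> (n1 \x n2) D = law P m12 D.
  apply: product_measure_unique => A1 A2 mA1 mA2.
  transitivity (P (pos1 m j @^-1` A1 `&` pos2 m j @^-1` A2)) => //.
  transitivity (P (pos1 m j @^-1` A1) * P (pos2 m j @^-1` A2)) => //.
  apply: (indep2 iidP (S := [set inr (m, j, inord 0)])).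
  - exact: mpre.
  - exact: mpre.
  - exact: depends_clip.
  - apply: (depends_on_sub (S := [set inr (m, j, inord 1)])); last exact: depends_clip.
    by move=> _ -> /= [] /eqP; apply/negP; exact: ine.
pose n12 := [the probability _ _ of n1 \x n2].
have e3 := @product_measure_unique _ _ _ _ R n12 n3 (law P m123) _ A mA.
pose I1 := `[(bx m).1.1%:~R : R, ((bx m).1.1%:~R + 1)%R[%classic.
pose I2 := `[(bx m).1.2%:~R : R, ((bx m).1.2%:~R + 1)%R[%classic.
pose I3 := `](h * (bx m).2%:R)%R, (h * (bx m).2%:R + h)%R]%classic.
have mI1 : @measurable _ mR I1 by exact: measurable_itv.
have mI2 : @measurable _ mR I2 by exact: measurable_itv.
have mI3 : @measurable _ mR I3 by exact: measurable_itv.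
have mI12 : @measurable _ (mR * mR)%type (I1 `*` I2) by exact: measurableX.
have mI123 : @measurable _ (mR * mR * mR)%type (boxset (bx m)) by exact: measurableX.
have n1E (B : set mR) : measurable B -> n1 B = lebesgue_measure (B `&` I1).
  move=> mB; rewrite leb_oo_co// -[LHS]mul1e.
  exact: (@P_clip_coord 1 (bx m).1.1%:~R (inr (m, j, inord 0)) B ltr01 mB).
have n2E (B : set mR) : measurable B -> n2 B = lebesgue_measure (B `&` I2).
  move=> mB; rewrite leb_oo_co// -[LHS]mul1e.
  exact: (@P_clip_coord 1 (bx m).1.2%:~R (inr (m, j, inord 1)) B ltr01 mB).
have n3E (B : set mR) : measurable B -> h%:E * n3 B = lebesgue_measure (B `&` I3).
  move=> mB; rewrite leb_oo_oc//.
  exact: (@P_clip_coord h (h * (bx m).2%:R)%R (inr (m, j, inord 2)) B h0 mB).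
pose l2 : {measure set _ -> \bar _} := (@lebesgue_measure R \x @lebesgue_measure R).
pose l3 : {measure set _ -> \bar _} := l2 \x @lebesgue_measure R.
pose mr2 : {measure set _ -> \bar _} := mrestr l2 mI12.
have f12 := @product_measure_unique _ _ _ _ R n1 n2 mr2.
have hi : (0 <= h^-1)%R by rewrite invr_ge0 ltW.
(* The box has volume [h], hence the normalisation. *)
pose mm : {measure set _ -> \bar _} := mscale (NngNum hi) (mrestr l3 mI123).
have mmE D : mm D = h^-1%:E * l3 (D `&` boxset (bx m)) by [].
transitivity (h%:E * mm A); last first.
  by rewrite mmE muleA -EFinM divff ?gt_eqF// mul1e.
have e4 := @product_measure_unique _ _ _ _ R n12 n3 mm _ A mA.
congr (_ * _); transitivity (law P m123 A) => //.
transitivity (product_measure1 n12 n3 A); last apply: e4.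
  apply/esym; apply: e3 => A1 A2 mA1 mA2.
  pose E := (fun c => (pos1 m j c, pos2 m j c)) @^-1` A1.
  transitivity (P (E `&` pos3 m j @^-1` A2)) => //.
  transitivity (P E * P (pos3 m j @^-1` A2)); last first.
    by congr (_ * _); exact: (esym (e12 _ mA1)).
  apply: (indep2 iidP (S := [set i | i = inr (m, j, inord 0) \/ i = inr (m, j, inord 1)])).
  - by rewrite -[X in measurable X]setTI; exact (m12 measurableT _ mA1).
  - exact: mpre.
  - by move=> w w' hw; rewrite /E /= /pos1 /pos2 (hw (inr (m, j, inord 0))); [rewrite (hw (inr (m, j, inord 1)))//; right|left].
  - apply: (depends_on_sub (S := [set inr (m, j, inord 2)])); last exact: depends_clip.
    by move=> _ -> /= -[] [] /eqP; apply/negP; exact: ine.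
move=> A1 A2 mA1 mA2.
rewrite mmE /boxset -setXI.
transitivity (h^-1%:E * (l2 (A1 `&` (I1 `*` I2)) * lebesgue_measure (A2 `&` I3))).
  by congr (_ * _); apply: product_measure1E; exact: measurableI.
transitivity (l2 (A1 `&` (I1 `*` I2)) * n3 A2).
  rewrite -n3E//.
  by rewrite muleCA (muleA h^-1%:E) -EFinM mulVf ?gt_eqF// mul1e.
congr (_ * _); apply/esym; apply: f12 => // B1 B2 mB1 mB2.
transitivity (lebesgue_measure (B1 `&` I1) * lebesgue_measure (B2 `&` I2)); last first.
  by rewrite -n1E// -n2E.
transitivity (l2 ((B1 `*` B2) `&` (I1 `*` I2))) => //.
by rewrite -setXI; apply: product_measure1E; exact: measurableI.
Qed.

End center_process.

Section counts.
Context (R : realType) (h : R) (bx : nat -> box).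
Hypothesis h0 : 0 < h.
Variable P : probability (Om cidx R) R.
Hypothesis iidP : has_iid_coords (T := R) (@unif01 R) P.

Definition cntA m (A : set (R * R * R)) (c : Om cidx R) : nat :=
  (\sum_(0 <= j < cnt h m c) (pos h bx m j c \in A))%N.

Definition count_upto M A (c : Om cidx R) : nat := (\sum_(0 <= m < M) cntA m A c)%N.

Definition muA m (A : set (R * R * R)) : R := fine (lebesgue3 (A `&` boxset h (bx m))).

Lemma pos_prob m j A : measurable A -> P (pos h bx m j @^-1` A) = (muA m A / h)%:E.
Proof.
move=> mA; rewrite /muA -(pos_law bx h0 iidP m j mA).
have fP : P (pos h bx m j @^-1` A) \is a fin_num.
  by apply: fin_num_measure; rewrite -[X in measurable X]setTI; exact: measurable_pos.
by rewrite fineM//= mulrC mulrA mulVf ?gt_eqF// mul1r fineK.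
Qed.

Lemma muA_ge0 m A : 0 <= muA m A.
Proof. by rewrite fine_ge0. Qed.

Lemma measurable_pos_pre m j (A : set (R * R * R)) : measurable A ->
  measurable (pos h bx m j @^-1` A).
Proof. by move=> mA; rewrite -[X in measurable X]setTI; exact: measurable_pos. Qed.

Lemma depends_pos m j (A : set (R * R * R)) :
  depends_on [set i | exists a, i = inr (m, j, a)] (pos h bx m j @^-1` A).
Proof.
move=> w w' hw /=; rewrite /pos /pos1 /pos2 /pos3.
by rewrite !hw; [|exists (inord 2)|exists (inord 1)|exists (inord 0)].
Qed.

Lemma depends_cnt m n : depends_on [set inl m] [set c : Om cidx R | cnt h m c = n].
Proof. by move=> w w' hw /=; rewrite /cnt hw. Qed.

Lemma measurable_cntA m A : measurable A -> measurable_fun setT (cntA m A).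
Proof.
move=> mA; rewrite /cntA.
apply: (@measurable_countable_case _ _ _ _ nat (cnt h m) (fun n c => \sum_(0 <= j < n) (pos h bx m j c \in A))%N).
  by move=> k; apply: measurable_fiber; exact: measurable_cnt.
move=> k; apply: measurable_sumn => j.
apply: (@measurableT_comp _ _ _ _ _ _ nat_of_bool) => //.
apply: (measurable_fun_bool true); rewrite setTI.
rewrite (_ : _ @^-1` _ = pos h bx m j @^-1` A); first exact: measurable_pos_pre.
by apply/seteqP; split=> c /=; [move/set_mem|move/mem_set].
Qed.

Lemma measurable_KM M A : measurable A -> measurable_fun setT (count_upto M A).
Proof. by move=> mA; apply: measurable_sumn => m; exact: measurable_cntA. Qed.

Lemma depends_cntA m A n : depends_on [set i : cidx | i = inl m \/ exists j a, i = inr (m, j, a)]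
  [set c | cntA m A c = n].
Proof.
move=> w w' hw /=; rewrite /cntA /cnt (hw (inl m)); last by left.
move=> <-; apply: eq_bigr => j _; rewrite /pos /pos1 /pos2 /pos3.
by rewrite !hw//; right; exists j; [exists (inord 2)|exists (inord 1)|exists (inord 0)].
Qed.

Section classes.
Variables (r : nat) (A : 'I_r -> set (R * R * R)).
Hypothesis mA : forall i, measurable (A i).
Hypothesis tA : trivIset setT A.

(** The label of a point is the set that contains it, or [None]; thinning by these labels yields the
    joint law of the counts. *)
Let lab (x : R * R * R) : option 'I_r := [pick i | x \in A i].

Let lab_some i : lab @^-1` [set Some i] = A i.
Proof.
apply/seteqP; split=> x /=; rewrite /lab; case: pickP => //.
- by move=> j /set_mem jx [] <-.
- by move=> j /set_mem jx ix; congr Some; apply: (tA I I); exists x.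
- by move=> nx /mem_set; rewrite nx.
Qed.

Let lab_meas l : measurable (lab @^-1` [set l]).
Proof.
case: l => [i|]; first by rewrite lab_some.
rewrite (_ : _ @^-1` _ = ~` \bigcup_(i in [set: 'I_r]) (A i)).
  by apply: measurableC; apply: fin_bigcup_measurable.
apply/seteqP; split=> x /=; rewrite /lab; case: pickP => //.
  by move=> nx _ [i _ /mem_set]; rewrite nx.
by move=> i /set_mem ix nx; case: nx; exists i.
Qed.

Let cnt_lab m l c :
  (\sum_(0 <= j < cnt h m c) (lab (pos h bx m j c) == l))%N = cntA m (lab @^-1` [set l]) c.
Proof.
apply: eq_bigr => j _; congr nat_of_bool; apply/eqP/idP => [e|/set_mem//].
exact/mem_set.
Qed.

Let box_pmf_option m (k : option 'I_r -> nat) :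
  P [set c | forall l, (\sum_(0 <= j < cnt h m c) (lab (pos h bx m j c) == l))%N = k l] =
  (\prod_l pois (muA m (lab @^-1` [set l])) (k l))%:E.
Proof.
pose p l := muA m (lab @^-1` [set l]) / h.
have := @thinning _ _ R P (option 'I_r) (cnt h m) (fun j c => lab (pos h bx m j c)) h p.
move=> /(_ (measurable_cnt h0 m)) -> //.
- by congr EFin; apply: eq_bigr => l _; rewrite /p mulrCA divff ?gt_eqF// mulr1.
- by move=> j l; exact: (@measurable_pos_pre m j (lab @^-1` [set l])).
- move=> n l.
  pose E (o : option nat) := if o is Some j then pos h bx m j @^-1` (lab @^-1` [set l j]) else [set c | cnt h m c = n].
  pose S (o : option nat) : set cidx := if o is Some j then [set i | exists a, i = inr (m, j, a)] else [set inl m].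
  have := @indep_family _ _ _ _ _ _ iidP _ S (None :: map Some (iota 0 n)) E.
  rewrite /= bigcap_cons => IH.
  transitivity (P (E None `&` \bigcap_(i in [set` map Some (iota 0 n)]) E i)).
    congr (P (_ `&` _)); apply/seteqP; split=> w /= hw.
      by move=> _ /mapP[j + ->]; rewrite mem_iota add0n /= => jn; exact: hw.
    by move=> j jn; apply: (hw (Some j)); rewrite /= map_f// mem_iota.
  rewrite IH.
  + rewrite big_cons big_map /E cnt_law//.
    rewrite [RHS](EFinM (pois h n)) -(big_mkord xpredT (fun j => p (l j))) -prodEFin.
    congr (_ * _)%E; rewrite /index_iota subn0; apply: eq_bigr => j _; exact: pos_prob.
  + by rewrite /= map_inj_uniq ?iota_uniq ?andbT; [apply/mapP => -[]|move=> ? ? []].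
  + by move=> [j|] _; [exact: measurable_pos_pre|apply: measurable_fiber; exact: measurable_cnt].
  + by move=> [j|] _; [exact: depends_pos|exact: depends_cnt].
  + move=> [j|] [j'|] _ _ // jj'; apply/seteqP; split=> i //=.
    * by move=> [[a ->] [a' [e _]]]; move: jj'; rewrite e eqxx.
    * by move=> [[a ->]].
    * by move=> [-> []].
apply: EFin_inj; rewrite -sumEFin -[RHS](probability_setT P).
rewrite (@measure_fin_split _ _ _ P _ (fun c => lab (pos h bx m 0 c)) setT)//; last first.
  by move=> l; exact: (@measurable_pos_pre m 0 (lab @^-1` [set l])).
apply: eq_bigr => l _; rewrite setTI -[RHS]/(P (pos h bx m 0 @^-1` (lab @^-1` [set l]))).
by rewrite pos_prob.
Qed.

(** The number of points outside all the sets, that is of label [None], is summed out. *)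
Lemma box_pmf m (k : 'I_r -> nat) :
  P [set c | forall i, cntA m (A i) c = k i] = (\prod_i pois (muA m (A i)) (k i))%:E.
Proof.
pose k' k0 (l : option 'I_r) := if l is Some i then k i else k0.
pose E k0 := [set c | forall l, cntA m (lab @^-1` [set l]) c = k' k0 l].
have -> : [set c | forall i, cntA m (A i) c = k i] = \bigcup_k0 E k0.
  apply/seteqP; split=> c /=.
    move=> hc; exists (cntA m (lab @^-1` [set None]) c) => //.
    by move=> [i|] //=; rewrite lab_some.
  by move=> [k0 _ hk] i; rewrite -lab_some (hk (Some i)).
rewrite measure_bigcup//; last 2 first.
- move=> k0 _; rewrite (_ : E k0 = \bigcap_(l in [set: option 'I_r]) [set c | cntA m (lab @^-1` [set l]) c = k' k0 l]).
    by apply: fin_bigcap_measurable => // l _; apply: measurable_fiber; exact: measurable_cntA.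
  by apply/seteqP; split=> c /= hc l; [move=> _|]; exact: hc.
- by move=> k1 k2 _ _ [c [/(_ None) + /(_ None)]] /= => -> .
have PE k0 : P (E k0) = ((pois (muA m (lab @^-1` [set None])) k0)%:E *
    (\prod_i pois (muA m (A i)) (k i))%:E)%E.
  have := box_pmf_option m (k' k0).
  rewrite -EFinM (bigD1 None)//= => hE.
  transitivity (P [set c | forall l, (\sum_(0 <= j < cnt h m c) (lab (pos h bx m j c) == l))%N = k' k0 l]).
    by congr (P _); apply/seteqP; split=> c /= hc l; have := hc l; rewrite cnt_lab.
  rewrite hE; congr (_ * _)%:E.
  rewrite (reindex_omap Some id)/=; last by case.
  by apply: eq_big => [i|i _]; rewrite ?eqxx// lab_some.
transitivity (\sum_(k0 <oo) ((\prod_i pois (muA m (A i)) (k i))%:E *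
    (pois (muA m (lab @^-1` [set None])) k0)%:E))%E.
  apply: congr_lim; apply/funext => n; apply: eq_big => k0; first by rewrite in_setT.
  by move=> _; rewrite muleC; exact: PE.
rewrite nneseriesZl; last by move=> i _; rewrite lee_fin pois_ge0// muA_ge0.
by rewrite nneseries_pois mule1.
Qed.

End classes.

End counts.

Section totals.
Context (R : realType) (h : R) (bx : nat -> box).
Hypothesis h0 : 0 < h.
Variable P : probability (Om cidx R) R.
Hypothesis iidP : has_iid_coords (T := R) (@unif01 R) P.

Local Notation cntA := (cntA h bx).
Local Notation KM := (count_upto h bx).
Local Notation muA := (muA h bx).

Definition muK M A : R := \sum_(0 <= m < M) muA m A.

Lemma measurable_all_fibers d (T : measurableType d) (K : finType) (f : K -> T -> nat) (k : K -> nat) :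
  (forall i, measurable_fun setT (f i)) -> measurable [set c | forall i, f i c = k i].
Proof.
move=> mf; rewrite (_ : [set c | _] = \bigcap_(l in [set: K]) [set c | f l c = k l]).
  by apply: fin_bigcap_measurable => // l _; apply: measurable_fiber.
by apply/seteqP; split=> c /= hc l; [move=> _|]; exact: hc.
Qed.

Lemma depends_KM M A n :
  depends_on [set i : cidx | exists2 m, (m < M)%N & i = inl m \/ exists j a, i = inr (m, j, a)]
    [set c | KM M A c = n].
Proof.
move=> w w' hw /= <-; rewrite /count_upto; apply: eq_big_nat => m /andP[_ mM].
apply: (@depends_cntA _ _ _ m A (cntA m A w) w) => // i hi.
by apply: hw; exists m.
Qed.

Section classes.
Variables (r : nat) (A : 'I_r -> set (R * R * R)).
Hypothesis mA : forall i, measurable (A i).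
Hypothesis tA : trivIset setT A.

(** Induction on the number of boxes: a new box uses new variables, and [pois_add] convolves its
    counts with the previous ones. *)
Lemma KM_pmf M (k : 'I_r -> nat) :
  P [set c | forall i, KM M (A i) c = k i] = (\prod_i pois (muK M (A i)) (k i))%:E.
Proof.
have mKM N i : measurable_fun setT (KM N (A i)) by exact: measurable_KM.
elim: M k => [|M IH] k.
  under eq_bigr do rewrite /muK big_geq// pois0.
  case: (boolP [forall i, k i == 0%N]) => [/forallP k0|].
    rewrite big1; last by move=> i _; rewrite k0.
    rewrite (_ : [set c | _] = setT) ?probability_setT//.
    by apply/seteqP; split=> // c _ i; rewrite /count_upto big_geq// (eqP (k0 i)).
  rewrite negb_forall => /existsP[i ki].
  rewrite (bigD1 i)//= (negbTE ki) mul0r (_ : [set c | _] = set0) ?measure0//.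
  apply/seteqP; split=> // c /= /(_ i); rewrite /count_upto big_geq// => /esym/eqP.
  by rewrite (negbTE ki).
(* Counts are truncated at [B] to split the event into finitely many cases; on the event they are at
   most [k i], so truncation loses nothing. *)
pose B := (\max_i k i)%N.
have kB i : (k i <= B)%N by exact: leq_bigmax.
pose f c : {ffun 'I_r -> 'I_B.+1} := [ffun i => inord (minn (KM M (A i) c) B)].
rewrite (@measure_fin_split _ _ _ P _ f); last 2 first.
- exact: measurable_all_fibers.
- move=> g; rewrite (_ : [set x | _] = [set c | forall i, minn (KM M (A i) c) B = g i]).
    apply: measurable_all_fibers => i.
    by apply: (@measurableT_comp _ _ _ _ _ _ (fun n => minn n B)).
  apply/seteqP; split=> c /=.
    by move=> <- i; rewrite ffunE inordK// ltnS geq_minr.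
  by move=> hc; apply/ffunP => i; rewrite ffunE hc inord_val.
transitivity (\sum_(g in family (fun i => [pred j : 'I_B.+1 | (j <= k i)%N]))
   (\prod_i (pois (muK M (A i)) (g i) * pois (muA M (A i)) (k i - g i)))%:E)%E.
  rewrite big_mkcond/= [RHS]big_mkcond; apply: eq_bigr => g _ /=.
  case: ifPn => [/familyP gk|]; last first.
    move=> gk; rewrite (_ : _ `&` _ = set0) ?measure0//; apply/seteqP; split=> c //= -[hc fc].
    move/negP: gk; apply; apply/familyP => i; rewrite inE.
    have : (KM M (A i) c <= k i)%N by rewrite -hc /count_upto big_nat_recr//= leq_addr.
    move=> Kk; rewrite -fc ffunE inordK; last by rewrite ltnS geq_minr.
    by rewrite geq_min Kk.
  rewrite big_split EFinM -(IH (fun i => val (g i))) -(box_pmf bx h0 iidP mA tA M (fun i => k i - g i)%N).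
  rewrite -(indep2 iidP (S := [set i : cidx | exists2 m, (m < M)%N & i = inl m \/ exists j a, i = inr (m, j, a)])).
  - congr (P _); apply/seteqP; split=> c /=.
      move=> [hc fc].
      have hK i : KM M (A i) c = g i.
        rewrite -fc ffunE inordK; last by rewrite ltnS geq_minr.
        apply/esym/minn_idPl; apply: leq_trans (kB i).
        by rewrite -hc /count_upto big_nat_recr//= leq_addr.
      split=> // i; rewrite -hK -hc /count_upto big_nat_recr//= addKn//.
    move=> [hK hc]; split.
      move=> i; rewrite /count_upto big_nat_recr//= -/(KM M (A i) c) hK hc subnKC//.
      by have := gk i; rewrite inE.
    apply/ffunP => i; apply/val_inj; rewrite ffunE /= hK (minn_idPl _) ?inordK//.
    by have := gk i; rewrite inE => /leq_trans; apply.
  - exact: measurable_all_fibers.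
  - by apply: measurable_all_fibers => i; exact: measurable_cntA.
  - move=> w w' hw /= hK i; exact: (@depends_KM M (A i) (g i) w w' hw (hK i)).
  - move=> w w' hw /= hK i; apply: (@depends_cntA _ h bx M (A i) _ w w' _ (hK i)) => j hj.
    apply: hw => -[m mM] [jm|[j' [a ja]]]; case: hj => [hj|[j'' [a' hj]]]; move: mM.
    + by move: jm; rewrite hj => -[->]; rewrite ltnn.
    + by move: jm; rewrite hj.
    + by move: ja; rewrite hj.
    + by move: ja; rewrite hj => -[-> _ _]; rewrite ltnn.
rewrite sumEFin; congr EFin.
transitivity (\prod_(i < r) \sum_(j < B.+1 | (j <= k i)%N)
    pois (muK M (A i)) j * pois (muA M (A i)) (k i - j)).
  by rewrite bigA_distr_big_dep.
apply: eq_bigr => i _.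
rewrite {2}/muK big_nat_recr//= -/(muK M (A i)) -pois_add.
by rewrite (big_ord_widen B.+1 (fun j => pois (muK M (A i)) j * pois (muA M (A i)) (k i - j))) ?ltnS//.
Qed.

End classes.

End totals.

Section enumeration.
Context (R : realType) (h : R) (bx : nat -> box).
Hypothesis h0 : 0 < h.

Local Notation cnt := (@cnt R h).
Local Notation pos := (@pos R h bx).
Local Notation KM := (count_upto h bx).

Definition SM M (c : Om cidx R) : nat := (\sum_(0 <= m < M) cnt m c)%N.

(* The box and the rank in this box of the [i]-th point. The second branch, taken only if there
   are finitely many points, is chosen to keep [sig c] injective. *)
Definition sig (c : Om cidx R) (i : nat) : nat * nat :=
  if pselect (exists m, (i < SM m.+1 c)%N) is left H then (ex_minn H, i - SM (ex_minn H) c)%N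
  else (i, cnt i c).

Definition center_pt (i : nat) (c : Om cidx R) : R * R * R := pos (sig c i).1 (sig c i).2 c.

Lemma SMS m c : SM m.+1 c = (SM m c + cnt m c)%N.
Proof. by rewrite /SM big_nat_recr. Qed.

Lemma SM_mono c : {homo SM ^~ c : m n / (m <= n)%N}.
Proof.
move=> m n /subnKC <-; elim: (n - m)%N => [|k IH]; first by rewrite addn0.
by rewrite addnS SMS (leq_trans IH)// leq_addr.
Qed.

Lemma sigE c i m : (SM m c <= i < SM m.+1 c)%N -> sig c i = (m, i - SM m c)%N.
Proof.
move=> /andP[h1 h2]; rewrite /sig; case: pselect => [H|[]]; last by exists m.
case: ex_minnP => m' hm' hmin; suff -> : m' = m by [].
apply/eqP; rewrite eqn_leq hmin//= leqNgt; apply/negP => mm.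
by move: (leq_trans hm' (SM_mono c mm)); rewrite ltnNge h1.
Qed.

Lemma sigP c i : (exists m, (SM m c <= i < SM m.+1 c)%N) \/
  ((forall m, (SM m c <= i)%N) /\ sig c i = (i, cnt i c)).
Proof.
case: (pselect (exists m, (i < SM m.+1 c)%N)) => [H|H].
  left; case: (ex_minnP H) => m hm hmin; exists m; rewrite hm andbT.
  case: m hm hmin => [|m] hm hmin; first by rewrite /SM big_geq.
  by rewrite leqNgt; apply/negP => /hmin; rewrite ltnn.
right; split; last by rewrite /sig; case: pselect.
move=> m; rewrite leqNgt; apply/negP => hm; apply: H; exists m.
by apply: leq_trans hm _; exact: SM_mono.
Qed.

Lemma sig_SM c m j : (j < cnt m c)%N -> sig c (SM m c + j)%N = (m, j).
Proof. by move=> jm; rewrite (@sigE _ _ m) ?leq_addr ?SMS ?ltn_add2l//= addKn. Qed.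

Lemma sig_inj c : injective (sig c).
Proof.
move=> i i'.
have [[m /[dup] hm /andP[h1 h2]]|[_ ->]] := sigP c i;
have [[m' /[dup] hm' /andP[h1' h2']]|[_ ->]] := sigP c i'.
- rewrite (sigE hm) (sigE hm') => -[mm e].
  by rewrite -[LHS](subnKC h1) e mm subnKC.
- by rewrite (sigE hm) => -[mm e]; move: h2; rewrite SMS {2}mm -e subnKC// ltnn.
- by rewrite (sigE hm') => -[mm e]; move: h2'; rewrite SMS -{2}mm e subnKC// ltnn.
- by case.
Qed.

Lemma measurable_SM m : measurable_fun setT (SM m).
Proof. by apply: measurable_sumn => i; exact: measurable_cnt. Qed.

Lemma measurable_nat_pre d (T : measurableType d) (f : T -> nat) (Y : set nat) :
  measurable_fun setT f -> measurable (f @^-1` Y).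
Proof. by move=> mf; rewrite -[X in measurable X]setTI; exact: mf. Qed.

Lemma measurable_sig i p : measurable [set c | sig c i = p].
Proof.
case: p => m j.
rewrite (_ : [set c | _] =
  ([set c | (SM m c <= i)%N] `&` [set c | (i < SM m.+1 c)%N] `&` [set c | (i - SM m c)%N = j])
  `|` (\bigcap_M [set c | (SM M c <= i)%N] `&` [set c | cnt i c = j] `&` [set c | i = m])).
  apply: measurableU.
    apply: measurableI; first apply: measurableI.
    - exact: (measurable_nat_pre [set n | (n <= i)%N] (measurable_SM m)).
    - exact: (measurable_nat_pre [set n | (i < n)%N] (measurable_SM m.+1)).
    - exact: (measurable_nat_pre [set n | (i - n)%N = j] (measurable_SM m)).
  apply: measurableI; first apply: measurableI.
  - apply: bigcapT_measurable => M.
    exact: (measurable_nat_pre [set n | (n <= i)%N] (measurable_SM M)).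
  - exact: (measurable_nat_pre [set n | n = j] (measurable_cnt h0 i)).
  - have [->|im] := pselect (i = m); last by rewrite (_ : [set _ | _] = set0)// -subset0.
    by rewrite (_ : [set _ | _] = setT)//; apply/seteqP; split.
apply/seteqP; split=> c /=.
  have [[m' /[dup] hm /andP[h1 h2]]|[hs ->]] := sigP c i.
    by rewrite (sigE hm) => -[<- <-]; left.
  by move=> [<- <-]; right; do !split=> //; move=> M _; exact: hs.
move=> [[[h1 h2] <-]|[[hs <-] <-]]; first by apply: sigE; rewrite h1.
have [[m' /andP[h1 h2]]|[_ ->//]] := sigP c i.
by move: (hs m'.+1 I) => /=; rewrite leqNgt h2.
Qed.

Lemma measurable_center_pt i : measurable_fun setT (center_pt i).
Proof.
apply: (@measurable_countable_case _ _ _ _ (nat * nat)%type (fun c => sig c i) (fun k c => pos k.1 k.2 c)).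
  by move=> k; exact: measurable_sig.
by move=> k; exact: measurable_pos.
Qed.

Lemma sum_center (A : set (R * R * R)) M c :
  (\sum_(0 <= i < SM M c) (center_pt i c \in A) = KM M A c)%N.
Proof.
elim: M => [|M IH]; first by rewrite /count_upto /SM !big_geq.
rewrite (big_cat_nat (n := SM M c))//=; last by apply: SM_mono.
rewrite IH /count_upto [in RHS]big_nat_recr//=; congr (_ + _)%N.
rewrite /cntA SMS -{1}[SM M c]add0n big_addn addKn.
by apply: eq_big_nat => j /andP[_ jM]; rewrite /center_pt addnC sig_SM.
Qed.

Definition infinite_points (c : Om cidx R) := forall i, exists M, (i < SM M c)%N.

Lemma measurable_infinite_points : measurable (~` [set c | infinite_points c]).
Proof.
rewrite (_ : ~` _ = \bigcup_i \bigcap_M [set c | (SM M c <= i)%N]).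
  apply: bigcupT_measurable => i; apply: bigcapT_measurable => M.
  exact: (measurable_nat_pre [set n | (n <= i)%N] (measurable_SM M)).
apply/seteqP; split=> c /=.
  move=> /existsNP[i /forallNP hi]; exists i => // M _ /=; rewrite leqNgt; exact/negP.
move=> [i _ hi] /(_ i) [M]; rewrite ltnNge => /negP; apply; exact: (hi M I).
Qed.

Variable P : probability (Om cidx R) R.
Hypothesis iidP : has_iid_coords (T := R) (@unif01 R) P.

(** With finitely many points all boxes from some [M0] on are empty, and [n] given boxes are empty
    with probability [expR (- h) ^+ n]. *)
Lemma infinite_points_ae : P (~` [set c | infinite_points c]) = 0%E.
Proof.
have sub : ~` [set c | infinite_points c] `<=` \bigcup_M0 \bigcap_m [set c | cnt (M0 + m) c = 0%N].
  move=> c /= /existsNP[i /forallNP hi].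
  have exv : exists v, `[< exists M, SM M c = v >] by exists (SM 0 c); apply/asboolP; exists 0%N.
  have bv v : `[< exists M, SM M c = v >] -> (v <= i)%N.
    by move=> /asboolP[M <-]; rewrite leqNgt; apply/negP/hi.
  have [v /asboolP[M0 hM0] hmax] := ex_maxnP exv bv.
  exists M0 => // m _ /=.
  have h1 : (SM M0 c <= SM (M0 + m) c)%N by apply: SM_mono; rewrite leq_addr.
  have h2 : (SM (M0 + m).+1 c <= v)%N by apply: hmax; apply/asboolP; exists (M0 + m).+1.
  by apply/eqP; rewrite -leqn0 -(leq_add2l (SM (M0 + m) c)) addn0 -SMS (leq_trans h2)// -hM0.
have mc m : measurable [set c | cnt m c = 0%N] by apply: measurable_fiber; exact: measurable_cnt.
apply: (subset_measure0 _ _ sub).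
- exact: measurable_infinite_points.
- by apply: bigcupT_measurable => M0; exact: bigcapT_measurable.
have mcap M0 : measurable (\bigcap_m [set c | cnt (M0 + m) c = 0%N]) by exact: bigcapT_measurable.
apply: measure_negligible; first exact: bigcupT_measurable.
apply: negligible_bigcup => M0; apply/negligibleP => //.
apply/eqP; rewrite eq_le measure_ge0 andbT.
have Pn n : (P (\bigcap_m [set c | cnt (M0 + m) c = 0%N]) <= (expR (- h) ^+ n)%:E)%E.
  have -> : (expR (- h) ^+ n)%:E = (\prod_(m <- iota 0 n) P [set c | cnt (M0 + m) c = 0%N])%E.
    under eq_bigr do rewrite cnt_law// /pois expr0 fact0 divr1 mulr1.
    by rewrite prodEFin big_const_seq count_predT size_iota iter_mulr_1.
  rewrite -(@indep_family _ _ _ _ _ _ iidP _ (fun m => [set inl (M0 + m)%N])).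
  - apply: le_measure; rewrite ?inE; [exact: bigcapT_measurable| |by move=> c hc m _; exact: hc].
    by apply: fin_bigcap_measurable.
  - exact: iota_uniq.
  - by [].
  - by move=> m _; exact: depends_cnt.
  - move=> m m' _ _ mm'; apply/seteqP; split=> i //= [-> [] /eqP].
    by rewrite eqn_add2l (negbTE mm').
have hlt : expR (- h) < 1 by rewrite expR_lt1 oppr_lt0.
have cv : (fun n => expR (- h) ^+ n) @ \oo --> (0 : R).
  by apply: cvg_expr; rewrite ger0_norm ?expR_ge0.
have cv' : (fun n => (expR (- h) ^+ n)%:E) @ \oo --> (0%:E : \bar R).
  by apply/fine_cvgP; split; [exact: nearW|].
by apply: (cvge_ge _ cv'); exact: nearW.
Qed.

End enumeration.

(** * From finitely many boxes to the whole point process *)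

Section counting_facts.
Context (R : realType).

Lemma counting_prefix (S : set nat) n :
  @counting _ R (S `&` `I_n) = (\sum_(0 <= i < n) (i \in S))%N%:R%:E.
Proof.
elim: n => [|n IH].
  by rewrite II0 setI0 big_geq// measure0.
rewrite IIS setIUr measureU//; last first.
  by apply/seteqP; split=> x //= [[_ xn] [_ xe]]; move: xn; rewrite xe ltnn.
rewrite big_nat_recr//= natrD EFinD -IH; congr (_ + _)%E.
have [nS|nS] := boolP (n \in S).
  rewrite setIidr; last by move=> _ ->; exact/set_mem.
  by rewrite /counting asboolT// fset_set1 cardfs1.
rewrite (_ : _ `&` _ = set0) ?measure0//; apply/seteqP; split=> x //= [Sx xn].
by move/negP: nS; apply; rewrite -xn; exact/mem_set.
Qed.

Lemma counting_le (S : set nat) (k : nat) :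
  (@counting _ R S <= k%:R%:E)%E <-> forall n, (\sum_(0 <= i < n) (i \in S) <= k)%N.
Proof.
split=> [Sk n|Sk].
  have : (@counting _ R (S `&` `I_n) <= k%:R%:E)%E.
    by apply: le_trans Sk; apply: le_measure; rewrite ?inE//; exact: subIsetl.
  by rewrite counting_prefix lee_fin ler_nat.
have SE : S = \bigcup_n (S `&` `I_n).
  by apply/seteqP; split=> x /=; [move=> Sx; exists x.+1 => //; split => //=|move=> [n _ []]].
have : @counting nat R \o (fun n => S `&` `I_n) @ \oo --> @counting _ R (\bigcup_n (S `&` `I_n)).
  apply: nondecreasing_cvg_mu => //.
  move=> m n mn; apply/subsetPset; apply: setIS => x /= xm; exact: leq_trans mn.
rewrite -SE => cv; apply: (cvge_le _ cv); apply: nearW => n /=.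
by rewrite counting_prefix lee_fin ler_nat.
Qed.

Lemma point_count_or_infty d (T : measurableType d) (X : nat -> T -> R * R * R) A w :
  point_count X A w = +oo%E \/ exists k : nat, point_count X A w = k%:R%:E.
Proof. by rewrite /point_count /counting; case: ifP => _; [right; eexists|left]. Qed.

End counting_facts.

Lemma eq_prob_off d (T : measurableType d) (R : realType) (P : probability T R) (A B Z : set T) :
  measurable A -> measurable B -> measurable Z -> P Z = 0%E ->
  A `\` Z = B `\` Z -> P A = P B.
Proof.
move=> mA mB mZ PZ AB.
have h X : measurable X -> P X = P (X `\` Z).
  move=> mX; rewrite measureD//; last by rewrite ltey_eq fin_num_measure.
  rewrite (subset_measure0 _ _ (@subIsetr _ X Z))// ?sube0//; exact: measurableI.
by rewrite h// AB -h.
Qed.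

Section count_events.
Context (R : realType) (h : R) (bx : nat -> box).
Hypothesis h0 : 0 < h.
Local Notation KM := (count_upto h bx).
Local Notation center_pt := (center_pt h bx).
Local Notation infinite_points := (infinite_points h).

(** Unlike the events prescribing an exact count, these are decreasing limits of events about
    finitely many boxes; they also form a pi-system. *)
Definition count_le (A : set (R * R * R)) (k : nat) : set (Om cidx R) :=
  [set c | (point_count center_pt A c <= k%:R%:E)%E].

Lemma cleE A k : count_le A k =
  \bigcap_n [set c | (\sum_(0 <= i < n) (center_pt i c \in A) <= k)%N].
Proof.
have e c n : (\sum_(0 <= i < n) (i \in [set i | A (center_pt i c)]) =
   \sum_(0 <= i < n) (center_pt i c \in A))%N.
  by apply: eq_bigr => i _; congr nat_of_bool; apply/idP/idP => /set_mem; exact: mem_set.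
apply/seteqP; split=> c /=.
  by rewrite /count_le /point_count /= counting_le => hc n _; rewrite /= -e.
by move=> hc; rewrite /count_le /point_count /= counting_le => n; rewrite e; exact: hc.
Qed.

Lemma measurable_cle A k : measurable A -> measurable (count_le A k).
Proof.
move=> mA; rewrite cleE; apply: bigcapT_measurable => n.
apply: (measurable_nat_pre [set m | (m <= k)%N]); apply: measurable_sumn => i.
apply: (@measurableT_comp _ _ _ _ _ _ nat_of_bool) => //.
apply: (measurable_fun_bool true); rewrite setTI.
rewrite (_ : _ @^-1` _ = center_pt i @^-1` A).
  by rewrite -[X in measurable X]setTI; exact: measurable_center_pt.
by apply/seteqP; split=> c /=; [move/set_mem|move/mem_set].
Qed.

Lemma cle_KM A k c : infinite_points c -> count_le A k c <-> (forall M, (KM M A c <= k)%N).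
Proof.
move=> ic; rewrite cleE; split=> [hc M|hc n _ /=].
  by rewrite -sum_center; exact: (hc _ I).
have [M nM] := ic n; apply: leq_trans (hc M); rewrite -sum_center.
by rewrite [leqRHS](big_cat_nat (n := n))//= ?leq_addr// ltnW.
Qed.

Lemma count_eqE A k : [set c | point_count center_pt A c = k%:R%:E] =
  count_le A k `\` (if k is k'.+1 then count_le A k' else set0).
Proof.
apply/seteqP; split=> c /=.
  move=> e; split; first by rewrite /count_le /= e.
  by case: k e => [e []|k e]; rewrite /count_le /= e lee_fin ler_nat ltnn.
have [e|[n e]] := point_count_or_infty center_pt A c; case: k => [|k]; rewrite /count_le /= e.
- by case.
- by case.
- by rewrite lee_fin ler_nat leqn0 => -[/eqP -> _].
- rewrite !lee_fin !ler_nat => -[nk nk']; congr _%:R%:E.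
  by apply/eqP; rewrite eqn_leq nk ltnNge; exact/negP.
Qed.

Lemma events_of_count A : events_of (point_count center_pt A) `<=`
  <<s [set count_le A k | k in [set: nat]] >>.
Proof.
move=> _ [B mB <-].
set G := [set count_le A k | k in setT].
have mG k : <<s G >> (count_le A k) by apply: sub_sigma_algebra; exists k.
have mGT : forall E, <<s G >> E -> @measurable _ (g_sigma_algebraType G) E by [].
have mk k : @measurable _ (g_sigma_algebraType G) [set c | point_count center_pt A c = k%:R%:E].
  rewrite count_eqE; apply: measurableD; first exact: mG.
  by case: k => [|k]; [exact: measurable0|exact: mG].
have moo : @measurable _ (g_sigma_algebraType G) [set c | point_count center_pt A c = +oo%E].
  rewrite (_ : [set c | _] = ~` \bigcup_k [set c | point_count center_pt A c = k%:R%:E]).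
    by apply: measurableC; exact: bigcupT_measurable.
  apply/seteqP; split=> c /= hc; first by case=> k _ /=; rewrite hc.
  have [//|[n e]] := point_count_or_infty center_pt A c.
  by case: hc; exists n.
rewrite -[<<s G >>]/(@measurable _ (g_sigma_algebraType G)).
rewrite (_ : _ @^-1` B = (\bigcup_(k in [set k | B k%:R%:E]) [set c | point_count center_pt A c = k%:R%:E])
  `|` ([set c | point_count center_pt A c = +oo%E] `&` [set c | B +oo%E])).
  apply: measurableU; first exact: bigcup_measurable.
  apply: measurableI => //.
  have [bo|nbo] := pselect (B +oo%E).
    by rewrite (_ : [set _ | _] = setT)//; apply/seteqP; split.
  by rewrite (_ : [set _ | _] = set0)//; apply/seteqP; split.
apply/seteqP; split=> c /=.
  move=> Bc; have [e|[n e]] := point_count_or_infty center_pt A c.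
    by right; split=> //; move: Bc; rewrite e.
  by left; exists n => //=; move: Bc; rewrite e.
by case=> [[k Bk ->]|[-> ]].
Qed.

End count_events.

Lemma cvg_bigsum (R : realType) (I : Type) (s : seq I) (f : I -> nat -> R) (l : I -> R) :
  (forall i, f i @ \oo --> l i) -> (fun M => \sum_(i <- s) f i M) @ \oo --> \sum_(i <- s) l i.
Proof.
move=> fl; elim: s => [|i s IH].
  by rewrite big_nil; under eq_fun do rewrite big_nil; exact: cvg_cst.
by rewrite big_cons; under eq_fun do rewrite big_cons; exact: cvgD.
Qed.

Lemma cvg_bigprod (R : realType) (I : Type) (s : seq I) (f : I -> nat -> R) (l : I -> R) :
  (forall i, f i @ \oo --> l i) -> (fun M => \prod_(i <- s) f i M) @ \oo --> \prod_(i <- s) l i.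
Proof.
move=> fl; elim: s => [|i s IH].
  by rewrite big_nil; under eq_fun do rewrite big_nil; exact: cvg_cst.
by rewrite big_cons; under eq_fun do rewrite big_cons; exact: cvgM.
Qed.

Section boxes.
Context (R : realType) (h : R).
Hypothesis h0 : 0 < h.

Lemma boxset_uniq b b' (x : R * R * R) : boxset h b x -> boxset h b' x -> b = b'.
Proof.
have fl (z : R) (i j : int) : i%:~R <= z < i%:~R + 1 -> j%:~R <= z < j%:~R + 1 -> i = j.
  move=> /andP[h1 h2] /andP[h3 h4]; apply/eqP; rewrite eq_le.
  by rewrite -!ltzD1 -!(ltr_int R) !intrD; apply/andP; split; lra.
case: b => [[i j] l]; case: b' => [[i' j'] l'].
rewrite /boxset /= !in_itv /= => -[[h1 h2] h3] [[h1' h2'] h3'].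
rewrite (fl _ _ _ h1 h1') (fl _ _ _ h2 h2'); congr (_, _).
move: h3 h3' => /andP[h3 h4] /andP[h3' h4'].
have lt (a b : nat) : h * a%:R < x.2 -> x.2 <= h * b%:R + h -> (a <= b)%N.
  move=> ha hb; rewrite -ltnS -(ltr_nat R) -(ltr_pM2l h0).
  by apply: (lt_le_trans ha); rewrite -natr1 mulrDr mulr1.
by apply/eqP; rewrite eqn_leq !lt.
Qed.

Lemma boxset_cover (x : R * R * R) : 0 < x.2 -> exists b, boxset h b x.
Proof.
move=> x0.
have ex : exists n, x.2 <= h * n%:R.
  exists (Num.bound (x.2 / h)); rewrite mulrC -ler_pdivrMr//.
  by apply/ltW/archi_boundP; rewrite divr_ge0// ltW.
case: (ex_minnP ex) => -[|l] hl hmin.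
  by move: hl; rewrite mulr0 leNgt x0.
exists (Num.floor x.1.1, Num.floor x.1.2, l); rewrite /boxset /= !in_itv/=.
have fl (z : R) : (Num.floor z)%:~R <= z < (Num.floor z)%:~R + 1.
  by rewrite -[X in _ < _ + X]/(1%:~R) -intrD; exact: floor_itv.
rewrite !fl; do !split=> //; apply/andP; split.
  by rewrite ltNge; apply/negP => /hmin; rewrite ltnn.
by move: hl; rewrite -natr1 mulrDr mulr1.
Qed.

Variable bx : nat -> box.
Hypothesis bx_bij : bijective bx.

Local Notation mR := (measurableTypeR R).

Lemma cvg_muK (A : set (R * R * R)) : measurable A -> A `<=` upper_half_space ->
  (lebesgue3 A < +oo)%E ->
  (fun M => muK h bx M A) @ \oo --> fine (lebesgue3 A).
Proof.
move=> /measurable_mR3 mA Aup Afin.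
pose l2 : {measure set _ -> \bar _} := (@lebesgue_measure R \x @lebesgue_measure R)%E.
pose l3 : {measure set _ -> \bar _} := (l2 \x @lebesgue_measure R)%E.
pose F m := A `&` boxset h (bx m).
have mF m : @measurable _ (mR * mR * mR)%type (F m).
  apply: measurableI => //; apply: measurableX; last exact: measurable_itv.
  by apply: measurableX; exact: measurable_itv.
have UF : \bigcup_m F m = A.
  apply/seteqP; split=> x; first by move=> [m _ []].
  move=> Ax; have [b hb] := boxset_cover (Aup _ Ax).
  case: bx_bij => g gK Kg; exists (g b) => //.
  by split=> //; rewrite Kg.
have tF : trivIset setT F.
  move=> m m' _ _ [x [[_ h1] [_ h2]]]; apply: (bij_inj bx_bij).
  exact: boxset_uniq h1 h2.
have mUF : @measurable _ (mR * mR * mR)%type (\bigcup_m F m) by rewrite UF.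
have := @measure_semi_sigma_additive _ _ _ l3 F mF tF mUF.
rewrite UF => cv.
have fin m : (l3 (F m) < +oo)%E.
  by apply: le_lt_trans Afin; apply: le_measure; rewrite ?inE//; exact: subIsetl.
have : (fun n => fine (\sum_(0 <= i < n) l3 (F i))%E) @ \oo --> fine (l3 A).
  by apply: fine_cvg; rewrite fineK// ge0_fin_numE.
apply: cvg_trans; apply: near_eq_cvg; apply: nearW => n /=.
rewrite -sum_fine// => i _; rewrite ge0_fin_numE//; exact: fin.
Qed.

End boxes.

Section poisson_process.
Context (R : realType) (h : R) (bx : nat -> box).
Hypothesis h0 : 0 < h.
Hypothesis bx_bij : bijective bx.
Variable P : probability (Om cidx R) R.
Hypothesis iidP : has_iid_coords (T := R) (@unif01 R) P.
Local Notation KM := (count_upto h bx).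
Local Notation center_pt := (center_pt h bx).
Local Notation infinite_points := (infinite_points h).
Local Notation cle := (count_le h bx).

Lemma KM_prob M A l : measurable A ->
  P [set c | KM M A c = l] = (pois (muK h bx M A) l)%:E.
Proof.
move=> mA.
have t : trivIset setT ((fun=> A) : 'I_1 -> set (R * R * R)).
  by move=> i j _ _ _; rewrite (ord1 i) (ord1 j).
have := KM_pmf bx h0 iidP (fun=> mA) t M (fun=> l).
rewrite big_ord1 => <-.
by congr (P _); apply/seteqP; split=> c /= hc; [move=> _|apply: (hc ord0)].
Qed.

Lemma KM_le_prob M A k : measurable A ->
  P [set c | (KM M A c <= k)%N] = (\sum_(l < k.+1) pois (muK h bx M A) l)%:E.
Proof.
move=> mA.
rewrite (_ : [set c | _] = \big[setU/set0]_(l < k.+1) [set c | KM M A c = l]).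
  rewrite measure_bigsetU_ord_cond//.
  - by rewrite -sumEFin; apply: eq_bigr => l _; exact: KM_prob.
  - by move=> l _; apply: measurable_fiber; exact: measurable_KM.
  - by move=> i j _ _ [c [/= -> /val_inj]].
rewrite -bigcup_mkord_ord; apply/seteqP; split=> c /=.
  by move=> hc; exists (KM M A c); rewrite //= inordK.
by move=> [l /= lk ->]; rewrite inordK.
Qed.

Let Z := ~` [set c : Om cidx R | infinite_points c].

Let capKM A k : cle A k `\` Z = (\bigcap_M [set c | (KM M A c <= k)%N]) `\` Z.
Proof.
apply/seteqP; split=> c /= [h1 nZ]; (split; last exact: nZ); have ic := contrapT nZ.
  by move=> M _; exact: ((cle_KM bx A k ic).1 h1 M).
by apply/(cle_KM bx A k ic) => M; exact: (h1 M I).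
Qed.

Lemma KM_mono A c : {homo (fun M => KM M A c) : m n / (m <= n)%N}.
Proof.
move=> m n mn; rewrite /count_upto [leqRHS](big_cat_nat (n := m))//= leq_addr//.
Qed.

(** Continuity from above: when there are infinitely many points, [count_le] is the decreasing
    intersection of its versions for the first [M] boxes. *)
Lemma cle_prob_cvg (J : seq nat) (A : nat -> set (R * R * R)) (k : nat -> nat) :
  (forall n, measurable (A n)) ->
  (fun M => P (\bigcap_(n in [set` J]) [set c | (KM M (A n) c <= k n)%N])) @ \oo -->
  P (\bigcap_(n in [set` J]) cle (A n) (k n)).
Proof.
move=> mA.
have mK n M : measurable [set c | (KM M (A n) c <= k n)%N].
  exact: (measurable_nat_pre [set m | (m <= k n)%N] (measurable_KM _ h0 _ (mA n))).
pose F M := \bigcap_(n in [set` J]) [set c | (KM M (A n) c <= k n)%N].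
have mF M : measurable (F M) by apply: fin_bigcap_measurable.
rewrite (@eq_prob_off _ _ _ P _ (\bigcap_M F M) Z).
- apply: nonincreasing_cvg_mu => //.
  + by rewrite ltey_eq fin_num_measure//; exact: mF.
  + exact: bigcapT_measurable.
  + move=> M M' MM'; apply/subsetPset => c hc n nJ; exact: leq_trans (KM_mono _ _ MM') (hc n nJ).
- by apply: fin_bigcap_measurable => // n _; exact: measurable_cle.
- exact: bigcapT_measurable.
- exact: measurable_infinite_points.
- exact: infinite_points_ae.
apply/seteqP; split=> c /= [h1 h2]; (split; last exact: h2).
  move=> M _ n nJ /=; have : (cle (A n) (k n) `\` Z) c by split=> //; exact: h1.
  by rewrite capKM => -[/(_ M I)].
move=> n nJ /=; have : ((\bigcap_M [set c | (KM M (A n) c <= k n)%N]) `\` Z) c.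
  by split=> // M _; exact: (h1 M I n nJ).
by rewrite -capKM => -[].
Qed.

Lemma pois_cvg (u : nat -> R) l k : u @ \oo --> l ->
  (fun M => pois (u M) k) @ \oo --> pois l k.
Proof.
move=> ul; rewrite /pois; apply: cvgM; last exact: cvg_cst.
apply: cvgM.
  by apply: continuous_cvg; [exact: continuous_expR|exact: cvgN].
elim: k => [|k IH].
  by under eq_fun do rewrite expr0; rewrite expr0; exact: cvg_cst.
by under eq_fun do rewrite exprS; rewrite exprS; exact: cvgM.
Qed.

Lemma cle_prob A k : measurable A -> A `<=` upper_half_space -> (lebesgue3 A < +oo)%E ->
  P (cle A k) = (\sum_(l < k.+1) pois (fine (lebesgue3 A)) l)%:E.
Proof.
move=> mA Aup Afin.
have := @cle_prob_cvg [:: 0%N] (fun=> A) (fun=> k) (fun=> mA).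
have e (E : nat -> set (Om cidx R)) : \bigcap_(n in [set` [:: 0%N]]) E n = E 0%N.
  apply/seteqP; split=> c /=; first by apply; rewrite /= inE.
  by move=> hc n /=; rewrite inE => /eqP ->.
rewrite e => /cvg_lim <- //.
apply/cvg_lim => //.
rewrite (_ : (fun M => _) = EFin \o (fun M => \sum_(l < k.+1) pois (muK h bx M A) l)); last first.
  by apply/funext => M /=; rewrite e KM_le_prob.
apply/fine_cvgP; split; first exact: nearW.
rewrite (_ : _ \o _ = fun M => \sum_(l < k.+1) pois (muK h bx M A) l)//.
by apply: cvg_bigsum => l; apply: pois_cvg; exact: cvg_muK.
Qed.

End poisson_process.

Section poisson_main.
Context (R : realType) (h : R) (bx : nat -> box).
Hypothesis h0 : 0 < h.
Hypothesis bx_bij : bijective bx.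
Variable P : probability (Om cidx R) R.
Hypothesis iidP : has_iid_coords (T := R) (@unif01 R) P.
Local Notation KM := (count_upto h bx).
Local Notation center_pt := (center_pt h bx).
Local Notation cle := (count_le h bx).

(** The empty set makes the generators stable under intersection, since two different values of a
    count are incompatible. *)
Lemma KM_indep (A : nat -> set (R * R * R)) M :
  (forall n, measurable (A n)) -> trivIset setT A ->
  mutually_independent P (fun n => <<s [set E | E = set0 \/ exists k, E = [set c | KM M (A n) c = k]] >>).
Proof.
move=> mA tA; apply: mutually_independent_g_sigma.
- move=> n X [->|[k ->]]; first exact: measurable0.
  by apply: measurable_fiber; exact: measurable_KM.
- move=> n X Y [->|[k ->]]; first by left; rewrite set0I.
  move=> [->|[k' ->]]; first by left; rewrite setI0.
  have [->|kk'] := eqVneq k k'; first by rewrite setIid; right; exists k'.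
  by left; apply/seteqP; split=> c //= [-> e]; move: kk'; rewrite e eqxx.
move=> J B uJ hB.
have PE n k := KM_prob bx h0 iidP M k (mA n).
have [/hasP[n nJ /asboolP Bn]|/hasPn noempty] := boolP (has (fun n => `[< B n = set0 >]) J).
  rewrite (_ : \bigcap_(i in _) _ = set0); last first.
    by apply/seteqP; split=> c //= hc; have := hc n nJ; rewrite Bn.
  rewrite measure0 (big_rem n)//= Bn measure0 mul0e//.
have ex n : exists k, n \in J -> B n = [set c | KM M (A n) c = k].
  have [nJ|nJ] := boolP (n \in J); last by exists 0%N.
  have [e|[k e]] := hB n nJ; last by exists k.
  by have /asboolP := noempty n nJ.
have [k hk] := choice ex.
transitivity (P [set c | forall i : 'I_(size J), KM M (A (nth 0%N J i)) c = k (nth 0%N J i)]).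
  congr (P _); apply/seteqP; split=> c /= hc.
    by move=> i; have nJ := mem_nth 0%N (ltn_ord i); have := hc _ nJ; rewrite hk.
  move=> n /= nJ; rewrite hk//=; have nj := nJ; rewrite -index_mem in nj.
  by have := hc (Ordinal nj); rewrite /= nth_index.
rewrite (KM_pmf bx h0 iidP (A := fun i : 'I_(size J) => A (nth 0%N J i)))//; last first.
  move=> i j _ _ ne; apply/val_inj/eqP.
  rewrite -(nth_uniq 0%N (ltn_ord i) (ltn_ord j) uJ); apply/eqP; exact: tA.
transitivity (\prod_(0 <= i < size J) P (B (nth 0%N J i)))%E; last by rewrite [RHS](big_nth 0%N).
rewrite big_mkord -prodEFin; apply: eq_bigr => i _.
by rewrite hk ?mem_nth// PE.
Qed.

(** The product formula for the first [M] boxes passes to the limit. The sets may have infinite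
    volume, so the argument uses convergence of the probabilities and not their Poisson values. *)
Lemma cle_indep (A : nat -> set (R * R * R)) :
  (forall n, measurable (A n)) -> trivIset setT A ->
  mutually_independent P (fun n => [set cle (A n) k | k in [set: nat]]).
Proof.
move=> mA tA J B uJ hB.
have ex n : exists k, n \in J -> B n = cle (A n) k.
  have [nJ|nJ] := boolP (n \in J); last by exists 0%N.
  by have [k _ <-] := hB n nJ; exists k.
have [k hk] := choice ex.
have mc n : measurable (cle (A n) (k n)) by exact: measurable_cle.
have mK n M : measurable [set c | (KM M (A n) c <= k n)%N].
  exact: (measurable_nat_pre [set m | (m <= k n)%N] (measurable_KM _ h0 _ (mA n))).
have sK n M : <<s [set E | E = set0 \/ exists k, E = [set c | KM M (A n) c = k]] >> [set c | (KM M (A n) c <= k n)%N].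
  set G := [set E | _].
  rewrite -[<<s G >>]/(@measurable _ (g_sigma_algebraType G)).
  rewrite (_ : [set c | _] = \bigcup_(j in [set j | (j <= k n)%N]) [set c | KM M (A n) c = j]).
    by apply: bigcup_measurable => j _; apply: sub_sigma_algebra; right; exists j.
  by apply/seteqP; split=> c /=; [move=> hc; exists (KM M (A n) c)|move=> [j jk ->]].
have e (E : nat -> set (Om cidx R)) n : \bigcap_(i in [set` [:: n]]) E i = E n.
  apply/seteqP; split=> c /=; first by apply; rewrite /= inE.
  by move=> hc i /=; rewrite inE => /eqP ->.
have cv n : (fun M => fine (P [set c | (KM M (A n) c <= k n)%N])) @ \oo --> fine (P (cle (A n) (k n))).
  have := @cle_prob_cvg _ _ bx h0 P iidP [:: n] A k mA.
  rewrite e; under eq_fun do rewrite e.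
  by move=> cvn; apply: fine_cvg; rewrite fineK// fin_num_measure.
have cvJ := @cle_prob_cvg _ _ bx h0 P iidP J A k mA.
transitivity (P (\bigcap_(n in [set` J]) cle (A n) (k n))).
  by congr (P _); apply: eq_bigcapr => n /= nJ; rewrite hk.
move/cvg_lim : cvJ => <-//; apply/cvg_lim => //.
rewrite (_ : (fun M => _) = EFin \o (fun M => \prod_(n <- J) fine (P [set c | (KM M (A n) c <= k n)%N]))); last first.
  apply/funext => M /=; rewrite (@KM_indep A M mA tA J _ uJ)//.
  by rewrite -prodEFin; apply: eq_bigr => n _; rewrite fineK// fin_num_measure.
have -> : (\prod_(i <- J) P (B i))%E = (\prod_(n <- J) fine (P (cle (A n) (k n))))%:E.
  by rewrite -prodEFin big_seq [RHS]big_seq; apply: eq_bigr => n nJ; rewrite hk// fineK// fin_num_measure.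
apply/fine_cvgP; split; first exact: nearW.
by rewrite (_ : _ \o _ = (fun M => \prod_(n <- J) fine (P [set c | (KM M (A n) c <= k n)%N])))//; exact: cvg_bigprod.
Qed.

Lemma center_pt_poisson : unit_poisson_process P center_pt.
Proof.
split.
- move=> i c; have := pos_in_box bx h0 (sig h c i).1 (sig h c i).2 c.
  rewrite /boxset /= in_itv /= => -[_ /andP[+ _]].
  by apply: le_lt_trans; rewrite mulr_ge0// ltW.
- move=> A k mA Aup Afin /=.
  have Pc j : P (cle A j) = (\sum_(l < j.+1) pois (fine (lebesgue3 A)) l)%:E.
    exact: cle_prob.
  rewrite count_eqE; case: k => [|k].
    by rewrite setD0; have := Pc 0%N; rewrite big_ord1.
  transitivity (P (cle A k.+1) - P (cle A k))%E.
    rewrite measureD; last 3 first.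
    + exact: measurable_cle.
    + exact: measurable_cle.
    + by rewrite ltey_eq fin_num_measure//; exact: measurable_cle.
    congr (_ - P _)%E; apply: setIidr.
    by move=> c; rewrite /count_le /= => /le_trans; apply; rewrite lee_fin ler_nat.
  by rewrite !Pc [in X in (X - _)%E]big_ord_recr /= -EFinB addrAC subrr add0r.
- move=> A mA _ tA.
  have ind : mutually_independent P (fun n => <<s [set cle (A n) k | k in [set: nat]] >>).
    apply: mutually_independent_g_sigma.
    + by move=> n X [k _ <-]; exact: measurable_cle.
    + move=> n X Y [k _ <-] [k' _ <-]; exists (minn k k') => //.
      apply/seteqP; split=> c; rewrite /count_le /=.
        by move=> hc; split; apply: (le_trans hc); rewrite lee_fin ler_nat ?geq_minl ?geq_minr.
      by move=> [h1 h2]; rewrite /minn; case: ifP.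
    + exact: cle_indep.
  move=> J B uJ hB; apply: ind => // n nJ.
  by apply: events_of_count; exact: hB.
Qed.

End poisson_main.

(** * Renormalization *)

Definition cell := (int * int)%type.

Definition cdist (u v : cell) : nat := maxn `|u.1 - v.1|%N `|u.2 - v.2|%N.
Definition coarse (k : nat) (u : cell) : cell := ((u.1 %/ (6 ^ k)%N%:Z)%Z, (u.2 %/ (6 ^ k)%N%:Z)%Z).

Lemma cdistC u v : cdist u v = cdist v u.
Proof. by case: u v => [u1 u2] [v1 v2]; rewrite /cdist /=; lia. Qed.

Lemma cdist_triangle u v w : (cdist u w <= cdist u v + cdist v w)%N.
Proof. case: u v w => [u1 u2] [v1 v2] [w1 w2]; rewrite /cdist /=; lia. Qed.

Lemma coarse0 u : coarse 0 u = u.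
Proof. by case: u => u1 u2; rewrite /coarse !divz1. Qed.

Lemma divz_dist (L : nat) (x y : int) (m : nat) : (0 < L)%N ->
  (`|x - y| <= m * L)%N -> (`|(x %/ L%:Z)%Z - (y %/ L%:Z)%Z| <= m)%N.
Proof.
move=> L0 h.
have hx := divz_eq x L%:Z; have hy := divz_eq y L%:Z.
have hx1 := @modz_ge0 x L%:Z; have hx2 := @ltz_mod x L%:Z.
have hy1 := @modz_ge0 y L%:Z; have hy2 := @ltz_mod y L%:Z.
have L0' : L%:Z != 0 by lia.
move: (hx1 L0') (hx2 L0') (hy1 L0') (hy2 L0').
move: hx hy; move: (x %/ L%:Z)%Z (x %% L%:Z)%Z (y %/ L%:Z)%Z (y %% L%:Z)%Z => a b c d.
by nia.
Qed.

Lemma divz_dist_le2 (L : nat) (x y : int) (m : nat) : (0 < L)%N ->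
  (`|(x %/ L%:Z)%Z - (y %/ L%:Z)%Z| <= m)%N -> (`|x - y| < m.+1 * L)%N.
Proof.
move=> L0 h.
have hx := divz_eq x L%:Z; have hy := divz_eq y L%:Z.
have hx1 := @modz_ge0 x L%:Z; have hx2 := @ltz_mod x L%:Z.
have hy1 := @modz_ge0 y L%:Z; have hy2 := @ltz_mod y L%:Z.
have L0' : L%:Z != 0 by lia.
move: (hx1 L0') (hx2 L0') (hy1 L0') (hy2 L0').
move: h hx hy; move: (x %/ L%:Z)%Z (x %% L%:Z)%Z (y %/ L%:Z)%Z (y %% L%:Z)%Z => a b c d.
by nia.
Qed.

Lemma coarse_dist k u v m : (cdist u v <= m * 6 ^ k)%N -> (cdist (coarse k u) (coarse k v) <= m)%N.
Proof.
rewrite /cdist !geq_max => /andP[h1 h2].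
by rewrite !divz_dist// expn_gt0.
Qed.

Lemma coarse_dist_ge k u v m : (m.+1 <= cdist (coarse k u) (coarse k v))%N -> (m * 6 ^ k <= cdist u v)%N.
Proof.
move=> h; rewrite leqNgt; apply/negP => /ltnW /coarse_dist; by rewrite leqNgt h.
Qed.

Lemma coarse_dist_lt k u v m : (cdist (coarse k u) (coarse k v) <= m)%N -> (cdist u v < m.+1 * 6 ^ k)%N.
Proof.
rewrite /cdist geq_max gtn_max => /andP[h1 h2].
by rewrite !divz_dist_le2// expn_gt0.
Qed.

Lemma coarseS k u : coarse k.+1 u = coarse 1 (coarse k u).
Proof. by rewrite /coarse /= expn1 expnSr PoszM !divzMA_ge0. Qed.

(** Diagonal steps are allowed because a connected red region may pass through a common corner of
    two cells. *)
Inductive reach (U : cell -> Prop) (u : cell) : cell -> Prop :=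
| reach_refl : U u -> reach U u u
| reach_step v w : reach U u v -> (cdist v w <= 1)%N -> U w -> reach U u w.

Lemma reach_start U u v : reach U u v -> U u.
Proof. by elim. Qed.

Lemma reach_mono (U V : cell -> Prop) u v : (forall w, U w -> V w) -> reach U u v -> reach V u v.
Proof.
move=> UV; elim => [/UV|x y _ IH xy /UV Vy]; first exact: reach_refl.
exact: reach_step IH xy Vy.
Qed.

Lemma reach_trans U u v w : reach U u v -> reach U v w -> reach U u w.
Proof. by move=> uv; elim => // x y _ IH xy Uy; exact: reach_step xy Uy. Qed.

Lemma reach_sym U u v : reach U u v -> reach U v u.
Proof.
elim => [|x y ux IH xy Uy]; first exact: reach_refl.
apply: reach_trans IH; apply: (@reach_step _ _ y); [exact: reach_refl|by rewrite cdistC|].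
by elim: ux.
Qed.

(* Discrete intermediate value property, along the part of the path where [f] stays below [c]. *)
Lemma reach_ivt U u v (f : cell -> nat) c :
  (forall x y, (cdist x y <= 1)%N -> (f y <= (f x).+1)%N) ->
  reach U u v -> (f u <= c)%N -> (c <= f v)%N ->
  exists2 x, f x = c & reach (fun y => U y /\ (f y <= c)%N) u x.
Proof.
move=> flip uv fu.
have : (exists2 x, f x = c & reach (fun y => U y /\ (f y <= c)%N) u x) \/
  ((f v < c)%N /\ reach (fun y => U y /\ (f y <= c)%N) u v).
  elim: uv => [Uu|x y ux [IH|[fx IH]] xy Uy]; last 2 first.
  - by left.
  - have fy := flip x y xy; have [yc|yc] := ltnP (f y) c.
      by right; split=> //; apply: reach_step IH xy _; split=> //; exact: ltnW.
    have e : f y = c by lia.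
    by left; exists y => //; apply: reach_step IH xy _; rewrite e.
  have [uc|uc] := ltnP (f u) c; first by right; split=> //; apply: reach_refl.
  have e : f u = c by lia.
  by left; exists u => //; apply: reach_refl; rewrite e.
by case=> // -[vc _]; rewrite leqNgt vc.
Qed.

Section renormalization.
(* [noblue u]: no blue square is centred in the column of [u] early on;
   [occ k z]: some early red square of level [k] is centred in the level-[k] cell [z]. *)
Variables (noblue : cell -> Prop) (occ : nat -> cell -> Prop).

(** Neighbours and subcells are indexed by finite types of 25, 36 and 121 elements, which the union
    bounds count. *)
Definition shift2 (z : cell) (d : 'I_5 * 'I_5) : cell := (z.1 + d.1%:Z - 2, z.2 + d.2%:Z - 2).
Definition child (z : cell) (e : 'I_6 * 'I_6) : cell := (6 * z.1 + e.1%:Z, 6 * z.2 + e.2%:Z).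
Definition shift5 (z : cell) (d : 'I_11 * 'I_11) : cell := (z.1 + d.1%:Z - 5, z.2 + d.2%:Z - 5).

Fixpoint Bad (k : nat) (z : cell) : Prop :=
  if k is k'.+1 then
    (exists d, occ k (shift2 z d)) \/
    (exists e d, cdist (child z e) (shift5 (child z e) d) = 5%N /\
       Bad k' (child z e) /\ Bad k' (shift5 (child z e) d))
  else noblue z.

(** A discrete superset of the red region, as far as squares of level at most [k] can produce it. *)
Definition Uset (k : nat) (u : cell) : Prop :=
  noblue u \/ exists j z, [/\ (0 < j <= k)%N, occ j z & (cdist (coarse j u) z <= 1)%N].

(** The path is stopped at distance [6 ^ k.+1]. If no square of level [k.+1] is near, it stays in
    [Uset k]; it then escapes from the coarse cell of [u] and, read backwards, from a coarse cell at
    distance 5, so both are bad by induction. *)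
Lemma reach_Bad k u v : reach (Uset k) u v -> (6 ^ k <= cdist u v)%N -> Bad k (coarse k u).
Proof.
elim: k u v => [|k IH] u v uv duv.
  rewrite coarse0; case: (reach_start uv) => // -[j [z [/andP[j0 j1]]]]; lia.
have flip x y w : (cdist x y <= 1)%N -> (cdist w y <= (cdist w x).+1)%N.
  by move=> xy; have := cdist_triangle w x y; lia.
have duu : cdist u u = 0%N by rewrite /cdist !subrr.
have du0 : (cdist u u <= 6 ^ k.+1)%N by rewrite duu.
have [x dx ux] := @reach_ivt _ _ _ (cdist u) _ (fun x y => @flip x y u) uv du0 duv.
apply: contrapT => nB.
have noocc z : (cdist (coarse k.+1 u) z <= 2)%N -> ~ occ k.+1 z.
  move=> dz oz; apply: nB; left.
  have [d1 d2] : (`|z.1 - (coarse k.+1 u).1| <= 2 /\ `|z.2 - (coarse k.+1 u).2| <= 2)%N.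
    by move: dz; rewrite cdistC /cdist geq_max => /andP[].
  have l1 : (absz (z.1 - (coarse k.+1 u).1 + 2)%R < 5)%N by lia.
  have l2 : (absz (z.2 - (coarse k.+1 u).2 + 2)%R < 5)%N by lia.
  exists (Ordinal l1, Ordinal l2).
  rewrite (_ : shift2 _ _ = z)//; case: z l1 l2 d1 d2 {dz oz} => z1 z2 /= l1 l2 d1 d2.
  by rewrite /shift2 /=; congr (_, _); lia.
(* The stopped path stays within coarse distance 1 of its start and a relevant square is within 1 of
   the path, hence the radius 2 of [shift2]. *)
have ux' : reach (Uset k) u x.
  apply: reach_mono ux => y [[n|[j [z [/andP[j0 jk] oz dz]]]] dy]; first by left.
  right; exists j, z; split=> //; rewrite j0 /=.
  move: jk; rewrite leq_eqVlt => /predU1P[je|]; last by rewrite ltnS.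
  exfalso; apply: (noocc z); last by rewrite -je.
  have := @coarse_dist k.+1 u y 1; rewrite mul1n => /(_ dy) d1.
  by apply: leq_trans (cdist_triangle _ (coarse k.+1 y) _) _; rewrite -je in d1 *; lia.
have dux : (6 ^ k <= cdist u x)%N by rewrite dx leq_pexp2l.
have B1 := IH _ _ ux' dux.
set w := coarse k u.
(* Coarse distance at most 4 would give a distance below [5 * 6 ^ k], less than [6 ^ k.+1]. *)
have dwx : (5 <= cdist w (coarse k x))%N.
  rewrite leqNgt ltnS; apply/negP => /coarse_dist_lt.
  by rewrite dx expnS; lia.
have dww : (cdist w (coarse k u) <= 5)%N by rewrite /cdist !subrr.
have flipc x' y : (cdist x' y <= 1)%N -> (cdist w (coarse k y) <= (cdist w (coarse k x')).+1)%N.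
  move=> xy; have : (cdist (coarse k x') (coarse k y) <= 1)%N.
    by apply: coarse_dist; apply: leq_trans xy _; rewrite mul1n expn_gt0.
  exact: flip.
have [y dy uy] := @reach_ivt _ _ _ (fun y => cdist w (coarse k y)) 5 flipc ux' dww dwx.
have uy' : reach (Uset k) u y by apply: reach_mono uy => ? [].
(* Coarse distance 5 leaves ample room for the reversed path to cover the distance [6 ^ k]. *)
have duy : (6 ^ k <= cdist y u)%N.
  rewrite cdistC -[X in (X <= _)%N]mul1n; apply: coarse_dist_ge.
  by rewrite -/w dy.
have B2 := IH _ _ (reach_sym uy') duy.
apply: nB; right.
have [e ew] : exists e, child (coarse k.+1 u) e = w.
  rewrite coarseS -/w; case: (w) => w1 w2; rewrite /coarse expn1 /child /=.
  have m1 : (absz (w1 %% 6)%Z < 6)%N by have := @modz_ge0 w1 6; have := @ltz_mod w1 6; lia.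
  have m2 : (absz (w2 %% 6)%Z < 6)%N by have := @modz_ge0 w2 6; have := @ltz_mod w2 6; lia.
  exists (Ordinal m1, Ordinal m2) => /=.
  have := divz_eq w1 6; have := divz_eq w2 6; have := @modz_ge0 w1 6; have := @modz_ge0 w2 6.
  by move=> ? ? ? ?; congr (_, _); lia.
have [d dw] : exists d, shift5 w d = coarse k y.
  move: dy; rewrite /cdist; case: (w) (coarse k y) => w1 w2 [y1 y2] /= dy.
  have l1 : (absz (y1 - w1 + 5)%R < 11)%N by lia.
  have l2 : (absz (y2 - w2 + 5)%R < 11)%N by lia.
  exists (Ordinal l1, Ordinal l2).
  by rewrite /shift5 /=; congr (_, _); lia.
by exists e, d; rewrite ew dw.
Qed.

End renormalization.

(** * From paths of cells to connected components *)

Section components.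
Context (R : realType).

Definition fcell (x : R * R) : cell := (Num.floor x.1, Num.floor x.2).

Lemma floor_near (a b : R) : `|a - b| < 1 -> (`|Num.floor a - Num.floor b| <= 1)%N.
Proof.
move=> ab; have /andP[a1 a2] := floor_itv a; have /andP[b1 b2] := floor_itv b.
move: ab; rewrite ltr_norml => /andP[ab1 ab2].
rewrite !intrD in a2 b2.
have h1 : (Num.floor a)%:~R < ((Num.floor b) + 2)%:~R :> R.
  by rewrite intrD; lra.
have h2 : (Num.floor b)%:~R < ((Num.floor a) + 2)%:~R :> R.
  by rewrite intrD; lra.
move: h1 h2; rewrite !ltr_int; move: (Num.floor a) (Num.floor b) => m n.
have : (`|m - n|%N <= 1)%N = (`|m - n| <= 1) by [].
move=> _ h1 h2.
rewrite -lez_nat abszE ler_norml; apply/andP; split; move: h1 h2; rewrite -!ltzD1; lra.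
Qed.

Lemma floor_dist (a b : R) K : (`|Num.floor a - Num.floor b| <= K)%N -> `|a - b| <= K%:R + 1.
Proof.
move=> h; have /andP[a1 a2] := floor_itv a; have /andP[b1 b2] := floor_itv b.
rewrite !intrD in a2 b2.
have : `|(Num.floor a - Num.floor b)%:~R| <= K%:R :> R.
  by rewrite -intr_norm -[K%:R]/(K%:Z%:~R) ler_int -abszE lez_nat.
rewrite intrB !ler_norml => /andP[h1 h2]; apply/andP; split; lra.
Qed.

(** Points at distance less than 1 lie in equal or adjacent cells. The points of the component whose
    cell is reachable therefore form a relatively open and closed subset, hence the whole
    component. *)
Lemma bounded_component (S : set (R * R)) (U : cell -> Prop) (x : R * R) (K : nat) :
  (forall y, S y -> U (fcell y)) ->
  (forall v, reach U (fcell x) v -> (cdist (fcell x) v <= K)%N) ->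
  S x -> bounded_set (connected_component S x).
Proof.
move=> SU hK Sx; set C := connected_component S x.
have CS : C `<=` S by exact: connected_component_sub.
have Cx : C x by exact: connected_component_refl.
pose D := [set y | reach U (fcell x) (fcell y)].
have step y z : C y -> C z -> ball y 1 z -> reach U (fcell x) (fcell y) -> reach U (fcell x) (fcell z).
  move=> Cy Cz [b1 b2] ry; apply: reach_step ry _ (SU _ (CS _ Cz)).
  by rewrite /cdist geq_max !floor_near.
have CD : C `&` D = C.
  apply: (@component_connected _ S x (C `&` D)).
  - by exists x; split=> //; apply: reach_refl; exact: SU.
  - exists (\bigcup_(y in C `&` D) ball y 1).
      by apply: bigcup_open => y _; exact: ball_open.
    apply/seteqP; split=> z [Cz].
      by move=> Dz; split=> //; exists z => //; exact: ballxx.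
    by move=> [y [Cy Dy] yz]; split=> //; exact: step yz Dy.
  - exists (~` \bigcup_(y in C `&` ~` D) ball y 1).
      by apply: open_closedC; apply: bigcup_open => y _; exact: ball_open.
    apply/seteqP; split=> z [Cz].
      move=> Dz; split=> // -[y [Cy nDy] yz]; apply: nDy.
      by apply: (step z) => //; exact: ball_sym.
    move=> nz; split=> //; apply: contrapT => nDz; apply: nz.
    by exists z => //; exact: ballxx.
have bnd y : C y -> `|y.1 - x.1| <= K%:R + 1 /\ `|y.2 - x.2| <= K%:R + 1.
  rewrite -CD => -[_ /hK]; rewrite cdistC /cdist geq_max => /andP[h1 h2].
  by split; exact: floor_dist.
exists (`|x| + K%:R + 1); split; first exact: num_real.
move=> M hM y /bnd [h1 h2]; apply: le_trans (ltW hM).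
rewrite prod_normE ge_max.
have l (a b : R) : `|a - b| <= K%:R + 1 -> `|b| <= `|x| -> `|a| <= `|x| + K%:R + 1.
  move=> hab hb; rewrite -[a](subrK b); apply: le_trans (ler_normD _ _) _; lra.
by rewrite (l _ x.1)// ?(l _ x.2)// prod_normE le_max lexx ?orbT.
Qed.

End components.

(* Marks are indexed by the number of a point in [midx], and by its box and its rank in
   this box in [nidx]; [true] selects the colour variable, [false] the level variable. *)
Definition midx := (cidx + nat * bool)%type.
Definition nidx := (cidx + nat * nat * bool)%type.

(** * Marked points *)

Section marks.
Context (R : realType) (h : R) (bx : nat -> box).
Hypothesis h0 : 0 < h.

Local Notation sig := (@sig R h).

Definition mark_sig (c : Om cidx R) (i : nat * bool) : nat * nat * bool := (sig c i.1, i.2).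

Lemma mark_sig_inj c : injective (mark_sig c).
Proof. by move=> [i b] [i' b'] [/sig_inj -> ->]. Qed.

Lemma measurable_mark_sig i p : measurable [set c | mark_sig c i = p].
Proof.
case: i p => [i b] [p b']; have [->|bb] := eqVneq b b'.
  rewrite (_ : [set c | _] = [set c | sig c i = p]); first exact: measurable_sig.
  by apply/seteqP; split=> c /=; [case|rewrite /mark_sig /= => ->].
rewrite (_ : [set c | _] = set0)//; apply/seteqP; split=> c //= [_ /eqP].
by rewrite (negbTE bb).
Qed.

(** The mark of the [i]-th point is looked up at its box and rank: a sample with local marks
    produces one with global marks. *)
Definition relab : Om nidx R -> Om midx R := relabel mark_sig.

Lemma measurable_relab : measurable_fun setT relab.
Proof. exact: (measurable_relabel measurable_mark_sig). Qed.

Variable Pm : probability (Om midx R) R.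
Hypothesis iidm : has_iid_coords (T := R) (@unif01 R) Pm.
Variable Pn : probability (Om nidx R) R.
Hypothesis iidn : has_iid_coords (T := R) (@unif01 R) Pn.

Lemma relab_law E : measurable E -> Pm E = Pn (relab @^-1` E).
Proof.
move=> mE.
have := @Om_measure_unique _ _ _ R Pm (law Pn (measurable_relabel measurable_mark_sig)).
apply=> // J A uJ mA.
rewrite (iidm uJ mA).
have u0 (B : set R) : (0 <= unif01 B)%E by exact: measure_ge0.
exact: (esym (@relabel_iid _ _ _ _ R R (@unif01 R) Pn u0 iidn mark_sig mark_sig_inj measurable_mark_sig J A uJ mA)).
Qed.

Definition ctr (i : nat) (w : Om midx R) : R * R * R := center_pt h bx i (centers w).

Definition markM (A B : set R) (b : box) (w : Om midx R) : Prop :=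
  exists i, [/\ boxset h b (ctr i w), A (w (inr (i, true))) & B (w (inr (i, false)))].

(** The counterpart of [markM] for local marks; it involves only the variables of the box [m]. *)
Definition markN (A B : set R) (m : nat) (w : Om nidx R) : Prop :=
  exists j, [/\ (j < cnt h m (centers w))%N, A (w (inr (m, j, true))) & B (w (inr (m, j, false)))].

Lemma centers_relab w : centers (relab w) = centers w.
Proof. by []. Qed.

Lemma markN_M A B m w : markN A B m w -> markM A B (bx m) (relab w).
Proof.
move=> [j [jm Aj Bj]]; exists (SM h m (centers w) + j)%N.
rewrite /ctr centers_relab /center_pt /relab /relabel /= /mark_sig /= sig_SM//.
by split=> //; exact: pos_in_box.
Qed.

Hypothesis bx_bij : bijective bx.

Lemma markM_N A B m w : infinite_points h (centers w) ->
  markM A B (bx m) (relab w) -> markN A B m w.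
Proof.
move=> iw [i []].
rewrite /ctr centers_relab /center_pt /relab /relabel /= /mark_sig /=.
have [[m' /[dup] hm /andP[h1 h2]]|[h1 _]] := sigP h (centers w) i; last first.
  by have [M] := iw i; rewrite ltnNge h1.
rewrite (sigE hm) /= => hb Ai Bi.
have mm : m' = m.
  apply: (bij_inj bx_bij); apply: (boxset_uniq h0 _ hb); exact: pos_in_box.
exists (i - SM h m (centers w))%N; rewrite -mm; split=> //.
by rewrite ltn_subLR// -SMS.
Qed.

Lemma measurable_ctr i : measurable_fun setT (ctr i).
Proof.
apply: (@measurableT_comp _ _ _ _ _ _ (center_pt h bx i)); first exact: measurable_center_pt.
exact: measurable_centers.
Qed.

Lemma measurable_markM A B b : measurable A -> measurable B -> measurable [set w | markM A B b w].
Proof.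
move=> mA mB; rewrite (_ : [set w | _] = \bigcup_i (ctr i @^-1` boxset h b `&`
   [set w | A (w (inr (i, true)))] `&` [set w | B (w (inr (i, false)))])).
  apply: bigcupT_measurable => i; apply: measurableI; first apply: measurableI.
  - rewrite -[X in measurable X]setTI; apply: measurable_ctr => //; exact: measurable_boxset.
  - exact: measurable_coord_pre.
  - exact: measurable_coord_pre.
by apply/seteqP; split=> w /=; [move=> [i [? ? ?]]; exists i|move=> [i _ [[? ?] ?]]; exists i].
Qed.

Definition cntN m (w : Om nidx R) : nat := cnt h m (centers w).

Lemma measurable_cntN m : measurable_fun setT (cntN m).
Proof.
apply: (@measurableT_comp _ _ _ _ _ _ (cnt h m)); first exact: measurable_cnt.
exact: measurable_centers.
Qed.

Lemma measurable_markN A B m : measurable A -> measurable B -> measurable [set w | markN A B m w].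
Proof.
move=> mA mB; rewrite (_ : [set w | _] = \bigcup_j ([set w | (j < cntN m w)%N] `&`
   [set w | A (w (inr (m, j, true)))] `&` [set w | B (w (inr (m, j, false)))])).
  apply: bigcupT_measurable => j; apply: measurableI; first apply: measurableI.
  - exact: (measurable_nat_pre [set n | (j < n)%N] (measurable_cntN m)).
  - exact: measurable_coord_pre.
  - exact: measurable_coord_pre.
by apply/seteqP; split=> w /=; [move=> [i [? ? ?]]; exists i|move=> [i _ [[? ?] ?]]; exists i].
Qed.

Definition boxof (i : nidx) : nat :=
  match i with inl (inl m) => m | inl (inr (m, _, _)) => m | inr (m, _, _) => m end.

Lemma depends_markN A B m : depends_on [set i | boxof i = m] [set w | markN A B m w].
Proof.
move=> w w' hw /= [j [jm Aj Bj]]; exists j; rewrite -!hw//; split=> //.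
by move: jm; rewrite /cnt /centers -hw.
Qed.

Lemma depends_onC (I U : Type) (S : set I) (E : set (I -> U)) : depends_on S E -> depends_on S (~` E).
Proof. by move=> dE w w' hw nE Ew'; apply: nE; apply: dE Ew' => i Si; rewrite hw. Qed.

(** Given [n] points in the box, all of them avoid the marks with probability [(1 - q) ^+ n]. *)
Lemma mark_void A B m : measurable A -> measurable B ->
  Pn (~` [set w | markN A B m w]) =
  (expR (- (h * (fine (unif01 A) * fine (unif01 B)))))%:E.
Proof.
move=> mA mB; set q := fine (unif01 A) * fine (unif01 B).
have iidP := iidn.
pose mk j := [set w : Om nidx R | A (w (inr (m, j, true)))] `&` [set w | B (w (inr (m, j, false)))].
have mmk j : measurable (mk j) by apply: measurableI; exact: measurable_coord_pre.
have Pmk j : Pn (~` mk j) = (1 - q)%:E.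
  rewrite probability_setC// EFinB; congr (_ - _)%E.
  rewrite (indep2 iidP (S := [set inr (m, j, true)])).
  - by rewrite !(iid_coord _ iidP)// EFinM !fineK// fin_num_measure.
  - exact: measurable_coord_pre.
  - exact: measurable_coord_pre.
  - by move=> w w' hw /=; rewrite hw.
  - by move=> w w' hw /=; rewrite hw.
pose E n := [set w | cntN m w = n] `&` [set w | forall j, (j < n)%N -> (~` mk j) w].
have Ecap n : [set w | forall j, (j < n)%N -> (~` mk j) w] = \bigcap_(j in [set` iota 0 n]) (~` mk j).
  apply/seteqP; split=> w /= hw j; first by rewrite /= mem_iota => /hw.
  by move=> jn; apply: hw; rewrite /= mem_iota.
have mcn n : measurable [set w | cntN m w = n].
  by apply: measurable_fiber; exact: measurable_cntN.
have mE n : measurable (E n).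
  apply: measurableI => //.
  by rewrite Ecap; apply: fin_bigcap_measurable => // j _; exact: measurableC.
(* The weight [pois h n * (1 - q) ^+ n] is a constant times a Poisson weight of parameter
   [h * (1 - q)], whose sum is 1. *)
have PE n : Pn (E n) = ((expR (- (h * q)))%:E * (pois (h * (1 - q)) n)%:E)%E.
  pose F (o : option nat) := if o is Some j then ~` mk j else [set w | cntN m w = n].
  pose S (o : option nat) : set nidx :=
    if o is Some j then [set i | i = inr (m, j, true) \/ i = inr (m, j, false)] else [set inl (inl m)].
  have := @indep_family _ _ _ _ _ _ iidP _ S (None :: map Some (iota 0 n)) F.
  rewrite /= bigcap_cons => IH.
  transitivity (Pn (F None `&` \bigcap_(i in [set` map Some (iota 0 n)]) F i)).
    rewrite /E Ecap; congr (Pn (_ `&` _)); apply/seteqP; split=> w /= hw.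
      by move=> _ /mapP[j + ->] => /hw.
    by move=> j jn; apply: (hw (Some j)); rewrite /= map_f.
  rewrite IH.
  + rewrite big_cons big_map /F.
    rewrite (_ : Pn [set w | cntN m w = n] = (pois h n)%:E); last first.
      rewrite -(@quantile_law _ (pois h)); last 2 first.
      - by move=> k; apply: pois_ge0; exact: ltW.
      - exact: cvg_sum_pois.
      apply: (iid_coord _ iidP (A := [set u | quantile (pois h) u = n])).
      by apply: measurable_fiber; apply: measurable_quantile => k; apply: pois_ge0; exact: ltW.
    under eq_bigr do rewrite Pmk.
    rewrite prodEFin -!EFinM; congr EFin.
    rewrite big_const_seq count_predT size_iota iter_mulr_1 /pois exprMn.
    rewrite (_ : - h = - (h * q) + - (h * (1 - q))); last by ring.
    by rewrite expRD; ring.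
  + by rewrite map_inj_uniq ?iota_uniq ?andbT; [apply/mapP => -[]|move=> ? ? []].
  + by move=> [j|] _; [apply: measurableC; exact: mmk|exact: mcn].
  + move=> [j|] _.
      apply: depends_onC => w w' hw /= [Aj Bj]; rewrite /mk /=.
      by split; rewrite -hw//; [left|right].
    by move=> w w' hw /=; rewrite /cntN /cnt /centers hw.
  + move=> [j|] [j'|] _ _ // jj'; apply/seteqP; split=> i //=.
    * move=> [h1 h2]; case: h1 => h1; case: h2 => h2; move: h2; rewrite h1 => -[] // e;
      by move: jj'; rewrite e eqxx.
    * by move=> [[->|->]].
    * by move=> [-> []].
rewrite (_ : ~` _ = \bigcup_n E n); last first.
  apply/seteqP; split=> w /=.
    move=> nw; exists (cntN m w) => //; split=> // j jm [Aj Bj]; apply: nw.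
    by exists j.
  by move=> [n _ [/= <- hw]] [j [jm Aj Bj]]; exact: (hw j jm).
rewrite measure_bigcup//; last first.
  by move=> n n' _ _ [w [[/= <- _] [/= <- _]]].
transitivity (\sum_(n <oo) ((expR (- (h * q)))%:E * (pois (h * (1 - q)) n)%:E))%E.
  by apply: congr_lim; apply/funext => n; apply: eq_big => k; [rewrite in_setT|move=> _; exact: PE].
have q1 : 0 <= 1 - q by rewrite -lee_fin -(Pmk 0%N) measure_ge0.
rewrite nneseriesZl; last first.
  by move=> i _; rewrite lee_fin pois_ge0// mulr_ge0// ltW.
by rewrite nneseries_pois mule1.
Qed.

End marks.

Lemma centers_iid (R : realType) (M : eqType) (P : probability (Om (cidx + M)%type R) R) :
  has_iid_coords (T := R) (@unif01 R) P ->
  has_iid_coords (T := R) (@unif01 R) (law P (@measurable_centers _ _ R M)).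
Proof.
by move=> iidP; have := precomp_iid iidP (f := inl : cidx -> cidx + M); apply => ? ? [].
Qed.

(** Transfers estimates from local to global marks; the implication between the events is checked
    only when there are infinitely many points. *)
Lemma relab_le (R : realType) (h : R) (h0 : 0 < h)
    (Pm : probability (Om midx R) R) (iidm : has_iid_coords (T := R) (@unif01 R) Pm)
    (Pn : probability (Om nidx R) R) (iidn : has_iid_coords (T := R) (@unif01 R) Pn)
    (E : set (Om midx R)) (F : set (Om nidx R)) : measurable E -> measurable F ->
  (forall w, infinite_points h (centers w) -> E (relab h w) -> F w) -> (Pm E <= Pn F)%E.
Proof.
move=> mE mF EF.
pose Z : set (Om nidx R) := [set w | ~ infinite_points h (centers w)].
have mc : measurable_fun setT (fun w : Om nidx R => centers w : Om cidx R) by exact: measurable_centers.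
have mZ : measurable Z by have := mc measurableT _ (measurable_infinite_points h0); rewrite setTI.
have PZ : (Pn Z <= 0)%E.
  rewrite le_eqVlt; apply/orP; left; apply/eqP.
  exact: (infinite_points_ae h0 (centers_iid iidn)).
rewrite [leLHS](_ : _ = Pn (relab h @^-1` E)); last exact: (relab_law h0 iidm iidn).
apply: (@le_trans _ _ (Pn (Z `|` F))).
  apply: le_measure; rewrite ?inE.
  - rewrite -[X in measurable X]setTI; exact: (@measurable_relab R h).
  - exact: measurableU.
  by move=> w hw; have [iw|] := pselect (infinite_points h (centers w)); [right; exact: EF|left].
apply: (le_trans (measureU2 _ mZ mF)).
by apply: (@le_trans _ _ (0 + Pn F)%E); [exact: leeD|rewrite add0e].
Qed.

Lemma prob_exists_le d (T : measurableType d) (R : realType) (P : probability T R)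
    (K : finType) (E : K -> set T) (b : R) :
  (forall k, measurable (E k)) -> (forall k, P (E k) <= b%:E)%E ->
  (P [set w | exists k, E k w] <= (#|K|%:R * b)%:E)%E.
Proof.
move=> mE Eb.
have h (s : seq K) : (P [set w | exists2 k, k \in s & E k w] <= ((size s)%:R * b)%:E)%E /\
    measurable [set w | exists2 k, k \in s & E k w].
  elim: s => [|k s [IH mIH]].
    rewrite (_ : [set w | _] = set0); last by apply/seteqP; split=> w //= -[].
    by rewrite measure0 mul0r.
  have e : [set w | exists2 k0, k0 \in k :: s & E k0 w] = E k `|` [set w | exists2 k, k \in s & E k w].
    apply/seteqP; split=> w /=.
      by move=> [k']; rewrite inE => /predU1P[->|ks] Ew; [left|right; exists k'].
    by case=> [Ew|[k' ks Ew]]; [exists k; rewrite ?mem_head|exists k'; rewrite ?inE ?ks ?orbT].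
  rewrite e; split; last exact: measurableU.
  apply: (le_trans (measureU2 _ _ _)) => //=.
  by rewrite -natr1 mulrDl mul1r EFinD addeC; apply: leeD.
rewrite (_ : [set w | _] = [set w | exists2 k, k \in enum K & E k w]).
  by rewrite cardE; have [] := h (enum K).
apply/seteqP; split=> w [k]; first by move=> Ek; exists k => //; rewrite mem_enum.
by move=> _ Ek; exists k.
Qed.

Lemma measurable_exists d (T : measurableType d) (K : countType) (E : K -> set T) :
  (forall k, measurable (E k)) -> measurable [set w | exists k, E k w].
Proof.
move=> mE; rewrite (_ : [set w | _] = \bigcup_k E k); last first.
  by apply/seteqP; split=> w [k]; [exists k|exists k].
exact: countable_bigcupT_measurable.
Qed.

(** * Probability that a cell is bad *)

Section bad_measurable.
Context d (Omega : measurableType d).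
Variables (nb : cell -> set Omega) (oc : nat -> cell -> set Omega).
Hypothesis mnb : forall u, measurable (nb u).
Hypothesis moc : forall k z, measurable (oc k z).

Definition BadE k z : set Omega := [set w | Bad (nb ^~ w) (fun k z => oc k z w) k z].

(** The distance condition is put inside the event, with value [set0] when it fails, so that unions
    run over a full finite type. *)
Definition far (k : nat) (z : cell) (ed : ('I_6 * 'I_6) * ('I_11 * 'I_11)) : set Omega :=
  if cdist (child z ed.1) (shift5 (child z ed.1) ed.2) == 5%N
  then BadE k (child z ed.1) `&` BadE k (shift5 (child z ed.1) ed.2) else set0.

Lemma BadES k z : BadE k.+1 z =
  [set w | exists d, oc k.+1 (shift2 z d) w] `|` [set w | exists ed, far k z ed w].
Proof.
apply/seteqP; split=> w /=; rewrite /BadE /=.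
  case=> [?|[e [f [de [B1 B2]]]]]; first by left.
  by right; exists (e, f); rewrite /far /= de eqxx.
case=> [?|[[e f]]]; first by left.
rewrite /far /=; case: eqP => // de [B1 B2].
by right; exists e, f.
Qed.

Lemma measurable_BadE k z : measurable (BadE k z).
Proof.
elim: k z => [|k IH] z; first exact: mnb.
rewrite BadES; apply: measurableU; apply: measurable_exists => //.
by move=> ed; rewrite /far; case: ifP => // _; exact: measurableI.
Qed.

Lemma measurable_far k z ed : measurable (far k z ed).
Proof. by rewrite /far; case: ifP => // _; apply: measurableI; exact: measurable_BadE. Qed.

End bad_measurable.

Section bad_prob.
Context (I : eqType) (R : realType) (mu : set R -> \bar R).
Variable P : probability (Om I R) R.
Hypothesis iidP : has_iid_coords (T := R) mu P.
Variable ucol : I -> cell.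
Variables (nb : cell -> set (Om I R)) (oc : nat -> cell -> set (Om I R)).
Hypothesis mnb : forall u, measurable (nb u).
Hypothesis moc : forall k z, measurable (oc k z).
Hypothesis dnb : forall u, depends_on [set i | ucol i = u] (nb u).
Hypothesis doc : forall k z, depends_on [set i | coarse k (ucol i) = z] (oc k z).

Local Notation BadE := (BadE nb oc).

(** The radius 2 reproduces itself: a child, a jump of 5 and a radius of 2 add up to 7 cells, less
    than 2 coarse cells of side 6. *)
Lemma depends_BadE k z : depends_on [set i | (cdist (coarse k (ucol i)) z <= 2)%N] (BadE k z).
Proof.
elim: k z => [|k IH] z.
  apply: (depends_on_sub (S := [set i | ucol i = z])); last exact: dnb.
  by move=> i /= ->; rewrite coarse0 /cdist !subrr.
have child_coarse (e : 'I_6 * 'I_6) : coarse 1 (child z e) = z.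
  case: z e => [z1 z2] [e1 e2]; rewrite /coarse /child expn1 /=.
  by congr (_, _); rewrite mulrC divzMDl// divz_small ?addr0//= ltz_nat ltn_ord.
have sub (e : 'I_6 * 'I_6) v i : (cdist v (child z e) <= 5)%N ->
   (cdist (coarse k (ucol i)) v <= 2)%N -> (cdist (coarse k.+1 (ucol i)) z <= 2)%N.
  move=> hv hi; rewrite coarseS -(child_coarse e); apply: coarse_dist.
  by have := cdist_triangle (coarse k (ucol i)) v (child z e); rewrite expn1; lia.
rewrite BadES => w w' hw [[d oz]|[[e d]]].
  left; exists d; apply: doc oz => i iz; apply: hw; rewrite /= iz.
  case: (d) => [[d1 p1] [d2 p2]]; case: (z) => z1 z2; rewrite /cdist /shift2 /=; lia.
rewrite /far /=; case: eqP => // de [B1 B2].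
right; exists (e, d); rewrite /far /= de eqxx; split.
  apply: IH B1 => i hi; apply: hw; apply: (sub e _ i _ hi).
  by rewrite /cdist !subrr.
by apply: IH B2 => i hi; apply: hw; apply: (sub e _ i _ hi); rewrite cdistC de.
Qed.

(** Cells at distance 5 look at disjoint sets of columns because 2 + 2 < 5. *)
Lemma far_prob k z ed b : (forall z, (P (BadE k z) <= b%:E)%E) -> 0 <= b ->
  (P (far nb oc k z ed) <= (b * b)%:E)%E.
Proof.
move=> hb b0; rewrite /far; case: eqP => [de|_]; last first.
  by rewrite measure0 lee_fin mulr_ge0.
have mB z' : measurable (BadE k z') by exact: measurable_BadE.
rewrite (indep2 iidP (S := [set i | (cdist (coarse k (ucol i)) (child z ed.1) <= 2)%N])) //.
- by rewrite EFinM; apply: lee_pmul.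
- exact: depends_BadE.
- apply: depends_on_sub (@depends_BadE k (shift5 (child z ed.1) ed.2)) => i /= h1 h2.
  have := cdist_triangle (child z ed.1) (coarse k (ucol i)) (shift5 (child z ed.1) ed.2).
  by rewrite de cdistC; lia.
Qed.

(** Union bound over 25 = 5 * 5 neighbours and 4356 = 36 * 121 pairs of cells. *)
Lemma Bad_prob_step k z b o : (forall z, (P (BadE k z) <= b%:E)%E) -> 0 <= b ->
  (forall z, (P (oc k.+1 z) <= o%:E)%E) ->
  (P (BadE k.+1 z) <= (25%:R * o + 4356%:R * (b * b))%:E)%E.
Proof.
move=> hb b0 ho; rewrite BadES.
have mf ed : measurable (far nb oc k z ed) by exact: measurable_far.
apply: (le_trans (measureU2 _ _ _)); [exact: measurable_exists|exact: measurable_exists|].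
rewrite EFinD; apply: leeD.
  have := @prob_exists_le _ _ _ P _ (fun d => oc k.+1 (shift2 z d)) o (fun d => moc _ _) (fun d => ho _).
  by rewrite card_prod !card_ord.
have := @prob_exists_le _ _ _ P _ (far nb oc k z) _ mf (fun ed => far_prob _ ed hb b0).
by rewrite !card_prod !card_ord.
Qed.

Variables (e : R) (o : R) (n : nat).
Hypothesis e0 : 0 <= e.
Hypothesis hnb : forall u, (P (nb u) <= e%:E)%E.
Hypothesis hoc : forall k z, (0 < k)%N -> (P (oc k z) <= o%:E)%E.
Hypothesis hocn : forall k z, (n < k)%N -> P (oc k z) = 0%E.
Hypothesis ho : 25%:R * o <= e / 2.
Hypothesis he : 4356%:R * e <= 2^-1.

(** By [ho] and [he] the red squares and the pairs of bad cells account for half of [e] each, so the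
    bound reproduces itself. *)
Lemma Bad_prob k z : (P (BadE k z) <= e%:E)%E.
Proof.
elim: k z => [|k IH] z; first exact: hnb.
apply: le_trans (Bad_prob_step z IH e0 (fun z => hoc z (ltn0Sn k))) _.
rewrite lee_fin; have : 4356%:R * (e * e) <= 2^-1 * e by rewrite mulrA ler_wpM2r.
by move: ho; lra.
Qed.

(** Beyond level [n] only the quadratic term remains, and by [he] it at least halves the bound. *)
Lemma Bad_prob_decay k z : (P (BadE (n + k) z) <= (2^-1 ^+ k)%:E)%E.
Proof.
have p2 j : 0 <= 2^-1 ^+ j :> R by rewrite exprn_ge0// invr_ge0.
(* The factor [e] is kept in the induction since it is what absorbs 4356. *)
suff : (P (BadE (n + k) z) <= (e * 2^-1 ^+ k)%:E)%E.
  move=> /le_trans; apply; rewrite lee_fin ler_piMl//; move: he; lra.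
elim: k z => [|k IH] z; first by rewrite addn0 expr0 mulr1; exact: Bad_prob.
have oc0 z' : (P (oc (n + k).+1 z') <= 0%:E)%E by rewrite hocn// ltnS leq_addr.
rewrite addnS; apply: le_trans (Bad_prob_step z IH _ oc0) _; first by rewrite mulr_ge0.
rewrite lee_fin exprS; have := p2 k.
have : 2^-1 ^+ k <= 1 :> R by rewrite exprn_ile1 ?invr_ge0// invf_le1// ler1n.
set x := 2^-1 ^+ k => x1 x0; rewrite mulr0 add0r.
have ex0 : 0 <= e * x by rewrite mulr_ge0.
have h1 : 4356%:R * (e * x * (e * x)) <= 2^-1 * x * (e * x).
  by rewrite !mulrA -[leRHS]mulrA -[leLHS]mulrA ler_wpM2r// ler_wpM2r.
apply: (le_trans h1); rewrite [leRHS]mulrC ler_wpM2l ?mulr_ge0 ?invr_ge0//.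
by rewrite ler_piMr.
Qed.

Lemma Bad_all_prob u : P (\bigcap_(k in [set k | (n <= k)%N]) BadE k (coarse k u)) = 0%E.
Proof.
have mB k z : measurable (BadE k z) by exact: measurable_BadE.
apply/eqP; rewrite eq_le measure_ge0 andbT.
have cv : (fun k => (2^-1 ^+ k)%:E) @ \oo --> (0%:E : \bar R).
  apply/fine_cvgP; split; first exact: nearW.
  by apply: cvg_expr; rewrite ger0_norm ?invr_ge0// invf_lt1// ltr1n.
apply: (cvge_ge _ cv); apply: nearW => k.
apply: le_trans (Bad_prob_decay k (coarse (n + k) u)).
apply: le_measure; rewrite ?inE//.
  by apply: bigcap_measurable; [exists n => /=|].
by move=> w; apply; rewrite /= leq_addr.
Qed.

Lemma good_ae :
  P (~` [set w | forall u, exists k, (n <= k)%N /\ ~ BadE k (coarse k u) w]) = 0%E.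
Proof.
have mB k z : measurable (BadE k z) by exact: measurable_BadE.
have mc u : measurable (\bigcap_(k in [set k | (n <= k)%N]) BadE k (coarse k u)).
  by apply: bigcap_measurable; [exists n => /=|].
rewrite (_ : ~` _ = \bigcup_(i : nat) (if (choice.unpickle i : option cell) is Some u then
   \bigcap_(k in [set k | (n <= k)%N]) BadE k (coarse k u) else set0)).
  apply: measure_negligible.
    by apply: bigcupT_measurable => i; case: choice.unpickle.
  apply: negligible_bigcup => i; case: choice.unpickle => [u|]; last exact: negligible_set0.
  by apply/negligibleP => //; exact: Bad_all_prob.
apply/seteqP; split=> w /=.
  move=> /existsNP[u /forallNP hu]; exists (choice.pickle u) => //; rewrite choice.pickleK => k nk.
  by apply: contrapT => nB; apply: (hu k).
move=> [i _]; case: choice.unpickle => // u hu /(_ u) [k [nk]]; apply; exact: hu.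
Qed.

End bad_prob.

Definition subcell (k : nat) (z : cell) (e : 'I_(6 ^ k) * 'I_(6 ^ k)) : cell :=
  ((6 ^ k)%N%:Z * z.1 + e.1%:Z, (6 ^ k)%N%:Z * z.2 + e.2%:Z).

Arguments subcell : clear implicits.

Lemma coarse_subcell k z e : coarse k (subcell k z e) = z.
Proof.
case: z e => [z1 z2] [e1 e2]; rewrite /coarse /subcell /=.
have p6 : (0 < 6 ^ k)%N by rewrite expn_gt0.
have p6' : (6 ^ k)%N%:Z != 0 by rewrite lt0r_neq0.
by congr (_, _); rewrite mulrC divzMDl// divz_small ?addr0//= ltz_nat ltn_ord.
Qed.

Lemma ord_modz (d : nat) (u : int) : (0 < d)%N ->
  exists e : 'I_d, (d%:Z * (u %/ d)%Z + e%:Z = u)%R.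
Proof.
move=> d0; have d0' : d%:Z != 0 by rewrite lt0r_neq0.
have h1 := modz_ge0 u d0'; have h2 := ltz_mod u d0'.
have hm : (absz (u %% d)%Z < d)%N by rewrite -ltz_nat gez0_abs.
by exists (Ordinal hm) => /=; rewrite gez0_abs// mulrC -divz_eq.
Qed.

Lemma subcell_surj k u : exists e, subcell k (coarse k u) e = u.
Proof.
have p6 : (0 < 6 ^ k)%N by rewrite expn_gt0.
have [e1 h1] := ord_modz u.1 p6; have [e2 h2] := ord_modz u.2 p6.
by exists (e1, e2); rewrite /subcell /coarse /= h1 h2; case: (u).
Qed.

(** * Low blue and red centres *)

Section observables.
Context (R : realType) (h : R) (bx : nat -> box) (bi : box -> nat).
Hypothesis h0 : 0 < h.
Hypothesis bxK : cancel bx bi.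
Hypothesis biK : cancel bi bx.
Variables (lam : R) (lev : R -> nat) (T : nat).
Hypothesis lam01 : 0 <= lam <= 1.
Hypothesis mlev : measurable_fun setT lev.

Definition blueU : set R := [set u | ~~ (u < lam)].
Definition redU : set R := [set u | u < lam].
Definition levU k : set R := [set v | lev v = k].

Lemma measurable_redU : measurable redU.
Proof.
rewrite (_ : redU = [set` `]-oo, lam[])//.
Qed.

Lemma blueUE : blueU = ~` redU.
Proof. by apply/seteqP; split=> u; rewrite /blueU /redU /= => /negP. Qed.

Lemma measurable_blueU : measurable blueU.
Proof. by rewrite blueUE; apply: measurableC; exact: measurable_redU. Qed.

Lemma measurable_levU k : measurable (levU k).
Proof. exact: measurable_fiber. Qed.

Lemma unif01_redU : unif01 redU = lam%:E.
Proof.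
move/andP: lam01 => [l0 l1].
transitivity (unif01 `[0, lam[); last by rewrite unif01_itv// subr0.
rewrite !unif01E; congr (lebesgue_measure _).
apply/seteqP; split=> u; rewrite /redU /= !in_itv /= => -[ul /andP[u0 u1]].
  by rewrite u0 ul u1.
by move: ul => /andP[_ ->]; rewrite u0 u1.
Qed.

Lemma unif01_blueU : unif01 blueU = (1 - lam)%:E.
Proof.
have mU : (@measurable _ (measurableTypeR R)) redU by exact: measurable_redU.
rewrite blueUE; apply: etrans (probability_setC (@unif01 R) mU) _.
by rewrite EFinB; congr (_ - _)%E; exact: unif01_redU.
Qed.

Local Notation markM := (markM h bx).
Local Notation markN := (markN h).

(** Low means in one of the first [T] layers of boxes, that is up to height [T * h]. *)
Definition nbM (u : cell) : set (Om midx R) := [set w | forall l : 'I_T, ~ markM blueU setT (u, l : nat) w].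
Definition ocM k (z : cell) : set (Om midx R) :=
  [set w | exists el : ('I_(6 ^ k) * 'I_(6 ^ k)) * 'I_T, markM redU (levU k) (subcell k z el.1, el.2 : nat) w].

Definition nbN (u : cell) : set (Om nidx R) := [set w | forall l : 'I_T, ~ markN blueU setT (bi (u, l : nat)) w].
Definition ocN k (z : cell) : set (Om nidx R) :=
  [set w | exists el : ('I_(6 ^ k) * 'I_(6 ^ k)) * 'I_T, markN redU (levU k) (bi (subcell k z el.1, el.2 : nat)) w].

Lemma measurable_forall d (X : measurableType d) (K : finType) (E : K -> set X) :
  (forall k, measurable (E k)) -> measurable [set w | forall k, ~ E k w].
Proof.
move=> mE; rewrite (_ : [set w | _] = \bigcap_(k in [set: K]) (~` E k)).
  by apply: fin_bigcap_measurable => // k _; exact: measurableC.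
by apply/seteqP; split=> w hw k; [move=> _|]; exact: hw.
Qed.

Lemma measurable_nbM u : measurable (nbM u).
Proof.
apply: (@measurable_forall _ _ _ (fun l : 'I_T => [set w | markM blueU setT (u, l : nat) w])) => l.
by apply: measurable_markM => //; exact: measurable_blueU.
Qed.

Lemma measurable_ocM k z : measurable (ocM k z).
Proof.
apply: (@measurable_exists _ _ _ (fun el : ('I_(6 ^ k) * 'I_(6 ^ k)) * 'I_T => [set w | markM redU (levU k) (subcell k z el.1, el.2 : nat) w])) => el.
by apply: measurable_markM => //; [exact: measurable_redU|exact: measurable_levU].
Qed.

Lemma measurable_nbN u : measurable (nbN u).
Proof.
apply: (@measurable_forall _ _ _ (fun l : 'I_T => [set w | markN blueU setT (bi (u, l : nat)) w])) => l.
by apply: measurable_markN => //; exact: measurable_blueU.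
Qed.

Lemma measurable_ocN k z : measurable (ocN k z).
Proof.
apply: (@measurable_exists _ _ _ (fun el : ('I_(6 ^ k) * 'I_(6 ^ k)) * 'I_T => [set w | markN redU (levU k) (bi (subcell k z el.1, el.2 : nat)) w])) => el.
by apply: measurable_markN => //; [exact: measurable_redU|exact: measurable_levU].
Qed.

Definition ucol (i : nidx) : cell := (bx (boxof i)).1.

Lemma depends_nbN u : depends_on [set i | ucol i = u] (nbN u).
Proof.
move=> w w' hw hb l hl; apply: (hb l).
apply: (@depends_markN _ h blueU setT (bi (u, l : nat)) w' w) => // i hi.
by apply/esym/hw; rewrite /= /ucol hi biK.
Qed.

Lemma depends_ocN k z : depends_on [set i | coarse k (ucol i) = z] (ocN k z).
Proof.
move=> w w' hw [el hel]; exists el.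
apply: (@depends_markN _ h redU (levU k) _ w w') => // i hi.
by apply: hw; rewrite /= /ucol hi biK coarse_subcell.
Qed.

Variable Pm : probability (Om midx R) R.
Hypothesis iidm : has_iid_coords (T := R) (@unif01 R) Pm.
Variable Pn : probability (Om nidx R) R.
Hypothesis iidn : has_iid_coords (T := R) (@unif01 R) Pn.

Lemma nbN_prob u : Pn (nbN u) = (expR (- (h * (1 - lam))) ^+ T)%:E.
Proof.
have mm l : measurable (~` [set w | markN blueU setT (bi (u, l : nat)) w]).
  by apply: measurableC; apply: measurable_markN => //; exact: measurable_blueU.
have P1 l : Pn (~` [set w | markN blueU setT (bi (u, l : nat)) w]) = (expR (- (h * (1 - lam))))%:E.
  rewrite (mark_void h0 iidn)//; last exact: measurable_blueU.
  by rewrite unif01_blueU probability_setT /= mulr1.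
transitivity (Pn (\bigcap_(l in [set` iota 0 T]) ~` [set w | markN blueU setT (bi (u, l : nat)) w])).
  congr (Pn _); apply/seteqP; split=> w hw l.
    by rewrite /= mem_iota add0n => /= lT; exact: (hw (Ordinal lT)).
  by apply: (hw l); rewrite /= mem_iota /= add0n ltn_ord.
rewrite (indep_family iidn (S := fun l => [set i | boxof i = bi (u, l)])).
- under eq_bigr do rewrite P1.
  by rewrite prodEFin big_const_seq count_predT size_iota iter_mulr_1.
- exact: iota_uniq.
- by move=> l _; exact: mm.
- by move=> l _; apply: depends_onC; exact: depends_markN.
- move=> l l' _ _ ll'; apply/seteqP; split=> i //= [-> /(can_inj biK) [] e].
  by move: ll'; rewrite e eqxx.
Qed.

Lemma markN_red_prob k m : (Pn [set w | markN redU (levU k) m w] <=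
  (h * (lam * fine (unif01 (levU k))))%:E)%E.
Proof.
set E := [set w | _].
have mE : measurable E by apply: measurable_markN => //; [exact: measurable_redU|exact: measurable_levU].
have : Pn (~` E) = (expR (- (h * (lam * fine (unif01 (levU k))))))%:E.
  rewrite (mark_void h0 iidn)//; [|exact: measurable_redU|exact: measurable_levU].
  by rewrite unif01_redU.
rewrite probability_setC// => e.
have fE : Pn E \is a fin_num by rewrite fin_num_measure.
move: e; rewrite -(fineK fE) -EFinB => -[e].
rewrite lee_fin; have := expR_ge1Dx (- (h * (lam * fine (unif01 (levU k))))).
by rewrite -e; lra.
Qed.

(** Union bound over the columns of the cell and the [T] layers; the number [6 ^ k * 6 ^ k] of
    columns will cancel against the weight of level [k]. *)
Lemma ocN_prob k z : (Pn (ocN k z) <=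
  ((6 ^ k * 6 ^ k * T)%N%:R * (h * (lam * fine (unif01 (levU k)))))%:E)%E.
Proof.
have mm m : measurable [set w | markN redU (levU k) m w].
  by apply: measurable_markN => //; [exact: measurable_redU|exact: measurable_levU].
have := @prob_exists_le _ _ _ Pn _ (fun el : ('I_(6 ^ k) * 'I_(6 ^ k)) * 'I_T => [set w | markN redU (levU k) (bi (subcell k z el.1, el.2 : nat)) w])
   _ (fun el => mm _) (fun el => markN_red_prob k _).
by rewrite !card_prod !card_ord.
Qed.

Lemma Bad_relab k z w : infinite_points h (centers w) ->
  BadE nbM ocM k z (relab h w) = BadE nbN ocN k z w.
Proof.
move=> iw; rewrite /BadE /=.
have mk A B b : markM A B b (relab h w) = markN A B (bi b) w.
  apply/propext; rewrite -{1}[b]biK; split; last exact: markN_M.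
  by apply: (markM_N h0) => //; exists bi.
rewrite (_ : nbM ^~ (relab h w) = nbN ^~ w); last first.
  by apply/funext => u; apply/propext; split=> hb l; have := hb l; rewrite mk.
rewrite (_ : (fun k z => ocM k z (relab h w)) = (fun k z => ocN k z w))//.
by apply/funext => k'; apply/funext => z'; apply/propext; split=> -[el hel]; exists el; move: hel; rewrite mk.
Qed.

Variables (e : R) (n : nat).
Hypothesis e0 : 0 <= e.
Hypothesis he : 4356%:R * e <= 2^-1.
Hypothesis hT : expR (- (h * (1 - lam))) ^+ T <= e.
Hypothesis ho : forall k, (0 < k)%N ->
  25%:R * ((6 ^ k * 6 ^ k * T)%N%:R * (h * (lam * fine (unif01 (levU k))))) <= e / 2.
Hypothesis hn : forall k, (n < k)%N -> unif01 (levU k) = 0%E.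

Definition goodM : set (Om midx R) :=
  [set w | forall u, exists k, (n <= k)%N /\ ~ BadE nbM ocM k (coarse k u) w].

Lemma good_aeM : Pm.-negligible (~` goodM).
Proof.
have gN : Pn (~` [set w | forall u, exists k, (n <= k)%N /\ ~ BadE nbN ocN k (coarse k u) w]) = 0%E.
  (* With occupation probability at most [e / 50], the 25 neighbours contribute [e / 2]. *)
  apply: (@good_ae _ _ _ Pn iidn ucol nbN ocN measurable_nbN measurable_ocN depends_nbN depends_ocN e (e / 50%:R)) => //.
  - by move=> u; rewrite nbN_prob lee_fin.
  - move=> k z k0; apply: le_trans (ocN_prob k z) _; rewrite lee_fin.
    by have := ho k0; lra.
  - move=> k z nk; apply/eqP; rewrite eq_le measure_ge0 andbT.
    by apply: le_trans (ocN_prob k z) _; rewrite hn//= !mulr0.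
  - by lra.
have mB k z : measurable (BadE nbM ocM k z).
  by apply: measurable_BadE; [exact: measurable_nbM|exact: measurable_ocM].
have mBN k z : measurable (BadE nbN ocN k z).
  by apply: measurable_BadE; [exact: measurable_nbN|exact: measurable_ocN].
have mg d (X : measurableType d) (F : nat -> cell -> set X) : (forall k z, measurable (F k z)) ->
    measurable (~` [set w | forall u, exists k, (n <= k)%N /\ ~ F k (coarse k u) w]).
  move=> mF; rewrite (_ : ~` _ = \bigcup_(u : cell) \bigcap_(k in [set k | (n <= k)%N]) F k (coarse k u)).
    apply: countable_bigcupT_measurable => [|u]; first exact: countableP.
    by apply: bigcap_measurable; [exists n => /=|].
  apply/seteqP; split=> w /=.
    move=> /existsNP[u /forallNP hu]; exists u => // k nk.
    by apply: contrapT => nB; apply: (hu k).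
  by move=> [u _ hu] /(_ u) [k [nk]]; apply; exact: hu.
apply/negligibleP; first exact: mg.
apply/eqP; rewrite eq_le measure_ge0 andbT.
apply: (@le_trans _ _ (Pn (~` [set w | forall u, exists k, (n <= k)%N /\ ~ BadE nbN ocN k (coarse k u) w]))).
  apply: (relab_le h0 iidm iidn); [exact: mg|exact: mg|].
  move=> w iw hw hW; apply: hw => u; have [k [nk nB]] := hW u; exists k; split=> //.
  by rewrite Bad_relab.
by rewrite le_eqVlt; apply/orP; left; apply/eqP; exact: gN.
Qed.

End observables.

(** * Absence of ties between heights *)

Section ties.
Context (R : realType) (h : R) (bx : nat -> box).
Hypothesis h0 : 0 < h.
Variable P : probability (Om cidx R) R.
Hypothesis iidP : has_iid_coords (T := R) (@unif01 R) P.

(** With every variable frozen except the one giving the height of the point [p], a tie prescribes a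
    single value of a uniform variable. *)
Lemma pos3_tie p q : p != q ->
  P.-negligible [set c | pos3 h bx p.1 p.2 c = pos3 h bx q.1 q.2 c].
Proof.
move=> pq; set E := [set c | _].
pose i := inr (p.1, p.2, inord 2) : cidx; pose j := inr (q.1, q.2, inord 2) : cidx.
have mp (r : nat * nat) : measurable_fun setT (pos3 h bx r.1 r.2) by exact: measurable_clip_coord.
have mE : measurable E.
  rewrite (_ : E = (fun c => pos3 h bx p.1 p.2 c - pos3 h bx q.1 q.2 c) @^-1` [set 0]).
    by rewrite -[X in measurable X]setTI; apply: (measurable_funB (mp p) (mp q)).
  apply/seteqP; split=> c; rewrite /E /= => /eqP; first by rewrite -subr_eq0 => /eqP.
  by rewrite subr_eq0 => /eqP.
have ij : i != j.
  by apply: contra pq => /eqP[e1 e2]; rewrite [p]surjective_pairing [q]surjective_pairing e1 e2.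
apply/negligibleP => //.
apply: etrans (mix_integral iidP (~` [set i]) mE) _; apply: integral0_eq => c _.
set v := pos3 h bx q.1 q.2 c.
pose F := [set c' : Om cidx R | [set v] (h * clip (c' i) + h * ((bx p.1).2)%:R)].
have PF : P F = 0%E.
  have e := P_clip_coord iidP (h * ((bx p.1).2)%:R) i h0 (measurable_set1 v).
  apply/eqP; have /eqP : (h%:E * P F = 0)%E.
    apply: etrans e _; apply/eqP; rewrite eq_le measure_ge0 andbT -(lebesgue_measure_set1 v).
    by rewrite le_measure ?inE//; apply: measurableI.
  by rewrite mule_eq0 eqe gt_eqF.
rewrite (_ : [set c' | _] = F)//.
apply/seteqP; split=> c'; rewrite /E /= /pos3 /mix.
  by rewrite memNset/=; [rewrite mem_set//=; move=> /esym/eqP; rewrite (negbTE ij)|move=> /(_ erefl)].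
by rewrite memNset/=; [rewrite mem_set//=; move=> /esym/eqP; rewrite (negbTE ij)|move=> /(_ erefl)].
Qed.

Definition no_ties (c : Om cidx R) : Prop :=
  forall i j, i != j -> (center_pt h bx i c).2 != (center_pt h bx j c).2.

Lemma no_ties_ae : P.-negligible (~` [set c | no_ties c]).
Proof.
pose N (o : option ((nat * nat) * (nat * nat))) : set (Om cidx R) :=
  if o is Some pq then if pq.1 == pq.2 then set0
    else [set c | pos3 h bx pq.1.1 pq.1.2 c = pos3 h bx pq.2.1 pq.2.2 c] else set0.
have : P.-negligible (\bigcup_k N (choice.unpickle k)).
  apply: negligible_bigcup => k; rewrite /N; case: choice.unpickle => [pq|]; last exact: negligible_set0.
  by case: eqP => [_|/eqP pq0]; [exact: negligible_set0|exact: pos3_tie].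
apply: negligibleS.
move=> c /= /existsNP[i /existsNP[j /not_implyP[ij /negP/negPn/eqP e]]].
exists (choice.pickle (sig h c i, sig h c j)) => //; rewrite choice.pickleK /N /=.
by case: eqP => [/sig_inj ee|_ //]; move: ij; rewrite ee eqxx.
Qed.

End ties.

Lemma finite_centers (R : realType) (h : R) (bx : nat -> box) b (c : Om cidx R) : 0 < h -> bijective bx ->
  infinite_points h c -> finite_set [set i | boxset h b (center_pt h bx i c)].
Proof.
move=> h0 bij ic; have [bi bxK biK] := bij.
apply: (@sub_finite_set _ _ `I_(SM h (bi b).+1 c)); last exact: finite_II.
move=> i /=; rewrite /center_pt.
have [[m' /[dup] hm /andP[h1 h2]]|[h1 _]] := sigP h c i; last first.
  by have [M] := ic i; rewrite ltnNge h1.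
rewrite (sigE hm) /= => hb.
suff -> : bi b = m' by [].
apply: (bij_inj bij); rewrite biK; apply: (boxset_uniq h0 hb); exact: pos_in_box.
Qed.

(* A red square of level [k.+1] centred in the column of one of these cells covers the unit square. *)
Definition ann_idx n := {k : 'I_n & ('I_(5 * 6 ^ k) * 'I_(6 ^ k.+1))%type}.

Definition ann_cell n (t : ann_idx n) : cell :=
  ((6 ^ tag t + (tagged t).1)%N%:Z, ((tagged t).2 : nat)%:Z).

(** The first coordinate lies between [6 ^ k] and [6 ^ k.+1], so it determines the level. Distinct
    indices thus use distinct columns, which makes their events independent. *)
Lemma ann_cell_inj n : injective (@ann_cell n).
Proof.
move=> [k [i j]] [k' [i' j']]; rewrite /ann_cell /=; case=> e1 e2.
have kk : k = k' :> nat.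
  have hi : (6 ^ k + i < 6 ^ k.+1)%N by rewrite expnS; have := ltn_ord i; lia.
  have hi' : (6 ^ k' + i' < 6 ^ k'.+1)%N by rewrite expnS; have := ltn_ord i'; lia.
  have l1 : (6 ^ k < 6 ^ k'.+1)%N by lia.
  have l2 : (6 ^ k' < 6 ^ k.+1)%N by lia.
  by move: l1 l2; rewrite !ltn_exp2l// !ltnS; lia.
have {}kk : k = k' by exact: val_inj.
subst k'; have ii : i = i' by apply: val_inj => /=; lia.
by have jj : j = j' by [apply: val_inj => /=; lia|]; rewrite ii jj.
Qed.

(** * Probability that the unit square is entirely red *)

Section visible.
Context (R : realType) (h : R) (bx : nat -> box) (bi : box -> nat).
Hypothesis h0 : 0 < h.
Hypothesis bxK : cancel bx bi.
Hypothesis biK : cancel bi bx.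
Variables (lam : R) (lev : R -> nat).
Hypothesis lam01 : 0 <= lam <= 1.
Hypothesis mlev : measurable_fun setT lev.
Variable Pm : probability (Om midx R) R.
Hypothesis iidm : has_iid_coords (T := R) (@unif01 R) Pm.
Variable Pn : probability (Om nidx R) R.
Hypothesis iidn : has_iid_coords (T := R) (@unif01 R) Pn.

Local Notation markM := (markM h bx).
Local Notation markN := (markN h).
Local Notation redU := (redU lam).
Local Notation levU := (levU lev).

(** A blue square centred below height [h] and meeting the unit square has its centre in one of
    these 25 boxes. *)
Definition clearM : set (Om midx R) :=
  [set w | forall d, ~ markM setT setT (shift2 (0, 0) d, 0%N) w].

Definition annM n : set (Om midx R) :=
  [set w | exists t : ann_idx n, markM redU (levU (tag t).+1) (ann_cell t, 0%N) w].

Definition visM n : set (Om midx R) :=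
  [set w | [/\ clearM w, annM n w, no_ties h bx (centers w) & infinite_points h (centers w)]].

Lemma measurable_clearM : measurable clearM.
Proof.
apply: (@measurable_forall _ _ _ (fun d => [set w | markM setT setT (shift2 (0, 0) d, 0%N) w])) => d.
exact: measurable_markM.
Qed.

Lemma measurable_annM n : measurable (annM n).
Proof.
apply: (@measurable_exists _ _ _ (fun t : ann_idx n => [set w | markM redU (levU (tag t).+1) (ann_cell t, 0%N) w])) => t.
by apply: measurable_markM => //; [exact: measurable_redU|exact: measurable_levU].
Qed.

Lemma mark_any_prob b : (Pm [set w | markM setT setT b w] <= h%:E)%E.
Proof.
have mN : measurable [set w | markN setT setT (bi b) w] by exact: measurable_markN.
apply: (@le_trans _ _ (Pn [set w | markN setT setT (bi b) w])).
  apply: (relab_le h0 iidm iidn) => //; first exact: measurable_markM.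
  move=> w iw; rewrite /= -{1}[b]biK; apply: (markM_N h0) => //; by exists bi.
have : Pn (~` [set w | markN setT setT (bi b) w]) = (expR (- h))%:E.
  by rewrite (mark_void h0 iidn)// probability_setT /= !mulr1.
rewrite probability_setC// => e.
have fE : Pn [set w | markN setT setT (bi b) w] \is a fin_num by rewrite fin_num_measure.
move: e; rewrite -(fineK fE) -EFinB => -[e].
by rewrite lee_fin; have := expR_ge1Dx (- h); rewrite -e; lra.
Qed.

Lemma clearM_prob : (Pm (~` clearM) <= (25%:R * h)%:E)%E.
Proof.
rewrite (_ : ~` clearM = [set w | exists d, markM setT setT (shift2 (0, 0) d, 0%N) w]); last first.
  apply/seteqP; split=> w /=; first by move=> /existsNP[d /contrapT]; exists d.
  by move=> [d hd] /(_ d).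
have := @prob_exists_le _ _ _ Pm _ (fun d : 'I_5 * 'I_5 => [set w | markM setT setT (shift2 (0, 0) d, 0%N) w])
  h (fun d => measurable_markM bx h0 _ measurableT measurableT) (fun d => mark_any_prob _).
by rewrite card_prod !card_ord.
Qed.

Variables (a : R) (n : nat).
Hypothesis hlev : forall k, (k < n)%N -> lam * fine (unif01 (levU k.+1)) = a * 36%:R ^- k.+1.

(** Level [k.+1] has [5 * 6 ^ k * 6 ^ k.+1] boxes, which is 5/6 of [36 ^ k.+1]; every level thus
    adds the same term to the exponent. *)
Lemma annM_prob : (Pm (~` annM n) <= (expR (- (5%:R / 6%:R * h * a * n%:R)))%:E)%E.
Proof.
pose E (t : ann_idx n) := [set w | markN redU (levU (tag t).+1) (bi (ann_cell t, 0%N)) w].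
have mE t : measurable (E t).
  by apply: measurable_markN => //; [exact: measurable_redU|exact: measurable_levU].
apply: (@le_trans _ _ (Pn (\bigcap_(t in [set` enum {: ann_idx n}]) ~` E t))).
  apply: (relab_le h0 iidm iidn).
  - by apply: measurableC; exact: measurable_annM.
  - by apply: fin_bigcap_measurable => // t _; exact: measurableC.
  move=> w iw nA t _ Et; apply: nA; exists t; rewrite -[X in markM _ _ X]biK.
  exact: (markN_M bx h0 Et).
have e := @indep_family _ _ _ _ _ _ iidn _ (fun t : ann_idx n => [set i | boxof i = bi (ann_cell t, 0%N)])
   (enum {: ann_idx n}) (fun t => ~` E t).
rewrite [leLHS](_ : _ = (\prod_(t <- enum {: ann_idx n}) Pn (~` E t))%E); last first.
  apply: e; first exact: enum_uniq.
  - by move=> t _; exact: measurableC.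
  - by move=> t _; apply: depends_onC; exact: depends_markN.
  - move=> t t' _ _ tt'; apply/seteqP; split=> i //= [-> /(can_inj biK) /(congr1 fst) /= ee].
    by move: tt'; rewrite (ann_cell_inj ee) eqxx.
have PE (t : ann_idx n) : Pn (~` E t) = (expR (- (h * (a * 36%:R ^- (tag t).+1))))%:E.
  rewrite (mark_void h0 iidn)//; [|exact: measurable_redU|exact: measurable_levU].
  by rewrite unif01_redU//= hlev.
rewrite big_enum /=; under eq_bigr do rewrite PE.
rewrite prodEFin lee_fin -expR_sum ler_expR.
have := @sig_big_dep _ _ (GRing.add : R -> R -> R) _ (fun k : 'I_n => ('I_(5 * 6 ^ k) * 'I_(6 ^ k.+1))%type) xpredT (fun _ _ => true) (fun k _ => - (h * (a * 36%:R ^- k.+1))).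
move=> /= ee; rewrite -[X in X <= _]ee.
under eq_bigr do rewrite sumr_const card_prod !card_ord.
rewrite (_ : \sum_(i < n) _ = \sum_(i < n) - (5%:R / 6%:R * h * a)).
  by rewrite sumr_const card_ord mulr_natr mulNrn.
apply: eq_bigr => k _; rewrite mulNrn -(mulr_natr _ (5 * 6 ^ k * 6 ^ k.+1)%N) !natrM !natrX; congr (- _).
have h6 : (6 : R) != 0 by [].
have h6k : (6 : R) ^+ k != 0 by rewrite expf_neq0.
rewrite (_ : (36 : R) = 6 * 6); last by ring.
by rewrite exprMn exprS; field; rewrite h6k.
Qed.

(** [no_ties] is known off a negligible set only, hence a measurable [G] inside [visM]. *)
Lemma visM_prob : exists G, [/\ measurable G, G `<=` visM n &
  (Pm (~` G) <= (25%:R * h + expR (- (5%:R / 6%:R * h * a * n%:R)))%:E)%E].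
Proof.
have ic := centers_iid iidm.
have mc : measurable_fun setT (fun w : Om midx R => centers w : Om cidx R) by exact: measurable_centers.
have [Z1 [mZ1 PZ1 sZ1]] := no_ties_ae bx h0 ic.
pose Z2 : set (Om cidx R) := ~` [set c | infinite_points h c].
have mZ2 : measurable Z2 by exact: measurable_infinite_points.
have PZ2 := infinite_points_ae h0 ic.
pose Z := (fun w : Om midx R => centers w : Om cidx R) @^-1` (Z1 `|` Z2).
have mZ : measurable Z by rewrite -[X in measurable X]setTI; apply: mc => //; exact: measurableU.
have PZ : (Pm Z <= 0)%E.
  apply: (@le_trans _ _ (law Pm mc (Z1 `|` Z2))) => //.
  apply: (le_trans (measureU2 _ mZ1 mZ2)).
  rewrite -[leRHS]adde0; apply: leeD; rewrite le_eqVlt; apply/orP; left; apply/eqP => //.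
have mC := measurable_clearM; have mA := measurable_annM n.
exists (clearM `&` annM n `&` ~` Z); split.
- by apply: measurableI; [exact: measurableI|exact: measurableC].
- move=> w [[cw aw] /= /not_orP[n1 /contrapT n2]]; split=> //.
  by apply: contrapT => nt; apply: n1; exact: sZ1.
rewrite !setCI setCK.
have m1 : measurable (~` clearM `|` ~` annM n) by apply: measurableU; exact: measurableC.
apply: (le_trans (measureU2 _ m1 mZ)); rewrite -[leRHS]adde0; apply: leeD => //.
apply: (le_trans (measureU2 _ (measurableC mC) (measurableC mA))).
by rewrite EFinD; apply: leeD; [exact: clearM_prob|exact: annM_prob].
Qed.

End visible.

(** The measurable events that depend on [S] only form a sigma-algebra. *)
Lemma sigma_of_family_depends (I : eqType) d (T : measurableType d) d' (T' : measurableType d')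
    (Y : nat -> Om I T -> T') (S : set I) :
  (forall i, measurable_fun setT (Y i)) ->
  (forall i w w', (forall j, S j -> w j = w' j) -> Y i w = Y i w') ->
  sigma_of_family Y `<=` [set E : set (Om I T) | measurable E /\ depends_on S E].
Proof.
move=> mY dY; apply: smallest_sub.
  split=> [|E [mE dE]|F hF] /=.
  - by split=> // w w' _.
  - by split; [rewrite setTD; exact: measurableC|rewrite setTD; exact: depends_onC].
  - split; first by apply: bigcupT_measurable => k; have [] := hF k.
    by move=> w w' hw [k _ Fk]; exists k => //; have [_ dF] := hF k; exact: dF Fk.
move=> E [i _ [B mB <-]]; split.
  by rewrite -[X in measurable X]setTI; exact: mY.
by move=> w w' hw /=; rewrite (dY i w w' hw).
Qed.

(** * The confetti model *)

Section model.
Context (R : realType) (h : R) (bx : nat -> box) (bi : box -> nat).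
Hypothesis h0 : 0 < h.
Hypothesis bxK : cancel bx bi.
Hypothesis biK : cancel bi bx.
Variables (lam : R) (lev : R -> nat).
Hypothesis lam01 : 0 <= lam <= 1.
Hypothesis mlev : measurable_fun setT lev.
Variable Pm : probability (Om midx R) R.
Hypothesis iidm : has_iid_coords (T := R) (@unif01 R) Pm.

Definition rho_fun (i : nat) (w : Om midx R) : R := 2 * 6 ^+ lev (w (inr (i, false))).
Definition eps_fun (i : nat) (w : Om midx R) : bool := w (inr (i, true)) < lam.
Definition beta_fun (w : Om midx R) : R := 2.

Lemma measurable_rho_fun i : measurable_fun setT (rho_fun i).
Proof.
apply: (@measurableT_comp _ _ _ _ _ _ (fun k : nat => 2 * 6 ^+ k : R)) => //.
by apply: (@measurableT_comp _ _ _ _ _ _ lev) => //; exact: measurable_coord.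
Qed.

Lemma measurable_eps_fun i : measurable_fun setT (eps_fun i).
Proof. by apply: measurable_fun_ltr => //; exact: measurable_coord. Qed.

Lemma measurable_beta_fun : measurable_fun setT beta_fun.
Proof. exact: measurable_cst. Qed.

Definition rho_rv i : {RV Pm >-> R} := mfun_Sub (mem_set (measurable_rho_fun i)).
Definition eps_rv i : {RV Pm >-> bool} := mfun_Sub (mem_set (measurable_eps_fun i)).
Definition beta_rv : {RV Pm >-> R} := mfun_Sub (mem_set measurable_beta_fun).
Definition center_rv i : {RV Pm >-> (R * R * R)%type} := mfun_Sub (mem_set (measurable_ctr bx h0 i)).

Lemma measurable_RV_pre d' (T' : measurableType d') (Y : {RV Pm >-> T'}) (B : set T') :
  measurable B -> measurable (Y @^-1` B).
Proof. by move=> mB; rewrite -[X in measurable X]setTI; exact: measurable_funPT. Qed.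

Lemma coords_independent d' (T' : measurableType d') (Y : nat -> {RV Pm >-> T'}) (c : nat -> midx) :
  injective c -> (forall i w w', w (c i) = w' (c i) -> Y i w = Y i w') ->
  mutually_independent Pm (fun i => events_of (Y i)).
Proof.
move=> cinj dY J A uJ hA.
apply: (indep_family iidm (S := fun i => [set c i])) => //.
- by move=> i /hA [B mB <-]; exact: measurable_RV_pre.
- by move=> i /hA [B mB <-] w w' hw /=; rewrite (dY i w w')//; exact: hw.
- by move=> i j _ _ ij; apply/seteqP; split=> k //= [-> /cinj e]; move: ij; rewrite e eqxx.
Qed.

Lemma rho_rv_iid : iid_copies Pm (rho_rv 0) rho_rv.
Proof.
split; last first.
  apply: (@coords_independent _ _ _ (fun i => inr (i, false))); first by move=> i j [].
  by move=> i w w' /= hw; rewrite /rho_fun hw.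
move=> i B mB.
have mC : measurable [set u : R | B (2 * 6 ^+ lev u)].
  rewrite -[X in measurable X]setTI.
  by apply: (@measurableT_comp _ _ _ _ _ _ (fun k : nat => 2 * 6 ^+ k : R) _ lev).
have e j : Pm (rho_rv j @^-1` B) = unif01 [set u : R | B (2 * 6 ^+ lev u)].
  exact: (iid_coord (inr (j, false)) iidm mC).
by rewrite (e i) -(e 0%N).
Qed.

Lemma beta_rv_iid : iid_copies Pm beta_rv (fun=> beta_rv).
Proof.
split=> //; apply: (@coords_independent _ _ _ (fun i => inr (i, false))) => // i j []; exact: id.
Qed.

Lemma eps_rv_bernoulli i (B : set bool) : Pm (eps_rv i @^-1` B) = bernoulli_prob lam B.
Proof.
have mU := measurable_redU lam.
have mC (c : bool) : measurable [set u : R | (u < lam) = c].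
  case: c; first exact: measurable_redU.
  rewrite (_ : [set _ | _] = blueU lam); first exact: measurable_blueU.
  by apply/seteqP; split=> u; rewrite /blueU /=; [move=> /negbT|move=> /negbTE].
have mB : measurable [set u : R | B (u < lam)].
  rewrite (_ : [set _ | _] = \bigcup_(c in B) [set u : R | (u < lam) = c]).
    by apply: fin_bigcup_measurable => // c _; exact: mC.
  by apply/seteqP; split=> u /=; [move=> Bu; exists (u < lam)|move=> [c Bc ->]].
transitivity (unif01 [set u : R | B (u < lam)]).
  exact: (iid_coord (inr (i, true)) iidm mB).
rewrite bernoulli_probE//.
have [Bt|Bt] := pselect (B true); have [Bf|Bf] := pselect (B false);
  rewrite !diracE ?(mem_set Bt) ?(mem_set Bf) ?(memNset Bt) ?(memNset Bf) ?mule1 ?mule0 ?adde0 ?add0e.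
- rewrite (_ : [set _ | _] = setT); last by apply/seteqP; split=> u //= _; case: (u < lam).
  by rewrite probability_setT -EFinD addrC subrK.
- rewrite (_ : [set _ | _] = redU lam); last first.
    by apply/seteqP; split=> u /=; rewrite /redU /=; case: (u < lam).
  exact: unif01_redU.
- rewrite (_ : [set _ | _] = blueU lam); last first.
    by apply/seteqP; split=> u /=; rewrite /blueU /=; case: (u < lam).
  exact: unif01_blueU.
- rewrite (_ : [set _ | _] = set0) ?measure0//.
  by apply/seteqP; split=> u //=; case: (u < lam).
Qed.

Lemma center_rv_poisson : unit_poisson_process Pm center_rv.
Proof.
have bij : bijective bx by exists bi.
have mc : measurable_fun setT (fun w : Om midx R => centers w : Om cidx R) by exact: measurable_centers.
have [h1 h2 h3] := center_pt_poisson h0 bij (centers_iid iidm); split.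
- by move=> i w; exact: (h1 i (centers w)).
- by move=> A k mA Aup Afin; exact: (h2 A k mA Aup Afin).
move=> A mA Aup tA J E uJ hE.
have /choice[B hB] : forall n, exists B, n \in J ->
    measurable B /\ [set w | B (point_count (center_pt h bx) (A n) (centers w))] = E n.
  move=> n; case: (boolP (n \in J)) => [/hE [B mB eB]|nJ]; last by exists set0.
  by exists B.
have := h3 A mA Aup tA J (fun n => point_count (center_pt h bx) (A n) @^-1` B n) uJ.
have hev n : n \in J -> events_of (point_count (center_pt h bx) (A n))
     (point_count (center_pt h bx) (A n) @^-1` B n).
  by move=> /hB [mB _]; exists (B n).
move=> /(_ hev) e.
transitivity (law Pm mc (\bigcap_(i in [set` J]) (point_count (center_pt h bx) (A i) @^-1` B i))).
  transitivity (Pm (\bigcap_(i in [set` J]) [set w | B i (point_count (center_pt h bx) (A i) (centers w))])).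
    by congr (Pm _); apply: eq_bigcapr => i /= iJ; have [_ ->] := hB i iJ.
  by congr (Pm _).
apply: etrans e _; rewrite big_seq [RHS]big_seq; apply: eq_bigr => n nJ.
by have [_ <-] := hB n nJ.
Qed.

Lemma rv_families_independent :
  mutually_independent Pm
      (tnth [tuple sigma_of_family center_rv; sigma_of_family rho_rv;
                   sigma_of_family (fun=> beta_rv); sigma_of_family eps_rv]).
Proof.
(* No coordinate has class 2, the class of the sides of the blue squares, because these are
   constant. *)
pose cls (i : midx) : nat := match i with inl _ => 0 | inr (_, false) => 1 | _ => 3 end.
pose S (k : 'I_4) : set midx := [set i | cls i = k].
have sub k : tnth [tuple sigma_of_family center_rv; sigma_of_family rho_rv;
      sigma_of_family (fun=> beta_rv); sigma_of_family eps_rv] k `<=` [set E : set (Om midx R) | measurable E /\ depends_on (S k) E].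
  rewrite (tnth_nth set0); case: k => [[|[|[|[|//]]]] ik] /=; apply: sigma_of_family_depends.
  - by move=> i; exact: measurable_ctr.
  - by move=> i w w' hw; congr (center_pt h bx i _); apply/funext => c; exact: hw.
  - exact: measurable_rho_fun.
  - by move=> i w w' hw /=; rewrite /rho_fun hw.
  - by move=> i; exact: measurable_beta_fun.
  - by [].
  - exact: measurable_eps_fun.
  - by move=> i w w' hw /=; rewrite /eps_fun hw.
move=> J A uJ hA; apply: (indep_family iidm (S := S)) => //.
- by move=> k /hA /sub [].
- by move=> k /hA /sub [].
- move=> k k' _ _ kk'; apply/seteqP; split=> i //= [h1 h2].
  by move: kk'; rewrite (val_inj (etrans (esym h1) h2)) eqxx.
Qed.

Lemma eps_rv_independent : mutually_independent Pm (fun i => events_of (eps_rv i)).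
Proof.
apply: (@coords_independent _ _ _ (fun i => inr (i, true))) => [i j []//|i w w' hw].
by rewrite /= /eps_fun hw.
Qed.

Definition model : confetti_model R :=
  @ConfettiModel R _ (Om midx R) Pm lam (rho_rv 0) beta_rv center_rv rho_rv (fun=> beta_rv) eps_rv
    lam01 center_rv_poisson rho_rv_iid beta_rv_iid eps_rv_bernoulli
    eps_rv_independent rv_families_independent.

End model.

(** The indicator of [G] is tested in the supremum that defines the integral; this bounds the
    covered area from below without proving it measurable in [w]. *)
Lemma prob_le_integral d (T : measurableType d) (R : realType) (P : probability T R)
    (f : T -> \bar R) (G : set T) : measurable G -> (forall w, 0 <= f w)%E ->
  (forall w, G w -> 1 <= f w)%E -> (P G <= \int[P]_w f w)%E.
Proof.
move=> mG f0 fG; rewrite ge0_integralTE//.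
apply: ereal_sup_ubound; exists (indic_nnsfun R mG); last exact: sintegral_indic.
move=> w; rewrite [X in (X <= _)%E](_ : _ = (\1_G w)%:E)// indicE; case: (boolP (w \in G)) => [/set_mem/fG//|_]; exact: f0.
Qed.

Lemma finite_argmin (R : realType) (A : set nat) (f : nat -> R) :
  finite_set A -> A !=set0 -> exists2 i, A i & forall j, A j -> f i <= f j.
Proof.
move=> /finite_seqP[s ->] [i0 /=].
elim: s i0 => [|i s IH] i0; first by rewrite in_nil.
move=> _; case: s IH => [_|k s IH].
  by exists i; [rewrite /= mem_head|move=> j; rewrite /= inE => /eqP ->].
have [j js hj] := IH k (mem_head _ _).
have [le|lt] := leP (f i) (f j).
  exists i; first by rewrite /= mem_head.
  by move=> l; rewrite /= in_cons => /predU1P[->//|/hj]; exact: le_trans.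
exists j; first by rewrite /= in_cons; apply/orP; right.
by move=> l; rewrite /= in_cons => /predU1P[->|/hj//]; exact: ltW.
Qed.

Lemma floor_dist_le (R : realType) (a b : R) (m : nat) : `|a - b| <= m%:R ->
  (absz (Num.floor a - Num.floor b)%R <= m)%N.
Proof.
move=> ab; have /andP[a1 a2] := floor_itv a; have /andP[b1 b2] := floor_itv b.
move: ab; rewrite ler_norml => /andP[ab1 ab2].
rewrite !intrD in a2 b2.
have h1 : (Num.floor a)%:~R < ((Num.floor b) + m%:Z + 1)%:~R :> R by rewrite !intrD; lra.
have h2 : (Num.floor b)%:~R < ((Num.floor a) + m%:Z + 1)%:~R :> R by rewrite !intrD; lra.
move: h1 h2; rewrite !ltr_int; lia.
Qed.

Lemma floor_itvP (R : realType) (a : R) (m : int) : m%:~R <= a < m%:~R + 1 -> Num.floor a = m.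
Proof. by move=> am; apply: floor_def; rewrite intrD. Qed.

(** * Colours of points read off the marks *)

Section coloring.
Context (R : realType) (h : R) (bx : nat -> box) (bi : box -> nat).
Hypothesis h0 : 0 < h.
Hypothesis bxK : cancel bx bi.
Hypothesis biK : cancel bi bx.
Variables (lam : R) (lev : R -> nat).
Hypothesis lam01 : 0 <= lam <= 1.
Hypothesis mlev : measurable_fun setT lev.
Variable n : nat.
Hypothesis lev1 : forall u, (0 < lev u <= n)%N.
Variable Pm : probability (Om midx R) R.
Hypothesis iidm : has_iid_coords (T := R) (@unif01 R) Pm.

Local Notation M := (model h0 bxK biK lam01 mlev iidm).
Local Notation ctr := (ctr h bx).
Local Notation markM := (markM h bx).

Lemma boxset_fcell u l (p : R * R * R) : boxset h (u, l) p -> fcell p.1 = u.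
Proof.
case: u => u1 u2; rewrite /boxset /= !in_itv /= => -[[h1 h2] _].
by rewrite /fcell (floor_itvP h1) (floor_itvP h2).
Qed.

Definition half_side i (w : Om midx R) : nat := if eps_fun lam i w then (6 ^ lev (w (inr (i, false))))%N else 1%N.

Lemma ctr_upper i w : 0 < (ctr i w).2.
Proof.
have bij : bijective bx by exists bi.
by have [+ _ _] := center_pt_poisson h0 bij (centers_iid iidm); exact.
Qed.

Lemma hitP (w : confetti_space M) x i : hit w x i <->
  `|x.1 - (ctr i w).1.1| <= (half_side i w)%:R /\ `|x.2 - (ctr i w).1.2| <= (half_side i w)%:R.
Proof.
have sE : square_side i w / 2 = (half_side i w)%:R.
  rewrite /square_side /half_side /= -/(eps_fun lam i w) /rho_fun /beta_fun; case: ifP => _.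
    by rewrite natrX mulrC mulrA mulVf// mul1r.
  by rewrite divff ?pnatr_eq0.
rewrite /hit /placed_square sE /upward_ray /=; set r := (half_side i w)%:R.
split.
  move=> [p [[q [[q1 q2] q3]]]].
  move: q1 q2; rewrite /= !in_itv /= => q1 q2 <- [<- _] /=.
  by rewrite !ler_norml; split; lra.
rewrite !ler_norml => -[/andP[a1 a2] /andP[b1 b2]].
exists (x, (ctr i w).2); split; last by split=> //=; exact/ltW/ctr_upper.
exists (x.1 - (ctr i w).1.1, x.2 - (ctr i w).1.2, 0).
  by do !split => //=; rewrite in_itv /=; lra.
by rewrite [RHS]surjective_pairing/=; congr (_, _); rewrite /= ?addr0 // [RHS]surjective_pairing; congr (_, _); rewrite /= addrC subrK.
Qed.

Variable T : nat.

(** If the square seen from [x] is centred in layer [T] or above, a low blue centre in the column of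
    [x] would be lower, and its square of half-side 1 would contain [x]. Otherwise the square seen
    is itself a low red square. *)
Lemma red_Uset (w : confetti_space M) x k : (n <= k)%N -> red_set w x ->
  Uset (fun u => nbM h bx lam T u w) (fun k z => ocM h bx lam lev T k z w) k (fcell x).
Proof.
move=> nk [i [/hitP [x1 x2] low] ei].
have [[u l] hb] := boxset_cover h0 (ctr_upper i w).
have := boxset_fcell hb => uE.
have [lT|Tl] := ltnP l T; [right|left].
  have ei' : eps_fun lam i w by [].
  rewrite /half_side ei' in x1 x2.
  set kk := lev (w (inr (i, false))) in x1 x2.
  have /andP[k1 kn] : (0 < kk <= n)%N by exact: lev1.
  exists kk, (coarse kk u); split; first by rewrite k1 (leq_trans kn).
    have [e he] := subcell_surj kk u.
    exists (e, Ordinal lT) => /=; rewrite he.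
    by exists i.
  apply: coarse_dist; rewrite mul1n -uE /cdist geq_max.
  by rewrite !floor_dist_le.
move=> l' [j []] hj; rewrite /blueU /= => ej _.
have ej' : eps_fun lam j w = false by apply/negbTE.
have hitj : hit w x j.
  apply/hitP; rewrite /half_side ej'.
  move: hj; rewrite /boxset /fcell /= !in_itv /= => -[[h1 h2] _].
  have := floor_itv x.1; have := floor_itv x.2; rewrite !intrD !ler_norml; lra.
have ji : j != i.
  by apply/eqP => e; move: ei; rewrite /= -/(eps_fun lam i w) -e ej'.
have := low j ji hitj; apply/negP; rewrite -leNgt.
move: hb hj; rewrite /boxset /= !in_itv /= => -[_ /andP[hb _]] [_ /andP[_ hj]].
apply: (le_trans hj); apply/ltW; apply: le_lt_trans hb.
rewrite -[X in _ + X]mulr1 -mulrDr; apply: ler_wpM2l; first exact: ltW.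
by rewrite natr1 ler_nat; apply: leq_trans Tl.
Qed.

Lemma good_not_percolating (w : confetti_space M) : goodM h bx lam lev T n w ->
  ~ exists2 x, red_set w x & ~ bounded_set (connected_component (red_set w) x).
Proof.
move=> gw [x rx]; apply.
have [k [nk nB]] := gw (fcell x).
apply: (bounded_component (U := Uset (fun u => nbM h bx lam T u w) (fun k z => ocM h bx lam lev T k z w) k) (K := 6 ^ k) _ _ rx).
  by move=> y; exact: red_Uset.
move=> v ruv; rewrite leqNgt; apply/negP => /ltnW hv; apply: nB.
exact: reach_Bad ruv hv.
Qed.

End coloring.

Section visible_square.
Context (R : realType) (h : R) (bx : nat -> box) (bi : box -> nat).
Hypothesis h0 : 0 < h.
Hypothesis bxK : cancel bx bi.
Hypothesis biK : cancel bi bx.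
Variables (lam : R) (lev : R -> nat).
Hypothesis lam01 : 0 <= lam <= 1.
Hypothesis mlev : measurable_fun setT lev.
Variable n : nat.
Hypothesis lev1 : forall u, (0 < lev u <= n)%N.
Variable Pm : probability (Om midx R) R.
Hypothesis iidm : has_iid_coords (T := R) (@unif01 R) Pm.

Local Notation M := (model h0 bxK biK lam01 mlev iidm).
Local Notation ctr := (ctr h bx).
Local Notation markM := (markM h bx).

Definition unit_square : set (R * R) := `[0, 1] `*` `[0, 1].

Lemma box_layer0 u l (p : R * R * R) : boxset h (u, l) p -> p.2 <= h -> l = 0%N.
Proof.
rewrite /boxset /= !in_itv /= => -[_ /andP[h1 _]] ph.
have : h * l%:R < h * 1 by rewrite mulr1; exact: lt_le_trans ph.
by rewrite ltr_pM2l// -[1]/(1%:R) ltr_nat ltnS leqn0 => /eqP.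
Qed.

Lemma box_height0 u (p : R * R * R) : boxset h (u, 0%N) p -> p.2 <= h.
Proof. by rewrite /boxset /= !in_itv /= mulr0 add0r => -[_ /andP[]]. Qed.

(** Half-sides are at most [6 ^ n], so the centres lie in finitely many boxes of the first layer; a
    lowest square can then be selected. *)
Lemma finite_low_hits (w : confetti_space M) x : infinite_points h (centers w) ->
  finite_set [set i | hit w x i /\ (ctr i w).2 <= h].
Proof.
move=> iw; have bij : bijective bx by exists bi.
pose B := (6 ^ n)%N; pose K := (2 * B).+1.
pose cellx (d : 'I_K * 'I_K) : cell := ((fcell x).1 + d.1%:Z - B%:Z, (fcell x).2 + d.2%:Z - B%:Z).
apply: (@sub_finite_set _ _ (\bigcup_(d in [set: 'I_K * 'I_K])
    [set i | boxset h (cellx d, 0%N) (ctr i w)])); last first.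
  by apply: bigcup_finite => [|d _]; [exact: finite_finset|exact: finite_centers].
move=> i /= [/hitP [x1 x2] low].
have [[u l] hb] := boxset_cover h0 (ctr_upper h0 bxK biK iidm i w).
have uE := boxset_fcell hb; have l0 := box_layer0 hb low; subst l.
have rB : (half_side lam lev i w <= B)%N.
  rewrite /half_side; case: ifP => _; last by rewrite expn_gt0.
  by have /andP[_ ln] := lev1 (w (inr (i, false))); rewrite leq_exp2l.
have hf (a b : R) : `|a - b| <= (half_side lam lev i w)%:R ->
    exists d : 'I_K, Num.floor b = Num.floor a + d%:Z - B%:Z.
  move=> /floor_dist_le hd.
  have d1 : (absz (Num.floor b - Num.floor a + B%:Z)%R < K)%N by rewrite /K; lia.
  by exists (Ordinal d1) => /=; lia.
have [d1 e1] := hf _ _ x1; have [d2 e2] := hf _ _ x2.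
exists (d1, d2) => //=; rewrite (_ : cellx _ = u)//.
by rewrite -uE /cellx /fcell /= e1 e2.
Qed.

(** Since some red square centred below [h] hits [x], the lowest square hitting [x] is also centred
    below [h], and [clearM] prevents it from being blue. *)
Lemma visible_square (w : confetti_space M) : visM h bx lam lev n w -> unit_square `<=` red_set w.
Proof.
move=> [cw [[k [d e]] [i0 [hb0 ri0 li0]]] nt iw] x; rewrite /ann_cell /= in hb0 li0; rewrite /unit_square /= !in_itv /= => -[/andP[x1 x1'] /andP[x2 x2']].
have hit0 : hit w x i0.
  apply/hitP; rewrite /half_side (_ : eps_fun lam i0 w = true)// li0.
  move: hb0; rewrite /boxset /= !in_itv /= => -[[/andP[a1 a2] /andP[b1 b2]] _].
  have l1 : 1 <= ((6 ^ k + d)%N%:Z%:~R : R).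
    have p6 : (0 < 6 ^ k)%N by rewrite expn_gt0.
    rewrite (_ : 1 = (1%:Z)%:~R)// ler_int lez_nat; lia.
  have l2 : ((6 ^ k + d)%N%:Z%:~R : R) + 1 <= (6 ^ k.+1)%:R.
    rewrite natr1 ler_nat expnS; have := ltn_ord d; lia.
  have l3 : (e%:Z%:~R : R) + 1 <= (6 ^ k.+1)%:R.
    by rewrite natr1 ler_nat; have := ltn_ord e.
  have l4 : 0 <= (e%:Z%:~R : R) by rewrite ler0n.
  by rewrite !ler_norml; lra.
have low0 := box_height0 hb0.
have [i [hi lowi] mini] := finite_argmin (fun i => (ctr i w).2) (finite_low_hits x iw)
   (ex_intro _ i0 (conj hit0 low0)).
exists i.
  split=> // j ji hj; rewrite lt_neqAle eq_sym (nt j i ji) /=.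
  have [lj|lj] := leP (ctr j w).2 h; first exact: mini.
  exact: le_trans lowi (ltW lj).
apply: contrapT => bi0.
have ei : eps_fun lam i w = false by apply/negbTE/negP.
move: hi => /hitP; rewrite /half_side ei => -[/floor_dist_le y1 /floor_dist_le y2].
have [[u l] hb] := boxset_cover h0 (ctr_upper h0 bxK biK iidm i w).
have uE := boxset_fcell hb; have l0 := box_layer0 hb lowi; subst l.
(* The unit square is closed, so the floor may be 1; the cell of a blue centre then ranges over -1,
   ..., 2, inside the range of [shift2]. *)
have f1 : 0 <= Num.floor x.1 <= 1.
  by rewrite floor_ge0 x1 /= -[1]/(1%:Z) -(ler_int R); apply: le_trans (floor_le _) x1'.
have f2 : 0 <= Num.floor x.2 <= 1.
  by rewrite floor_ge0 x2 /= -[1]/(1%:Z) -(ler_int R); apply: le_trans (floor_le _) x2'.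
have hd (a b : int) : 0 <= a <= 1 -> (absz (a - b)%R <= 1)%N -> exists d : 'I_5, b = 0 + d%:Z - 2.
  move=> ha hab; have d5 : (absz (b + 2)%R < 5)%N by lia.
  by exists (Ordinal d5) => /=; lia.
have [d1 e1] := hd _ _ f1 y1; have [d2 e2] := hd _ _ f2 y2.
apply: (cw (d1, d2)); exists i; split=> //.
by rewrite /shift2 /= -e1 -e2; move: hb; rewrite -uE.
Qed.

Lemma lebesgue2_unit_square : lebesgue2 unit_square = 1%E.
Proof.
have mR (a b : R) : @measurable _ (measurableTypeR R) `[a, b]%classic by exact: measurable_itv.
apply: etrans (product_measure1E _ _ (mR 0 1) (mR 0 1)) _.
have l1 : lebesgue_measure (`[0, 1]%classic : set R) = 1%E.
  by rewrite lebesgue_measure_itv /= lte_fin ltr01 sube0.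
by rewrite -[RHS]mule1; congr (_ * _)%E; exact: l1.
Qed.

Lemma CAF_red_ge G : measurable G -> G `<=` visM h bx lam lev n -> (Pm G <= CAF_red M)%E.
Proof.
move=> mG GV; apply: (@prob_le_integral _ _ _ Pm) => // w Gw; rewrite (_ : _ `&` _ = unit_square) ?lebesgue2_unit_square//.
by apply/seteqP; split=> x; [case|move=> sx; split=> //; apply: visible_square; [exact: GV|]].
Qed.

End visible_square.

Lemma box_enumeration : exists (bx : nat -> box) (bi : box -> nat), cancel bx bi /\ cancel bi bx.
Proof.
have : ([set: box] #= [set: nat])%card.
  rewrite card_eq_le; apply/andP; split; first exact: countableP.
  rewrite (_ : [set: nat] = snd @` [set: box]); first exact: card_image_le.
  by apply/seteqP; split=> k // _; exists (0, 0, k).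
by move=> /card_set_bijP[f]; rewrite setTT_bijective => -[g fK gK]; exists g, f.
Qed.

Lemma quantile_lt (R : realType) (pm : nat -> R) n u : (0 < n)%N ->
  (forall k, (n <= k)%N -> pm k = 0) -> (quantile pm u < n)%N.
Proof.
move=> n0 pm0; rewrite /quantile; case: pselect => [H|//].
case: ex_minnP => m hm hmin; rewrite ltnNge; apply/negP => nm.
have Fd d : \sum_(k < n + d) pm k = \sum_(k < n) pm k.
  elim: d => [|d IH]; first by rewrite addn0.
  by rewrite addnS big_ord_recr /= IH pm0 ?leq_addr// addr0.
have := hmin n.-1; rewrite prednK//.
rewrite -(subnKC (leqW nm)) Fd in hm => /(_ hm); lia.
Qed.

Lemma expR_decay (R : realType) (c d : R) : 0 < c -> 0 < d ->
  exists2 n, (0 < n)%N & expR (- (c * n%:R)) <= d.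
Proof.
move=> c0 d0; exists (Num.bound (c * d)^-1).+1 => //.
set n := _.+1; rewrite expRN invf_ple ?posrE ?expR_gt0//.
apply: le_trans (expR_ge1Dx _).
have hn : (c * d)^-1 <= n%:R.
  apply/ltW; apply: (lt_le_trans (archi_boundP _)); last by rewrite ler_nat.
  by rewrite invr_ge0 mulr_ge0// ltW.
have : c * (c * d)^-1 <= c * n%:R by rewrite ler_pM2l.
by rewrite invfM mulrA mulfV ?gt_eqF// mul1r; lra.
Qed.

(** * Truncated geometric law of the levels *)

Section levels.
Context (R : realType) (n : nat).
Hypothesis n0 : (0 < n)%N.

Definition geom36 (m : nat) : R := \sum_(k < m) 36 ^- k.+1.

Lemma geom36E m : geom36 m = (1 - 36 ^- m) / 35.
Proof.
elim: m => [|m IH]; first by rewrite /geom36 big_ord0 expr0 invr1 subrr mul0r.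
rewrite /geom36 big_ord_recr /= -/(geom36 m) IH exprS invfM.
by field; rewrite ?expf_neq0.
Qed.

Lemma geom36_gt0 : 0 < geom36 n.
Proof.
case: n n0 => // m _; rewrite /geom36 big_ord_recr /=.
apply: ltr_wpDl; first by apply: sumr_ge0 => i _; rewrite invr_ge0 exprn_ge0.
by rewrite invr_gt0 exprn_gt0.
Qed.

Lemma geom36_le : geom36 n <= 2^-1.
Proof.
rewrite geom36E; have : 0 <= 36 ^- n :> R by rewrite invr_ge0 exprn_ge0.
lra.
Qed.

Definition level_pmf (k : nat) : R := if (k < n)%N then 36 ^- k.+1 / geom36 n else 0.

(** The successor turns the values 0, ..., n - 1 of the quantile into the levels 1, ..., n. *)
Definition level (u : R) : nat := (quantile level_pmf u).+1.

Lemma level_pmf_ge0 k : 0 <= level_pmf k.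
Proof.
rewrite /level_pmf; case: ifP => // _.
by rewrite divr_ge0 ?ltW ?geom36_gt0// invr_gt0 exprn_gt0.
Qed.

Lemma level_pmf0 k : (n <= k)%N -> level_pmf k = 0.
Proof. by rewrite /level_pmf ltnNge => ->. Qed.

Lemma cvg_sum_level_pmf : (fun m => \sum_(k < m) level_pmf k) @ \oo --> (1 : R).
Proof.
apply: cvg_near_cst; exists n => // m /= nm.
rewrite -(subnKC nm); elim: (m - n)%N => [|d IH].
  rewrite addn0 (eq_bigr (fun k : 'I_n => 36 ^- k.+1 / geom36 n)).
    by rewrite -mulr_suml divff// gt_eqF// geom36_gt0.
  by move=> k _; rewrite /level_pmf ltn_ord.
by rewrite addnS big_ord_recr /= IH level_pmf0 ?leq_addr// addr0.
Qed.

Lemma level_itv u : (0 < level u <= n)%N.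
Proof. by rewrite /level /=; apply: quantile_lt => // k; exact: level_pmf0. Qed.

Lemma measurable_level : measurable_fun setT level.
Proof.
apply: (@measurableT_comp _ _ _ _ _ _ S) => //.
by apply: measurable_quantile => k; exact: level_pmf_ge0.
Qed.

Lemma levU_level k : unif01 (levU level k.+1) = (level_pmf k)%:E.
Proof.
rewrite -(quantile_law level_pmf_ge0 cvg_sum_level_pmf).
by congr (unif01 _); apply/seteqP; split=> u; rewrite /levU /level /=; [case|move=> ->].
Qed.

End levels.

(** * Choice of the constants *)

Lemma confetti_exists (R : realType) (t : R)
    (Pm : probability (Om midx R) R) (iidm : has_iid_coords (T := R) (@unif01 R) Pm)
    (Pn : probability (Om nidx R) R) (iidn : has_iid_coords (T := R) (@unif01 R) Pn) :
  0 < t < 1 ->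
  exists M : confetti_model R,
    [/\ positive_bounded (rho M), positive_bounded (beta M),
        (t%:E < CAF_red M)%E
      & red_does_not_percolate M].
Proof.
move=> /andP[t0 t1].
have [bx [bi [bxK biK]]] := box_enumeration.
(* The bound [25 * h] on the failure of [clearM] is [(1 - t) / 4]; the absence of a covering red
   square will cost at most as much again. *)
pose h : R := (1 - t) / 100.
have h0 : 0 < h by rewrite /h divr_gt0// subr_gt0.
have [e [e0 he]] : exists e : R, 0 < e /\ 4356%:R * e <= 2^-1.
  exists (2^-1 / 4356%:R); split; first by rewrite divr_gt0 ?invr_gt0 ?ltr0n.
  by rewrite mulrC divfK ?pnatr_eq0.
(* [h / 2] bounds [h * (1 - lam)] from below, because [lam <= 2^-1] whatever [a <= 1] and [n]
   are. *)
have [T T0 hT] := expR_decay (divr_gt0 h0 (ltr0n R 2)) e0.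
have T0' : 0 < T%:R :> R by rewrite ltr0n.
(* The quotient ensures [25 * T * h * a <= e / 2], as the occupation bound requires; the minimum
   with 1 keeps [lam] below 1/2. *)
pose a : R := Num.min 1 (e / (50 * T%:R * h)).
have d50 : 0 < 50 * T%:R * h by rewrite mulr_gt0// mulr_gt0.
have q0 : 0 < e / (50 * T%:R * h) by rewrite divr_gt0.
have a0 : 0 < a by rewrite /a lt_min ltr01 q0.
have a1 : a <= 1 by rewrite /a ge_min lexx.
have aq : 50 * T%:R * h * a <= e.
  by rewrite mulrC -ler_pdivlMr// /a ge_min lexx orbT.
have d0 : 0 < (1 - t) / 4 by rewrite divr_gt0// subr_gt0.
have c0 : 0 < 5 / 6 * h * a by rewrite mulr_gt0// mulr_gt0// divr_gt0.
have [n n0 hn] := expR_decay c0 d0.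
(* This undoes the normalisation of [level_pmf]: red squares of level [k] get weight exactly
   [a * 36 ^- k]. *)
pose lam := a * geom36 R n.
have S0 := geom36_gt0 R n0; have S1 := @geom36_le R n.
have lam_le : lam <= 2^-1 by apply: le_trans (ler_piMl _ a1) S1; exact: ltW.
have lam01 : 0 <= lam <= 1 by rewrite mulr_ge0 ?ltW//=; lra.
have mlev := measurable_level (R := R) n0.
have hlev k : (k < n)%N -> lam * fine (unif01 (levU (@level R n) k.+1)) = a * 36%:R ^- k.+1.
  move=> kn; rewrite levU_level//= /level_pmf kn /lam mulrA -[in LHS](mulrA a) (mulrC (geom36 R n)).
  by rewrite mulrA mulfK// gt_eqF.
have hlev0 k : (n < k)%N -> unif01 (levU (@level R n) k) = 0%E.
  by case: k => // k nk; rewrite levU_level// level_pmf0.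
exists (model h0 bxK biK lam01 mlev iidm); split.
- split; first by move=> w; rewrite mulr_gt0 ?exprn_gt0.
  exists (2 * 6 ^+ n) => w; rewrite ler_pM2l//; apply: ler_weXn2l; first by rewrite ler1n.
  by have /andP[] := level_itv n0 (w (inr (0%N, false))).
- by split; [move=> w; exact: ltr0n|exists 2].
- have [G [mG GV PG]] := visM_prob h0 bxK biK lam01 mlev iidm iidn hlev.
  apply: lt_le_trans (CAF_red_ge h0 bxK biK lam01 mlev (level_itv n0) iidm mG GV).
  have fG : Pm G \is a fin_num by rewrite fin_num_measure.
  move: PG; rewrite probability_setC// -(fineK fG) -EFinB lee_fin lte_fin.
  by move: hn; rewrite /h; lra.
- have := good_aeM h0 bxK biK lam01 mlev iidm iidn (T := T) (e := e) (n := n) (ltW e0).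
  move=> /(_ he) H.
  apply: negligibleS (H _ _ hlev0).
  + move=> w /= nw gw; apply: nw; exact: (good_not_percolating (level_itv n0) gw).
  + rewrite -expRM_natl; apply: le_trans hT; rewrite ler_expR.
    have : h / 2 * T%:R <= h * (1 - lam) * T%:R by rewrite ler_pM2r// ler_pM2l//; lra.
    lra.
  move=> k k0; have [nk|kn] := ltnP n k.
    by rewrite hlev0//= !mulr0 divr_ge0// ltW.
  case: k k0 kn => // k _ kn; rewrite hlev// !natrM !natrX.
  have h36 : (36 : R) ^+ k.+1 != 0 by rewrite expf_neq0.
  (* The number of columns cancels the weight of the level, so the bound is the same for all
     levels. *)
  rewrite (_ : _ * _ = 25 * T%:R * h * a); first by lra.
  rewrite (_ : (36 : R) = 6 * 6); last by ring.
  by rewrite exprMn; field; rewrite expf_neq0.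
Qed.

Theorem theorem1p3 (R : realType) (t : R) (ht : 0 < t < 1) :
  exists M : confetti_model R,
    [/\ positive_bounded (rho M), positive_bounded (beta M),
        (t%:E < CAF_red M)%E
      & red_does_not_percolate M].
Proof. exact: (@confetti_exists R t (Punif midx R) (@Punif_iid midx R) (Punif nidx R) (@Punif_iid nidx R) ht). Qed.
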